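(* Let $p$ be a prime and let $m,h$ be positive integers such that $m>1$ divides $p^h-1$. Then the $p$-rank of the curve $\mathcal{F}_{m,p^h-1}: y^m = x^{p^h-1} + 1$ over $\overline{\mathbb{F}}_p$ is $$\gamma = \sum_{j=1}^{m-1} \left( \prod_{r=1}^h (a_{j,r}+1) \right) - 2(m-1),$$ where $a_{j,1}, \ldots, a_{j,h}\in\{0,\dots,p-1\}$ are the coefficients in the base-$p$ expansion of $j(p^h-1)/m$, i.e. $j(p^h-1)/m=a_{j,1}p^{h-1}+\cdots+a_{j,h-1}p+a_{j,h}$. In particular, if $m$ divides $p-1$, then $$\gamma = \sum_{j=1}^{m-1} \left( \frac{j(p-1)}{m} + 1 \right)^h - 2(m-1).$$
   Context: A ''curve'' given by an affine equation over $\overline{\mathbb{F}}_p$ means the nonsingular, projective, irreducible curve whose function field is defined by that equation. The $p$-rank $\gamma(\mathcal{X})$ of a curve $\mathcal{X}$ with Jacobian $J$ is the integer such that $J[p](\overline{\mathbb{F}}_p)\cong(\mathbb{Z}/p\mathbb{Z})^{\gamma(\mathcal{X})}$; a curve of genus $0$ has $p$-rank $0$. *)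

(* Defs.v *)
From HB Require Import structures.
From mathcomp Require Import all_boot all_order all_algebra all_field.
From mathcomp Require Import boolp.
From mathcomp Require Import freeg.
Set Implicit Arguments.
Unset Strict Implicit.
Unset Printing Implicit Defensive.
Import Order.TTheory GRing.Theory Num.Theory.
Local Open Scope ring_scope.

Definition algebraic_closure_Fp (p : nat) (k : closedFieldType)
    (iota : {rmorphism 'F_p -> k}) : Prop :=
  forall a : k, algebraicOver iota a.

(* A function field of one variable over k is a finite extension of the       *)
(* rational function field k(x) = {fraction {poly k}}.                        *)
Notation ratfun k := ({fraction {poly k}})%type.

(* [poly_fun] is the canonical map k[x] -> K.                                 *)
Definition poly_fun (k : closedFieldType) (K : fieldExtType (ratfun k))
  (c : {poly k}) : K := (FracField.tofrac c)%:A.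

(* K is the field k(x, y) with F(x, y) = 0; the inner variable of F is x and  *)
(* the outer one is y.                                                        *)
Definition function_field_of (k : closedFieldType) (F : {poly {poly k}})
    (K : fieldExtType (ratfun k)) : Prop :=
  exists2 y : K, root (map_poly (poly_fun K) F) y & <<1; y>>%VS = fullv.

(* The points of the nonsingular projective curve with function field K,      *)
(* i.e. the normalized discrete valuations of K that are trivial on k.  The   *)
(* value at 0, mathematically +oo, is pinned to 0 so that two places with the *)
(* same valuation are equal.                                                  *)
Record place (k : closedFieldType) (K : fieldExtType (ratfun k)) := Place {
  ord :> K -> int;
  ord_at0 : ord 0 = 0;
  ordM : forall f g : K, f != 0 -> g != 0 -> ord (f * g) = ord f + ord g;
  ordD : forall f g : K, f != 0 -> g != 0 -> f + g != 0 ->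
           Num.min (ord f) (ord g) <= ord (f + g);
  ordC : forall c : k, c != 0 -> ord (poly_fun K c%:P) = 0;
  ord_uniformizer : exists t : K, ord t = 1
}.

HB.instance Definition _ k K := gen_eqMixin (@place k K).
HB.instance Definition _ k K := gen_choiceMixin (@place k K).

(* The group of divisors of degree 0 on a set T of points, all of degree 1.   *)
Definition deg0_pred (T : choiceType) : {pred {freeg T}} :=
  fun D => deg D == 0.

Lemma deg0_zmod_closed (T : choiceType) : zmod_closed (@deg0_pred T).
Proof.
split; rewrite ?unfold_in /deg0_pred ?deg0 // => D E.
by rewrite !unfold_in /deg0_pred degB => /eqP-> /eqP->; rewrite subr0.
Qed.
HB.instance Definition _ (T : choiceType) :=
  GRing.isZmodClosed.Build _ (@deg0_pred T) (@deg0_zmod_closed T).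

Record div0 (T : choiceType) := Div0 {
  div0_val :> {freeg T};
  div0P : div0_val \in @deg0_pred T
}.
HB.instance Definition _ (T : choiceType) := [isSub for @div0_val T].
HB.instance Definition _ (T : choiceType) := [Choice of div0 T by <:].
HB.instance Definition _ (T : choiceType) :=
  [SubChoice_isSubZmodule of div0 T by <:].

(* D is the divisor of a nonzero function.  Every place of K has degree 1,    *)
(* because k is algebraically closed.                                         *)
Definition principal (k : closedFieldType) (K : fieldExtType (ratfun k)) :
  {pred div0 (place K)} :=
  fun D => `[< exists2 f : K, f != 0 &
               forall P : place K, coeff P D = P f >].

Lemma ord1 k K (P : @place k K) : P 1 = 0.
Proof.
have /eqP := ordM P (oner_neq0 _) (oner_neq0 _).
by rewrite mulr1 -subr_eq0 opprD addrA subrr sub0r oppr_eq0 => /eqP.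
Qed.

Lemma ordV k K (P : @place k K) (f : K) : f != 0 -> P f^-1 = - P f.
Proof.
move=> f0; have fV0 : f^-1 != 0 by rewrite invr_eq0.
by have := ordM P f0 fV0; rewrite divff // ord1 => /esym/eqP;
   rewrite addrC addr_eq0 => /eqP.
Qed.

Lemma principal_zmod_closed k K : zmod_closed (@principal k K).
Proof.
split=> [|D E].
  by apply/asboolP; exists 1; [exact: oner_neq0|] => P; rewrite coeff0 ord1.
move=> /asboolP[f f0 fD] /asboolP[g g0 gE]; apply/asboolP.
have gV0 : g^-1 != 0 by rewrite invr_eq0.
exists (f / g) => [|P]; first by rewrite mulf_neq0.
by rewrite ordM // ordV // coeffB fD gE.
Qed.
HB.instance Definition _ k K :=
  GRing.isZmodClosed.Build _ (@principal k K) (@principal_zmod_closed k K).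

(* Pic^0 of the curve, i.e. the group J(k) of k-points of its Jacobian J. *)
Definition Jac (k : closedFieldType) (K : fieldExtType (ratfun k)) : zmodType :=
  Quotient.quot (@principal k K).

(* J[p](k) is isomorphic to (Z/pZ)^g. *)
Definition is_p_rank (p : nat) (k : closedFieldType)
    (K : fieldExtType (ratfun k)) (g : nat) : Prop :=
  exists2 f : {additive 'rV['F_p]_g -> Jac K},
    injective f & forall c : Jac K, c *+ p = 0 <-> exists v, f v = c.

(* y^m = x^n + 1 *)
Definition curve_F (k : closedFieldType) (m n : nat) : {poly {poly k}} :=
  'X^m - ('X^n + 1)%:P.

(* Main.v *)
From HB Require Import structures.
Require Import Defs.
From mathcomp Require Import all_boot all_order all_algebra all_field.
From mathcomp Require Import boolp freeg.
From mathcomp Require Import zify ring.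
Set Implicit Arguments.
Unset Strict Implicit.
Unset Printing Implicit Defensive.
Import Order.TTheory GRing.Theory Num.Theory.
Local Open Scope ring_scope.

(** Let [K] be the function field of the curve [y ^ m = x ^ n + 1], where
    [n = p ^ h - 1].  A [p]-torsion class [c] of the Jacobian gives a function
    [f], whose divisor is [p] times a divisor of class [c], and the differential
    [df / f].  As the residues of [df / f] are the orders of [f], which are
    multiples of [p], this differential is holomorphic; it only depends on [c],
    and every holomorphic logarithmic differential arises from exactly one class.
    So the [p]-rank is the dimension over the prime field of the space of
    holomorphic logarithmic differentials ([hol_dlog], [torsion_classE], [p_rank_ordinary]).

    The geometry behind this is elementary, because the curve is the union of two
    affine pieces with the same equation, in the coordinates [x], [y] and in
    [1 / x], [y / x ^ (n / m)] ([model_inf]).  A place is the order of vanishing at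
    a point of one of the pieces ([ordp_uniq], [place_point]); this gives the
    fibers of [x] ([fiber]), and, with norms to [k(x)], the fact that principal
    divisors have degree zero ([principal_deg0]).  The elements
    [1, x, .., x ^ p.-1] form a basis of [K] over its [p]-th powers
    ([curve_p_basis]), hence there is a derivation [D] with [D x = 1]
    ([derivation_ex]), and by a formula of Jacobson [g dx] is logarithmic when [D ^ p.-1 g + g ^ p = 0] ([log_diff]).

    Holomorphic differentials have the basis [x ^ i.-1 / y ^ j dx] for
    [0 < i < j n / m] and [j < m] ([hol_mono], [hol_expand]).  Write [d] and [l]
    for the leading digits in base [p] of [j n / m] and of [i].  Multiplication
    by [p] modulo [m], resp. [p ^ h - 1], rotates the digits, and the Cartier
    operator takes the monomial of the rotated pair to that of [(i, j)] times the
    binomial coefficient of [d] and [l] ([cartier_mono]), which is nonzero when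
    [l <= d].  So the coefficients of a logarithmic differential satisfy a
    Frobenius-semilinear system that permutes the indices, and they are supported
    on the indices for which all the digits of [i] are at most those of [j n / m]
    ([log_hol]).  On these the system is invertible, and by Lang's argument its
    solutions are a vector space over the prime field whose dimension is the
    number of indices ([lang]).  For each [j] with [0 < j < m] the product of the
    [a + 1] over the digits [a] of [j n / m] counts the numbers that are digitwise
    at most [j n / m]; the two extreme ones, [0] and [j n / m], are not allowed
    ([card_ordinary]). *)

(** * Valuations *)

Section Valuation.
Variables (k K : fieldType) (kap : {rmorphism k -> K}).

(** The axioms of a place, for a bare function on a field [K] over [k]. *)
Record valuation (v : K -> int) : Prop := Valuation {
  val_at0 : v 0 = 0;
  valM : forall f g, f != 0 -> g != 0 -> v (f * g) = v f + v g;
  valD : forall f g, f != 0 -> g != 0 -> f + g != 0 ->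
           Num.min (v f) (v g) <= v (f + g);
  valC : forall c : k, c != 0 -> v (kap c) = 0;
  val_unif : exists t, v t = 1
}.

(** The sub-level sets of a valuation; [0] is put in all of them, so that they
    are closed under addition although the value at [0] is pinned to [0]. *)
Definition vge (v : K -> int) (r : int) (f : K) := (f == 0) || (r <= v f).

Variables (v : K -> int) (hv : valuation v).

Lemma val1 : v 1 = 0.
Proof.
have /eqP := valM hv (oner_neq0 _) (oner_neq0 _).
by rewrite mulr1 -subr_eq0 opprD addrA subrr sub0r oppr_eq0 => /eqP.
Qed.

Lemma valN f : v (- f) = v f.
Proof.
have [->|f0] := eqVneq f 0; first by rewrite oppr0.
have n1 : (-1 : K) != 0 by rewrite oppr_eq0 oner_neq0.
have := valC hv (c := -1); rewrite rmorphN1 oppr_eq0 oner_neq0 => /(_ isT) h.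
by rewrite -mulN1r (valM hv) // h add0r.
Qed.

Lemma valV f : v f^-1 = - v f.
Proof.
have [->|f0] := eqVneq f 0; first by rewrite invr0 (val_at0 hv) oppr0.
have fV0 : f^-1 != 0 by rewrite invr_eq0.
by have := valM hv f0 fV0; rewrite divff // val1 => /esym/eqP;
   rewrite addrC addr_eq0 => /eqP.
Qed.

Lemma val_div f g : f != 0 -> g != 0 -> v (f / g) = v f - v g.
Proof. by move=> f0 g0; rewrite (valM hv) ?invr_eq0 // valV. Qed.

Lemma valX f (i : nat) : v (f ^+ i) = v f *+ i.
Proof.
have [->|f0] := eqVneq f 0.
  by rewrite expr0n (val_at0 hv) mul0rn; case: i => [|i]; rewrite ?val1 ?(val_at0 hv).
elim: i => [|i IH]; first by rewrite expr0 val1.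
by rewrite exprS (valM hv) ?expf_neq0 // IH mulrS.
Qed.

Lemma val_prod (I : Type) (s : seq I) (F : I -> K) :
  (forall i, F i != 0) -> v (\prod_(i <- s) F i) = \sum_(i <- s) v (F i).
Proof.
move=> F0; elim: s => [|i s IH]; first by rewrite !big_nil val1.
by rewrite !big_cons (valM hv) // ?IH //; elim/big_rec: _ => [|j f _ f0];
   rewrite ?oner_neq0 ?mulf_neq0.
Qed.

Lemma vge0f r : vge v r 0. Proof. by rewrite /vge eqxx. Qed.

Lemma vge_neq0 r f : f != 0 -> vge v r f = (r <= v f).
Proof. by rewrite /vge => /negbTE->. Qed.

Lemma vge_le r s f : r <= s -> vge v s f -> vge v r f.
Proof. by rewrite /vge => rs /orP[->//|h]; rewrite (le_trans rs h) orbT. Qed.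

Lemma vgeD r f g : vge v r f -> vge v r g -> vge v r (f + g).
Proof.
rewrite /vge; have [->|f0] := eqVneq f 0; first by rewrite add0r.
have [->|g0] := eqVneq g 0; first by rewrite addr0 (negbTE f0).
rewrite /= => rf rg; have [//|fg0 /=] := eqVneq (f + g) 0.
by apply: le_trans (valD hv f0 g0 fg0); rewrite le_min rf.
Qed.

Lemma vgeN r f : vge v r (- f) = vge v r f.
Proof. by rewrite /vge oppr_eq0 valN. Qed.

Lemma vgeB r f g : vge v r f -> vge v r g -> vge v r (f - g).
Proof. by move=> rf rg; rewrite vgeD ?vgeN. Qed.

Lemma vgeM r s f g : vge v r f -> vge v s g -> vge v (r + s) (f * g).
Proof.
rewrite /vge; have [->|f0] := eqVneq f 0; first by rewrite mul0r eqxx.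
have [->|g0] := eqVneq g 0; first by rewrite mulr0 eqxx.
by rewrite /= => rf rg; rewrite (valM hv) // lerD ?orbT.
Qed.

Lemma vge_sum r (I : Type) (s : seq I) (Q : pred I) (F : I -> K) :
  (forall i, Q i -> vge v r (F i)) -> vge v r (\sum_(i <- s | Q i) F i).
Proof.
by move=> h; elim/big_rec: _ => [|i f Qi]; [exact: vge0f | apply: vgeD; apply: h].
Qed.

Lemma vge_kap c : vge v 0 (kap c).
Proof.
have [->|c0] := eqVneq c 0; first by rewrite rmorph0 vge0f.
by rewrite /vge (valC hv c0) lexx orbT.
Qed.

Lemma vge1_kap c : vge v 1 (kap c) -> c = 0.
Proof.
have [->//|c0] := eqVneq c 0.
by rewrite vge_neq0 ?fmorph_eq0 // (valC hv c0).
Qed.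

Lemma vgeX r f (i : nat) : vge v r f -> vge v (r *+ i) (f ^+ i).
Proof.
move=> h; elim: i => [|i IH]; first by rewrite expr0 /vge val1 mulr0n lexx orbT.
by rewrite exprS mulrS; apply: vgeM.
Qed.

Lemma vge0M f g : vge v 0 f -> vge v 0 g -> vge v 0 (f * g).
Proof. by move=> hf hg; rewrite -[0]addr0 vgeM. Qed.

Lemma vge0X f i : vge v 0 f -> vge v 0 (f ^+ i).
Proof. by move=> /(vgeX i); rewrite mul0rn. Qed.

Lemma vge0_expr f i : (0 < i)%N -> vge v 0 (f ^+ i) -> vge v 0 f.
Proof.
rewrite /vge expf_eq0 valX => i0; rewrite i0 /= => /orP[->//|h]; apply/orP; right.
by rewrite leNgt; apply/negP => h1; move: h; rewrite leNgt pmulrn_llt0 // h1.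
Qed.

(** The ultrametric inequality is sharp when the two values differ. *)
Lemma val_dom f g : f != 0 -> vge v (v f + 1) g ->
  f + g != 0 /\ v (f + g) = v f.
Proof.
move=> f0 hg; have fg0 : f + g != 0.
  apply: contraTneq hg => /eqP; rewrite addr_eq0 => /eqP fE.
  have g0 : g != 0 by rewrite -oppr_eq0 -fE.
  by rewrite vge_neq0 // fE valN; lia.
split=> //; have [g0|g0] := eqVneq g 0; first by rewrite g0 addr0.
move: hg; rewrite vge_neq0 // => hg.
have h1 := valD hv f0 g0 fg0.
have ng0 : - g != 0 by rewrite oppr_eq0.
have h2 := valD hv fg0 ng0; rewrite addrK valN in h2.
have := h2 f0; move: h1; rewrite /Num.min; do 2 case: ifP; lia.
Qed.

Lemma vge_prod1 (I : eqType) (s : seq I) (F : I -> K) :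
  (forall i, i \in s -> vge v 0 (F i)) -> vge v 1 (\prod_(i <- s) F i) ->
  exists2 i, i \in s & vge v 1 (F i).
Proof.
elim: s => [|i s IH] h.
  by rewrite big_nil vge_neq0 ?oner_neq0 // val1.
rewrite big_cons; have [hi _|hi] := boolP (vge v 1 (F i)).
  by exists i; rewrite ?mem_head.
move=> hp; case: IH.
- by move=> j js; apply: h; rewrite in_cons js orbT.
- have := h i (mem_head _ _); move: hi; rewrite /vge negb_or => /andP[fi0 fi1].
  rewrite (negbTE fi0) /= => fi2.
  have vi : v (F i) = 0 by lia.
  move: hp; rewrite /vge mulf_eq0 (negbTE fi0) /= => /orP[->//|].
  have [->//|p0] := eqVneq (\prod_(j <- s) F j) 0.
  by rewrite (valM hv) // vi add0r => ->; rewrite orbT.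
- by move=> j js hj; exists j => //; rewrite in_cons js orbT.
Qed.

End Valuation.

(** Terms with distinct values cannot cancel: the one of least value dominates. *)
Lemma sum_val_distinct (k K : fieldType) (kap : {rmorphism k -> K}) v (d : nat)
    (F : 'I_d -> K) : valuation kap v ->
  (forall i j, F i != 0 -> F j != 0 -> v (F i) = v (F j) -> i = j) ->
  \sum_i F i = 0 -> forall i, F i = 0.
Proof.
move=> hv Fd F0 i; apply/eqP; apply/negPn/negP => Fi.
have [j Fj jmin] := @arg_minP _ _ _ i (fun j => F j != 0) (fun j => v (F j)) Fi.
have := val_dom hv Fj (g := \sum_(l | l != j) F l).
have -> : F j + \sum_(l | l != j) F l = 0 by rewrite -[RHS]F0 [RHS](bigD1 j).
rewrite eqxx => h; suff : false /\ v 0 = v (F j) by case.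
apply: h; apply: (vge_sum hv) => l lj.
have [->|Fl] := eqVneq (F l) 0; first exact: vge0f.
rewrite vge_neq0 // lezD1 lt_neqAle jmin // andbT.
by apply: contra_neq lj => /Fd -> //.
Qed.

(** * Affine models of the curve and their points *)

Section Model.
Variables (k : closedFieldType) (K : fieldType) (kap : {rmorphism k -> K}).
Variables (m n : nat).

Definition eval_x (x : K) : {poly k} -> K := horner_eval x \o map_poly kap.
HB.instance Definition _ x := GRing.RMorphism.on (eval_x x).
Local Notation evx := eval_x.

Definition eval_xy (x y : K) : {poly {poly k}} -> K :=
  horner_eval y \o map_poly (evx x).
HB.instance Definition _ x y := GRing.RMorphism.on (eval_xy x y).
Local Notation ev := eval_xy.

Definition eval_pt (a b : k) : {poly {poly k}} -> k :=
  horner_eval a \o horner_eval b%:P.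
HB.instance Definition _ a b := GRing.RMorphism.on (eval_pt a b).
Local Notation evp := eval_pt.

Arguments eval_x : simpl never.
Arguments eval_xy : simpl never.
Arguments eval_pt : simpl never.

Lemma evxC x c : evx x c%:P = kap c.
Proof. by rewrite /eval_x /= map_polyC /horner_eval hornerC. Qed.

Lemma evxX x : evx x 'X = x.
Proof. by rewrite /eval_x /= map_polyX /horner_eval hornerX. Qed.

Lemma evC x y r : ev x y r%:P = evx x r.
Proof. by rewrite /eval_xy /= map_polyC /horner_eval hornerC. Qed.

Lemma evX x y : ev x y 'X = y.
Proof. by rewrite /eval_xy /= map_polyX /horner_eval hornerX. Qed.

Lemma evpC a b r : evp a b r%:P = r.[a].
Proof. by rewrite /eval_pt /= /horner_eval hornerC. Qed.

Lemma evpX a b : evp a b 'X = b.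
Proof. by rewrite /eval_pt /= /horner_eval hornerX hornerC. Qed.

Lemma evB x y : {morph ev x y : G H / G - H}.
Proof. exact: rmorphB. Qed.

Lemma evE x y (G : {poly {poly k}}) d : (size G <= d)%N ->
  ev x y G = \sum_(j < d) evx x G`_j * y ^+ j.
Proof.
move=> sG; rewrite /eval_xy /= /horner_eval (horner_coef_wide _ (n := d)).
  by apply: eq_bigr => i _; rewrite coef_map.
exact: leq_trans (size_poly _ _) sG.
Qed.

(** [x] and [y] generate [K], and satisfy no other relation than
    [y ^ m = x ^ n + 1].  The curve has two such systems of generators: the
    coordinates themselves and those at infinity. *)
Record model (x y : K) : Prop := Model {
  model_eq : y ^+ m = x ^+ n + 1;
  model_rep : forall f, exists G r, evx x r != 0 /\ f = ev x y G / evx x r;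
  model_free : forall G : {poly {poly k}}, (size G <= m)%N -> ev x y G = 0 -> G = 0
}.

Variables (m_gt0 : (0 < m)%N) (n_gt0 : (0 < n)%N).
Variables (mk : m%:R != 0 :> k) (nk : n%:R != 0 :> k).
Variables (x y : K) (mod : model x y).

Lemma evx_inj r : evx x r = 0 -> r = 0.
Proof.
move=> r0; have := @model_free _ _ mod r%:P; rewrite evC size_polyC => h.
apply/eqP; rewrite -polyC_eq0; apply/eqP/h => //.
by case: (r != 0).
Qed.

Lemma evx_eq0 r : (evx x r == 0) = (r == 0).
Proof. by apply/eqP/eqP => [/evx_inj|->]; rewrite ?rmorph0. Qed.

Lemma xsub_neq0 a : x - kap a != 0.
Proof.
have -> : x - kap a = evx x ('X - a%:P) by rewrite rmorphB /= evxX evxC.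
by rewrite evx_eq0 polyXsubC_eq0.
Qed.

Lemma x_neq0 : x != 0.
Proof. by have := xsub_neq0 0; rewrite rmorph0 subr0. Qed.

Lemma xn1_neq0 : x ^+ n + 1 != 0.
Proof.
have -> : x ^+ n + 1 = evx x ('X^n + 1) by rewrite rmorphD rmorphXn rmorph1 /= evxX.
by rewrite evx_eq0 -size_poly_eq0 size_XnaddC.
Qed.

Lemma y_neq0 : y != 0.
Proof.
apply: contraNneq xn1_neq0 => y0.
by rewrite -(model_eq mod) y0 expr0n eqn0Ngt m_gt0.
Qed.

Lemma evx_geom a : evx x (\sum_(i < n) 'X^(n.-1 - i) * a%:P ^+ i) * (x - kap a)
  = x ^+ n - kap a ^+ n.
Proof.
rewrite mulrC [in RHS]subrXX; congr (_ * _); rewrite rmorph_sum; apply: eq_bigr => i _.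
by rewrite rmorphM !rmorphXn /= evxX evxC; congr (_ ^+ _ * _); lia.
Qed.

Lemma model_rep_red f : exists (G : {poly {poly k}}) r,
  [/\ (size G <= m)%N, evx x r != 0 & f = ev x y G / evx x r].
Proof.
have [G [r [r0 ->]]] := model_rep mod f.
pose F : {poly {poly k}} := 'X^m - ('X^n + 1)%:P.
have Fm : F \is monic by apply: monicXnsubC.
exists (Pdiv.Ring.rmodp G F), r; split=> //.
  by have := Pdiv.Ring.ltn_rmodpN0 G (monic_neq0 Fm); rewrite size_XnsubC.
have evF : ev x y F = 0.
  rewrite rmorphB rmorphXn /= evX evC rmorphD rmorphXn rmorph1 /= evxX.
  by rewrite (model_eq mod) subrr.
by rewrite {1}(Pdiv.RingMonic.rdivp_eq Fm G) rmorphD rmorphM /= evF mulr0 add0r.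
Qed.

Section Point.
Variables (a b : k) (ab : b ^+ m = a ^+ n + 1).

(** Functions regular on the affine model have a value at its points. *)
Lemma evp_eq0 G : ev x y G = 0 -> evp a b G = 0.
Proof.
pose F : {poly {poly k}} := 'X^m - ('X^n + 1)%:P.
have Fm : F \is monic by apply: monicXnsubC.
have sF : size F = m.+1 by apply: size_XnsubC.
have evF : ev x y F = 0.
  rewrite rmorphB rmorphXn /= evX evC rmorphD rmorphXn rmorph1 /= evxX.
  by rewrite (model_eq mod) subrr.
have evpF : evp a b F = 0.
  by rewrite rmorphB rmorphXn /= evpX evpC !hornerE ab ?hornerXn subrr.
rewrite (Pdiv.RingMonic.rdivp_eq Fm G).
rewrite !rmorphD !rmorphM /= evF evpF !mulr0 !add0r => /(model_free mod) ->.
  by rewrite rmorph0.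
by have := Pdiv.Ring.ltn_rmodpN0 G (monic_neq0 Fm); rewrite sF.
Qed.

Lemma ev_neq0 G : evp a b G != 0 -> ev x y G != 0.
Proof. by apply: contraNneq => /evp_eq0 ->. Qed.

(** A local parameter: the curve is ramified over the [x]-line exactly where
    [y] vanishes. *)
Definition lpar : {poly {poly k}} := if b == 0 then 'X else ('X - a%:P)%:P.

Lemma evp_lpar : evp a b lpar = 0.
Proof.
rewrite /lpar; case: (eqVneq b 0) => [b0|_]; first by rewrite evpX.
by rewrite evpC !hornerE subrr.
Qed.

Lemma lpar_neq0 : ev x y lpar != 0.
Proof.
rewrite /lpar; case: (eqVneq b 0) => _; first by rewrite evX y_neq0.
by rewrite evC rmorphB /= evxX evxC xsub_neq0.
Qed.

Lemma a_neq0 : b = 0 -> a != 0.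
Proof.
move=> b0; apply: contra_eqN ab => /eqP->; rewrite b0 !expr0n.
by rewrite (gtn_eqF n_gt0) (gtn_eqF m_gt0) add0r eq_sym oner_neq0.
Qed.

Lemma xsub_lpar : exists2 Q, evp a b Q != 0 &
  (x - kap a) * ev x y Q = ev x y lpar ^+ (if b == 0 then m else 1).
Proof.
rewrite /lpar; case: (eqVneq b 0) => [b0|b0]; last first.
  by exists 1; rewrite ?rmorph1 ?oner_neq0 // evC rmorphB /= evxX evxC mulr1.
exists (\sum_(i < n) 'X^(n.-1 - i) * a%:P ^+ i)%:P.
  rewrite evpC horner_sum (eq_bigr (fun _ => a ^+ n.-1)) => [|i _].
    by rewrite sumr_const card_ord -mulr_natr mulf_neq0 // expf_neq0 // a_neq0.
  by rewrite !hornerE ?horner_exp ?hornerC -exprD; congr (_ ^+ _); have := ltn_ord i; lia.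
rewrite evC evX mulrC evx_geom (model_eq mod); congr (_ + _).
have an : a ^+ n = -1 by apply/eqP; rewrite -addr_eq0 -ab b0 expr0n gtn_eqF.
by rewrite -rmorphXn an rmorphN1 opprK.
Qed.

Lemma xsub_lpar1 : exists Q S, evp a b Q != 0 /\
  (x - kap a) * ev x y Q = ev x y lpar * ev x y S.
Proof.
have [Q Q0 QE] := xsub_lpar; exists Q, (lpar ^+ (if b == 0 then m else 1).-1).
by rewrite rmorphXn -exprS prednK //; case: ifP.
Qed.

Lemma ysub_lpar : exists Q S, evp a b Q != 0 /\
  (y - kap b) * ev x y Q = ev x y lpar * ev x y S.
Proof.
rewrite /lpar; case: (eqVneq b 0) => [b0|b0].
  by exists 1, 1; rewrite !rmorph1 oner_neq0 !mulr1 evX b0 rmorph0 subr0.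
exists (\sum_(i < m) 'X^(m.-1 - i) * b%:P%:P ^+ i),
       (\sum_(i < n) 'X^(n.-1 - i) * a%:P ^+ i)%:P; split.
  rewrite rmorph_sum (eq_bigr (fun _ => b ^+ m.-1)) => [|i _].
    by rewrite sumr_const card_ord -mulr_natr mulf_neq0 // expf_neq0.
  rewrite rmorphM !rmorphXn /= evpX evpC hornerC -exprD.
  by congr (_ ^+ _); have := ltn_ord i; lia.
rewrite !evC rmorphB /= evxX evxC mulrC [RHS]mulrC evx_geom.
have -> : x ^+ n - kap a ^+ n = y ^+ m - kap b ^+ m.
  by rewrite (model_eq mod) -!rmorphXn /= ab rmorphD rmorph1 opprD addrACA subrr addr0.
rewrite mulrC subrXX; congr (_ * _); rewrite rmorph_sum; apply: eq_bigr => i _.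
by rewrite rmorphM !rmorphXn /= evX evC evxC; congr (_ ^+ _ * _); lia.
Qed.

(** The maximal ideal of the local ring is generated by the local parameter:
    it is generated by [x - a] and [y - b], which are both multiples of it. *)
Lemma lpar_dvd G : evp a b G = 0 -> exists Q S, evp a b Q != 0 /\
  ev x y G * ev x y Q = ev x y lpar * ev x y S.
Proof.
move=> G0.
have [B BE] : exists B, G - G.[b%:P]%:P = B * ('X - b%:P%:P).
  by apply/factor_theorem; rewrite /root !hornerE subrr.
have [A AE] : exists A, G.[b%:P] = A * ('X - a%:P).
  by apply/factor_theorem/eqP; exact: G0.
have [Q1 [S1 [q1 E1]]] := xsub_lpar1.
have [Q2 [S2 [q2 E2]]] := ysub_lpar.
exists (Q1 * Q2), (B * S2 * Q1 + A%:P * S1 * Q2); split.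
  by rewrite rmorphM mulf_neq0.
have -> : G = B * ('X - b%:P%:P) + (A * ('X - a%:P))%:P by rewrite -AE -BE subrK.
rewrite !rmorphD !rmorphM /= !rmorphB /= evX !evC !evxX !evxC.
move: (x - kap a) (y - kap b) E1 E2 => u w E1 E2; rewrite !mulrDl.
have -> : ev x y B * w * (ev x y Q1 * ev x y Q2) = ev x y B * ev x y Q1 * (w * ev x y Q2) by ring.
have -> : evx x A * u * (ev x y Q1 * ev x y Q2) = evx x A * ev x y Q2 * (u * ev x y Q1) by ring.
by rewrite E1 E2; ring.
Qed.

(** A nonzero function vanishes to a finite order, because it divides a nonzero
    polynomial in [x]. *)
Lemma lpar_bound G : ev x y G != 0 -> exists H e R, evp a b R != 0 /\
  ev x y G * ev x y H = ev x y lpar ^+ e * ev x y R.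
Proof.
move=> G0; have [G1 [r [r0 rE]]] := model_rep mod (ev x y G)^-1.
have GG1 : ev x y G * ev x y G1 = evx x r.
  have : ev x y G / ev x y G = 1 by rewrite divff.
  by rewrite rE mulrA => /(canRL (divfK r0)); rewrite mul1r.
have rn0 : r != 0 by rewrite -evx_eq0.
have [e [q qa rE2]] := multiplicity_XsubC r a; move: qa; rewrite rn0 /= => qa.
have [Q Q0 QE] := xsub_lpar.
exists (G1 * Q ^+ e), ((if b == 0%R then m else 1) * e)%N, q%:P; rewrite evpC; split; first by [].
rewrite rmorphM rmorphXn /= mulrA GG1 rE2 rmorphM rmorphXn rmorphB /= evxX evxC evC.
by rewrite -mulrA -exprMn QE -exprM mulrC.
Qed.

Lemma ev_factor G : ev x y G != 0 -> exists (i : nat) Q S,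
  [/\ evp a b Q != 0, evp a b S != 0 &
      ev x y G * ev x y Q = ev x y lpar ^+ i * ev x y S].
Proof.
move=> G0; have [H [e [R [R0 HE]]]] := lpar_bound G0.
suff step (i : nat) : (exists (i : nat) Q S, [/\ evp a b Q != 0, evp a b S != 0 &
      ev x y G * ev x y Q = ev x y lpar ^+ i * ev x y S]) \/
    exists Q S, evp a b Q != 0 /\ ev x y G * ev x y Q = ev x y lpar ^+ i * ev x y S.
  have [//|[Q [S [Q0 QE]]]] := step e.+1.
  have : ev x y (R * Q - lpar * S * H) = 0.
    apply: (mulfI (expf_neq0 e lpar_neq0)).
    rewrite mulr0 rmorphB !rmorphM /= mulrBr mulrA -HE; move: QE; rewrite exprS => QE.
    by ring: QE.
  move=> /evp_eq0; rewrite rmorphB !rmorphM /= evp_lpar !mul0r subr0 => /eqP.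
  by rewrite mulf_eq0 (negbTE R0) (negbTE Q0).
elim: i => [|i [|[Q [S [Q0 QE]]]]]; [right|by left|].
  by exists 1, G; rewrite !rmorph1 oner_neq0 expr0 mulr1 mul1r.
have [S0|S0] := eqVneq (evp a b S) 0; last by left; exists i, Q, S.
right; have [Q' [S' [Q'0 Q'E]]] := lpar_dvd S0.
exists (Q * Q'), S'; rewrite rmorphM mulf_neq0 //; split=> //.
by rewrite rmorphM /= mulrA QE -mulrA Q'E exprSr mulrA.
Qed.

Definition order_at (f : K) (i : int) := exists G H,
  [/\ evp a b G != 0, evp a b H != 0 & f = ev x y lpar ^ i * (ev x y G / ev x y H)].

Lemma order_at_ex f : f != 0 -> exists i, order_at f i.
Proof.
have [G [r [r0 fE]]] := model_rep mod f; rewrite fE mulf_eq0 invr_eq0 negb_or.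
rewrite r0 andbT => G0; have r1 : ev x y r%:P != 0 by rewrite evC.
have [i [Q [S [Q0 S0 QE]]]] := ev_factor G0.
have [j [Q' [S' [Q'0 S'0 Q'E]]]] := ev_factor r1.
exists (i%:Z - j%:Z), (S * Q'), (Q * S'); rewrite !rmorphM !mulf_neq0 //; split=> //.
have tn := lpar_neq0; rewrite expfzDr // -exprnN -exprnP.
move: QE Q'E (ev_neq0 Q0) (ev_neq0 Q'0) (ev_neq0 S0) (ev_neq0 S'0).
rewrite evC /= => QE Q'E q0 q'0 s0 s'0.
have ti := expf_neq0 i tn; have tj := expf_neq0 j tn.
have -> : ev x y G = ev x y lpar ^+ i * ev x y S / ev x y Q by rewrite -QE mulfK.
have -> : evx x r = ev x y lpar ^+ j * ev x y S' / ev x y Q' by rewrite -Q'E mulfK.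
by field; rewrite q0 q'0 s'0 expf_neq0.
Qed.

Lemma order_at_le f i j : order_at f i -> order_at f j -> i <= j.
Proof.
move=> [G [H [G0 H0 ->]]] [G' [H' [G'0 H'0 E]]]; rewrite leNgt; apply/negP => ji.
have tn := lpar_neq0.
have [d iE] : exists d : nat, i = j + d.+1%:Z by exists `|i - j|.-1%N; lia.
have : ev x y (lpar ^+ d.+1 * G * H' - G' * H) = 0.
  apply: (mulfI (expfz_neq0 j tn)); rewrite mulr0.
  move: E; rewrite iE expfzDr // -exprnP => E.
  move: (ev_neq0 H0) (ev_neq0 H'0) => h0 h'0.
  have {}E : ev x y lpar ^ j * (ev x y lpar ^+ d.+1 * ev x y G) * ev x y H'
    = ev x y lpar ^ j * ev x y G' * ev x y H.
    apply: (mulIf (mulf_neq0 (invr_neq0 h0) (invr_neq0 h'0))).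
    have -> : ev x y lpar ^ j * (ev x y lpar ^+ d.+1 * ev x y G) * ev x y H' *
      ((ev x y H)^-1 / ev x y H') = ev x y lpar ^ j * ev x y lpar ^+ d.+1 *
      (ev x y G / ev x y H) by field; rewrite h0 h'0.
    by rewrite E; field; rewrite h0 h'0.
  by rewrite rmorphB !rmorphM rmorphXn /= mulrBr; move: E; rewrite !mulrA => ->; rewrite subrr.
move=> /evp_eq0; rewrite rmorphB !rmorphM rmorphXn /= evp_lpar expr0n !mul0r sub0r.
by move/eqP; rewrite oppr_eq0 mulf_eq0 (negbTE G'0) (negbTE H0).
Qed.

Lemma order_at_uniq f i j : order_at f i -> order_at f j -> i = j.
Proof. by move=> fi fj; apply/le_anti; rewrite !(order_at_le fi, order_at_le fj). Qed.

Lemma order_at_neq0 f i : order_at f i -> f != 0.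
Proof.
move=> [G [H [/ev_neq0 G0 /ev_neq0 H0 ->]]].
by rewrite mulf_neq0 ?expfz_neq0 ?lpar_neq0 // mulf_neq0 ?invr_eq0.
Qed.

Definition ordp (f : K) : int :=
  if pselect (f != 0) is left f0 then projT1 (cid (order_at_ex f0)) else 0.

Lemma ordp_at f : f != 0 -> order_at f (ordp f).
Proof. by move=> f0; rewrite /ordp; case: pselect => // f0'; case: cid. Qed.

Lemma ordpE f i : order_at f i -> ordp f = i.
Proof. by move=> fi; apply: (order_at_uniq _ fi); apply/ordp_at/(order_at_neq0 fi). Qed.

Lemma order_at1 G : evp a b G != 0 -> order_at (ev x y G) 0.
Proof.
by move=> G0; exists G, 1; rewrite !rmorph1 oner_neq0 expr0z mul1r divr1.
Qed.

Lemma ordp_lpar : ordp (ev x y lpar) = 1.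
Proof.
by apply: ordpE; exists 1, 1; rewrite !rmorph1 oner_neq0 expr1z divr1 mulr1.
Qed.

Lemma order_at_ev G i : ev x y G != 0 -> order_at (ev x y G) i -> 0 <= i.
Proof.
move=> G0 Gi; have [j [Q [S [Q0 S0 QE]]]] := ev_factor G0.
suff /(order_at_uniq Gi)-> : order_at (ev x y G) j by [].
by exists S, Q; split=> //; rewrite -exprnP mulrA -QE mulfK // ev_neq0.
Qed.

Lemma order_atM f g i j : order_at f i -> order_at g j -> order_at (f * g) (i + j).
Proof.
move=> [G [H [G0 H0 ->]]] [G' [H' [G'0 H'0 ->]]].
exists (G * G'), (H * H'); rewrite !rmorphM !mulf_neq0 //; split=> //.
move: (ev_neq0 H0) (ev_neq0 H'0) => h0 h'0.
by rewrite expfzDr ?lpar_neq0 //=; field; rewrite h0 h'0.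
Qed.

Lemma order_atD f g i j l : order_at f i -> order_at g j -> i <= j ->
  order_at (f + g) l -> i <= l.
Proof.
move=> [G [H [G0 H0 ->]]] [G' [H' [G'0 H'0 ->]]] ij fgl; have tn := lpar_neq0.
have [d jE] : exists d : nat, j = i + d%:Z by exists `|j - i|%N; lia.
move: (ev_neq0 H0) (ev_neq0 H'0) => h0 h'0.
have E : ev x y lpar ^ i * (ev x y G / ev x y H) + ev x y lpar ^ j * (ev x y G' / ev x y H')
  = ev x y lpar ^ i * (ev x y (G * H' + lpar ^+ d * G' * H) / ev x y (H * H')).
  rewrite jE expfzDr // -exprnP !rmorphD !rmorphM rmorphXn /=.
  by field; rewrite h0 h'0.
rewrite E in fgl.
have := order_at_neq0 fgl; rewrite !mulf_eq0 invr_eq0 !negb_or => /and3P[_ n0 d0].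
have [e Se] := order_at_ex n0.
have e0 := order_at_ev n0 Se.
have HH : evp a b (H * H') != 0 by rewrite rmorphM mulf_neq0.
suff /(order_at_uniq fgl)-> : order_at (ev x y lpar ^ i *
   (ev x y (G * H' + lpar ^+ d * G' * H) / ev x y (H * H'))) (i + e).
  by rewrite lerDl.
apply: order_atM; first by exists 1, 1; rewrite !rmorph1 oner_neq0 divr1 mulr1.
have [A [B [A0 B0 ->]]] := Se; exists A, (B * (H * H')).
rewrite rmorphM mulf_neq0 //; split=> //.
by rewrite [ev x y (B * _)]rmorphM /= invfM !mulrA.
Qed.

Lemma ordp_valuation : valuation kap ordp.
Proof.
split.
- by rewrite /ordp; case: pselect => // h; case/eqP: (h).
- by move=> f g f0 g0; apply: ordpE; apply: order_atM; apply: ordp_at.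
- move=> f g f0 g0 fg0.
  have [Of Og Ofg] := And3 (ordp_at f0) (ordp_at g0) (ordp_at fg0).
  rewrite ge_min; have [ij|/ltW ji] := leP (ordp f) (ordp g).
    by rewrite (order_atD Of Og ij).
  by rewrite (order_atD Og Of ji) ?orbT // addrC.
- move=> c c0; apply: ordpE; rewrite -(evxC x) -(evC x y); apply: order_at1.
  by rewrite evpC hornerC.
- by exists (ev x y lpar); apply: ordp_lpar.
Qed.

(** The polynomials that do not vanish at [(a, b)] are units for [v], so [v] is a
    multiple of [ordp]; it takes the value [1], hence it is [ordp] itself. *)
Lemma ordp_uniq v : valuation kap v -> vge v 1 (x - kap a) -> vge v 1 (y - kap b) ->
  v =1 ordp.
Proof.
move=> hv hx hy.
have x0 : vge v 0 x.
  by rewrite -(subrK (kap a) x) (vgeD hv) ?(vge_kap hv) //; apply: vge_le hx.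
have y0 : vge v 0 y.
  by rewrite -(subrK (kap b) y) (vgeD hv) ?(vge_kap hv) //; apply: vge_le hy.
have r0 r : vge v 0 (evx x r).
  by rewrite /eval_x /= /horner_eval horner_coef (vge_sum hv) // => i _;
     rewrite (vge0M hv) ?(vge0X hv) // coef_map (vge_kap hv).
have G0 G : vge v 0 (ev x y G).
  by rewrite (evE _ _ (leqnn _)) (vge_sum hv) // => i _; rewrite (vge0M hv) ?(vge0X hv).
have Gu G : evp a b G != 0 -> v (ev x y G) = 0.
  move=> Gu.
  have [B BE] : exists B, G - G.[b%:P]%:P = B * ('X - b%:P%:P).
    by apply/factor_theorem; rewrite /root !hornerE subrr.
  have [A AE] : exists A, G.[b%:P] - (evp a b G)%:P = A * ('X - a%:P).
    by apply/factor_theorem; rewrite /root !hornerE /eval_pt /= /horner_eval subrr.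
  have GE : ev x y G = kap (evp a b G) + (ev x y B * (y - kap b) + evx x A * (x - kap a)).
    have GA : G = B * ('X - b%:P%:P) + (A * ('X - a%:P) + (evp a b G)%:P)%:P.
      by rewrite -AE subrK -BE subrK.
    rewrite [in LHS]GA !rmorphD !rmorphM /= !rmorphB /= evX !evC !evxX !evxC.
    by rewrite addrA addrC.
  have Gk : kap (evp a b G) != 0 by rewrite fmorph_eq0.
  rewrite GE; have := valC hv Gu => vk.
  have := val_dom hv Gk (g := ev x y B * (y - kap b) + evx x A * (x - kap a)).
  by case=> [|_ ->//]; rewrite vk add0r; apply: (vgeD hv); rewrite -[1]add0r (vgeM hv).
have fE f i : order_at f i -> v f = v (ev x y lpar) * i.
  move=> [G [H [g0 h0 ->]]].
  rewrite (valM hv) ?expfz_neq0 ?lpar_neq0 ?mulf_neq0 ?invr_neq0 ?ev_neq0 //.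
  rewrite (val_div hv) ?ev_neq0 // (Gu _ g0) (Gu _ h0) subrr addr0.
  case: i => i; first by rewrite -exprnP (valX hv) pmulrn mulrzz.
  by rewrite NegzE -exprnN (valV hv) (valX hv) pmulrn mulrzz mulrN.
have vt : v (ev x y lpar) = 1.
  have [u u1] := val_unif hv; have [u0|u0] := eqVneq u 0.
    by move: u1; rewrite u0 (val_at0 hv).
  move: (fE _ _ (ordp_at u0)); rewrite u1 => /esym/eqP E.
  have : 0 <= v (ev x y lpar).
    by have := G0 lpar; rewrite vge_neq0 ?lpar_neq0.
  move/eqP: E; move: (v (ev x y lpar)) (ordp u) => A B AB A0.
  have [B0|B0] := leP B 0; first by have := mulr_ge0_le0 A0 B0; rewrite AB.
  have [A1|A1] := leP A 1; last first.
    by have /(ler_wpM2l A0) : 1 <= B by []; rewrite AB mulr1; lia.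
  by have [A2|] := eqVneq A 0; [move: AB; rewrite A2 mul0r | lia].
move=> f; have [->|f0] := eqVneq f 0.
  by rewrite (val_at0 hv) (val_at0 ordp_valuation).
by rewrite (fE _ _ (ordp_at f0)) vt mul1r.
Qed.

Lemma ordp_unit G : evp a b G != 0 -> ordp (ev x y G) = 0.
Proof. by move=> /order_at1/ordpE. Qed.

Lemma ordp_ev G : vge ordp 0 (ev x y G).
Proof.
have [->|G0] := eqVneq (ev x y G) 0; first exact: vge0f.
by rewrite vge_neq0 // (order_at_ev G0 (ordp_at G0)).
Qed.

Lemma ordp_ev1 G : evp a b G = 0 -> vge ordp 1 (ev x y G).
Proof.
move=> G0; have [Q [S [Q0 E]]] := lpar_dvd G0; have hv := ordp_valuation.
have -> : ev x y G = ev x y lpar * (ev x y S / ev x y Q) by rewrite mulrA -E mulfK ?ev_neq0.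
rewrite -[1]addr0; apply: (vgeM hv); first by rewrite /vge ordp_lpar orbT.
apply: (vge0M hv); first exact: ordp_ev.
by rewrite /vge (valV hv) ordp_unit // orbT.
Qed.

Lemma ordp_xsub : vge ordp 1 (x - kap a).
Proof.
have -> : x - kap a = ev x y ('X - a%:P)%:P by rewrite evC rmorphB /= evxX evxC.
by apply: ordp_ev1; rewrite evpC !hornerE subrr.
Qed.

Lemma ordp_ysub : vge ordp 1 (y - kap b).
Proof.
have -> : y - kap b = ev x y ('X - b%:P%:P) by rewrite rmorphB /= evX evC evxC.
by apply: ordp_ev1; rewrite rmorphB /= evpX evpC hornerC subrr.
Qed.

Lemma ordp_xsubE : ordp (x - kap a) = (if b == 0 then m else 1%N).
Proof.
have [Q Q0 /(congr1 ordp)] := xsub_lpar; have hv := ordp_valuation.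
rewrite (valM hv) ?xsub_neq0 ?ev_neq0 // (valX hv) ordp_lpar ordp_unit // addr0 => ->.
by rewrite natz.
Qed.

(** The residue field is [k]. *)
Lemma ordp_value f : vge ordp 0 f -> exists c, vge ordp 1 (f - kap c).
Proof.
have [->|f0] := eqVneq f 0; first by exists 0; rewrite rmorph0 subr0 vge0f.
rewrite vge_neq0 // le_eqVlt => /orP[/eqP fi|fi]; last first.
  by exists 0; rewrite rmorph0 subr0 vge_neq0.
have hv := ordp_valuation.
have [G [H [G0 H0 fE]]] := ordp_at f0; rewrite -fi expr0z mul1r in fE.
exists (evp a b G / evp a b H).
have -> : f - kap (evp a b G / evp a b H) =
    ev x y (G * (evp a b H)%:P%:P - (evp a b G)%:P%:P * H) / (ev x y H * kap (evp a b H)).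
  rewrite fE evB !rmorphM /= !evC !evxC fmorphV /=.
  by field; rewrite fmorph_eq0 H0 ev_neq0.
rewrite -[1]addr0; apply: (vgeM hv).
  apply: ordp_ev1; rewrite rmorphB !rmorphM /= !evpC !hornerC mulrC.
  by rewrite mulrC subrr.
by rewrite /vge (valV hv) (valM hv) ?ev_neq0 ?fmorph_eq0 // ordp_unit // (valC hv) // orbT.
Qed.

End Point.

(** If no [x - a] had a zero at [v], all nonzero polynomials in [x] would be units,
    [y] would be integral over them, and [v] would take no negative value.  The
    value of [y] is then found among the roots of [Y ^ m = a ^ n + 1]. *)
Lemma place_point v : valuation kap v -> vge v 0 x ->
  exists a b, [/\ b ^+ m = a ^+ n + 1, vge v 1 (x - kap a) & vge v 1 (y - kap b)].
Proof.
move=> hv x0.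
have [[a xa]|noa] := pselect (exists a, vge v 1 (x - kap a)); last first.
  have u1 a : v (x - kap a) = 0.
    have : vge v 0 (x - kap a) by rewrite (vgeB hv) ?(vge_kap hv).
    rewrite vge_neq0 ?xsub_neq0 // => h; apply/eqP; rewrite eq_le h andbT leNgt.
    by apply/negP => h1; apply: noa; exists a; rewrite vge_neq0 ?xsub_neq0.
  have vr r : r != 0 -> v (evx x r) = 0.
    move=> r0; have [s sE] := closed_field_poly_normal r; rewrite sE -mul_polyC.
    rewrite rmorphM rmorph_prod /= evxC.
    rewrite (eq_bigr (fun a => x - kap a)) => [|a _]; last by rewrite rmorphB /= evxX evxC.
    rewrite (valM hv) ?fmorph_eq0 ?lead_coef_eq0 //; last first.
      by elim/big_rec: _ => [|i f _ f0]; rewrite ?oner_neq0 ?mulf_neq0 ?xsub_neq0.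
    rewrite (valC hv) ?lead_coef_eq0 // (val_prod hv) => [|a]; last exact: xsub_neq0.
    by rewrite big1.
  have vr0 r : vge v 0 (evx x r).
    by have [->|r0] := eqVneq r 0; rewrite ?rmorph0 ?vge0f // /vge vr ?lexx ?orbT.
  have y0 : vge v 0 y.
    apply: (vge0_expr hv m_gt0); rewrite (model_eq mod).
    have -> : x ^+ n + 1 = evx x ('X^n + 1) by rewrite rmorphD rmorphXn rmorph1 /= evxX.
    exact: vr0.
  have [t t1] := val_unif hv; have [t0|t0] := eqVneq t 0.
    by move: t1; rewrite t0 (val_at0 hv).
  have [G [r [r0 fE]]] := model_rep mod t^-1.
  have : vge v 0 t^-1.
    rewrite fE (vge0M hv) //.
      by rewrite (evE _ _ (leqnn _)) (vge_sum hv) // => i _; rewrite (vge0M hv) ?(vge0X hv).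
    by rewrite /vge (valV hv) vr ?oppr0 ?lexx ?orbT // -evx_eq0.
  by rewrite vge_neq0 ?invr_eq0 // (valV hv) t1.
have [s sE] := closed_field_poly_normal ('X^m - (a ^+ n + 1)%:P).
rewrite (monicP (monicXnsubC _ m_gt0)) scale1r in sE.
have rE : y ^+ m - kap (a ^+ n + 1) = \prod_(b <- s) (y - kap b).
  have := congr1 (evx y) sE.
  rewrite rmorphB rmorphXn /= evxX evxC rmorph_prod /= => ->.
  by apply: eq_bigr => b _; rewrite rmorphB /= evxX evxC.
have ya : vge v 1 (\prod_(b <- s) (y - kap b)).
  rewrite -rE (model_eq mod) rmorphD rmorph1 rmorphXn /= opprD addrACA subrr addr0.
  rewrite -evx_geom -[1]add0r (vgeM hv) //.
  rewrite /eval_x /= /horner_eval horner_coef (vge_sum hv) // => i _.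
  by rewrite (vge0M hv) ?(vge0X hv) // coef_map (vge_kap hv).
have yv : vge v 0 y.
  apply: (vge0_expr hv m_gt0); rewrite (model_eq mod) (vgeD hv) ?(vge0X hv) //.
  by rewrite -(rmorph1 kap) (vge_kap hv).
have [b bs yb] := vge_prod1 hv (fun b _ => vgeB hv yv (vge_kap hv b)) ya.
exists a, b; split=> //; apply/eqP; rewrite -subr_eq0.
have : root ('X^m - (a ^+ n + 1)%:P) b by rewrite sE root_prod_XsubC.
by rewrite /root !hornerE ?hornerXn.
Qed.

End Model.

(** * Coordinates at infinity and the cyclic group of the covering *)

Section ModelMaps.
Variables (k : closedFieldType) (K : fieldType) (kap : {rmorphism k -> K}).
Variables (m n : nat).
Variables (m_gt0 : (0 < m)%N) (n_gt0 : (0 < n)%N).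
Variables (x y : K) (mod : model kap m n x y).
Local Notation evx := (eval_x kap).
Local Notation ev := (eval_xy kap).

Definition revp d (r : {poly k}) : {poly k} := \sum_(i < d) r`_i *: 'X^(d - i).

Lemma evx_revp d (r : {poly k}) (w : K) : w != 0 -> (size r <= d)%N ->
  evx w (revp d r) = w ^+ d * evx w^-1 r.
Proof.
move=> w0 sr; rewrite rmorph_sum /= {2}/eval_x /= /horner_eval.
rewrite (horner_coef_wide _ (n := d)); last exact: leq_trans (size_poly _ _) sr.
rewrite mulr_sumr; apply: eq_bigr => i _.
rewrite coef_map -mul_polyC rmorphM rmorphXn /= evxC evxX mulrCA; congr (_ * _).
by rewrite exprVn expfB // ltnW.
Qed.

Lemma evxV_inj r : evx x^-1 r = 0 -> r = 0.
Proof.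
have x0 := x_neq0 m_gt0 mod; have [s sE] := closed_field_poly_normal r.
have [//|r0] := eqVneq r 0; rewrite sE -mul_polyC rmorphM rmorph_prod /= evxC => /eqP.
rewrite mulf_eq0 fmorph_eq0 lead_coef_eq0 (negbTE r0) /=.
have : \prod_(a <- s) evx x^-1 ('X - a%:P) != 0.
  elim/big_rec: _ => [|a f _ f0]; rewrite ?oner_neq0 ?mulf_neq0 //.
  rewrite rmorphB /= evxX evxC subr_eq0.
  apply: contraNneq (xsub_neq0 m_gt0 mod a^-1) => h.
  by rewrite fmorphV -h invrK subrr.
by move=> /negbTE->.
Qed.

(** Near infinity the curve looks as it does near [x = 0]: [1 / x] and
    [y / x ^ (n / m)] satisfy the same equation as [x] and [y]. *)
Lemma model_inf e : n = (m * e)%N -> model kap m n x^-1 (y / x ^+ e).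
Proof.
move=> nE; have x0 := x_neq0 m_gt0 mod; have u0 : x^-1 != 0 by rewrite invr_eq0.
set u := x^-1 in u0 *; set z := y / x ^+ e.
pose Rp f := exists G r, evx u r != 0 /\ f = ev u z G / evx u r.
have RpD f g : Rp f -> Rp g -> Rp (f + g).
  move=> [G [r [r0 ->]]] [G' [r' [r'0 ->]]].
  exists (G * r'%:P + G' * r%:P), (r * r'); rewrite !rmorphD !rmorphM /= !evC mulf_neq0 //.
  by split=> //; field; rewrite r0 r'0.
have RpM f g : Rp f -> Rp g -> Rp (f * g).
  move=> [G [r [r0 ->]]] [G' [r' [r'0 ->]]].
  exists (G * G'), (r * r'); rewrite !rmorphM /= mulf_neq0 //.
  by split=> //; field; rewrite r0 r'0.
have RpE G : Rp (ev u z G) by exists G, 1; rewrite !rmorph1 oner_neq0 divr1.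
have RpV r : evx u r != 0 -> Rp (evx u r)^-1.
  by move=> r0; exists 1, r; rewrite rmorph1 mul1r.
have RpX i : Rp (x ^+ i).
  rewrite -[x]invrK exprVn -/u -[u](evxX kap) -rmorphXn; apply: RpV.
  by rewrite rmorphXn /= evxX expf_neq0.
have RpC r : Rp (evx x r).
  have : x ^+ size r != 0 by rewrite expf_neq0.
  have -> : evx x r = x ^+ size r * ev u z (revp (size r) r)%:P.
    by rewrite evC evx_revp // invrK mulrA -exprMn divff // expr1n mul1r.
  by move=> _; apply: (RpM _ _).
have RpVx r : evx x r != 0 -> Rp (evx x r)^-1.
  move=> r0; have E : evx u (revp (size r) r) = u ^+ size r * evx x r.
    by rewrite evx_revp // invrK.
  have -> : (evx x r)^-1 = ev u z ('X^(size r))%:P / evx u (revp (size r) r).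
    by rewrite E evC rmorphXn /= evxX; field; rewrite r0 expf_neq0.
  by apply: (RpM _ _) => //; apply: RpV; rewrite E mulf_neq0 // expf_neq0.
have Rpy : Rp y.
  have -> : y = z * x ^+ e by rewrite mulfVK // expf_neq0.
  by apply: (RpM _ _) => //; rewrite -(evX kap u z).
split.
- by rewrite exprMn (model_eq mod) -exprVn -/u -exprM mulnC -nE mulrDl mul1r -exprMn divff ?expr1n // addrC.
- move=> f; have [G [r [r0 ->]]] := model_rep mod f; apply: (RpM _ _); last exact: RpVx.
  elim/poly_ind: G => [|G c IH]; first by rewrite rmorph0 -(rmorph0 (ev u z)); apply: RpE.
  by rewrite rmorphD rmorphM /= evX evC; apply: (RpD _ _) => //; apply: (RpM _ _).
- move=> G sG; rewrite (evE _ _ _ sG) => G0.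
  pose d := (\max_(j < m) size (G`_j)%R)%N.
  have sd (j : 'I_m) : (size (G`_j)%R <= d)%N by apply: (leq_bigmax (F := fun j : 'I_m => size (G`_j)%R)).
  pose H : {poly {poly k}} := \poly_(j < m) (revp d G`_j * 'X^(n - e * j)).
  have : H = 0.
    apply: (model_free mod); first exact: size_poly.
    rewrite (evE _ _ _ (size_poly _ _)) -[RHS](mulr0 (x ^+ (d + n))) -[in RHS]G0 mulr_sumr.
    apply: eq_bigr => j _; rewrite coef_poly ltn_ord rmorphM rmorphXn /= evxX evx_revp //.
    rewrite -/u exprD -(subnKC (_ : e * j <= n)%N); last first.
      by rewrite nE mulnC leq_mul2r (ltnW (ltn_ord j)) orbT.
    rewrite exprD addKn exprMn exprVn -exprM.
    by field; rewrite expf_neq0.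
  move=> H0; apply/polyP => j; rewrite coef0; case: (ltnP j m) => jm; last first.
    by rewrite nth_default // (leq_trans sG).
  have /eqP := congr1 (fun p : {poly {poly k}} => p`_j) H0.
  rewrite coef_poly jm coef0 mulf_eq0 expf_eq0 polyX_eq0 andbF orbF => /eqP r0.
  have /eqP := evx_revp x0 (sd (Ordinal jm)); rewrite /= r0 rmorph0 eq_sym mulf_eq0.
  by rewrite expf_eq0 (negbTE x0) andbF /= => /eqP/evxV_inj.
Qed.

Lemma ev_rel y' G : y' ^+ m = x ^+ n + 1 -> ev x y G = 0 -> ev x y' G = 0.
Proof.
move=> y'E.
pose F : {poly {poly k}} := 'X^m - ('X^n + 1)%:P.
have Fm : F \is monic by apply: monicXnsubC.
have sF : size F = m.+1 by apply: size_XnsubC.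
have evF w : w ^+ m = x ^+ n + 1 -> ev x w F = 0.
  move=> wE; rewrite /F evB rmorphXn /= evX evC rmorphD rmorphXn rmorph1 /= evxX.
  by rewrite wE subrr.
rewrite (Pdiv.RingMonic.rdivp_eq Fm G).
rewrite !rmorphD !rmorphM /= !evF ?(model_eq mod) // !mulr0 !add0r => /(model_free mod) ->.
  by rewrite rmorph0.
by have := Pdiv.Ring.ltn_rmodpN0 G (monic_neq0 Fm); rewrite sF.
Qed.

(** The automorphisms of the curve as a cyclic covering of the [x]-line. *)
Lemma twist_ex (z : k) : z ^+ m = 1 -> exists s : {rmorphism K -> K},
  [/\ forall c, s (kap c) = kap c, s x = x & s y = kap z * y].
Proof.
move=> z1; set y' := kap z * y.
have y'E : y' ^+ m = x ^+ n + 1 by rewrite exprMn -rmorphXn z1 rmorph1 mul1r (model_eq mod).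
have [s sP] : exists s : K -> K, forall f, exists G r,
    [/\ evx x r != 0, f = ev x y G / evx x r & s f = ev x y' G / evx x r].
  have h f : exists g, exists G r,
      [/\ evx x r != 0, f = ev x y G / evx x r & g = ev x y' G / evx x r].
    by have [G [r [r0 fE]]] := model_rep mod f; exists (ev x y' G / evx x r), G, r.
  by exists (fun f => projT1 (cid (h f))) => f; case: cid.
have sE G r : evx x r != 0 -> s (ev x y G / evx x r) = ev x y' G / evx x r.
  move=> r0; have [G' [r' [r'0 E ->]]] := sP (ev x y G / evx x r).
  apply/eqP; rewrite eqr_div // -subr_eq0 -!(evC kap x y') -!rmorphM -evB; apply/eqP.
  apply: ev_rel => //; rewrite evB !rmorphM /= !evC.
  by apply/eqP; rewrite subr_eq0 -eqr_div // E.
have sE1 G : s (ev x y G) = ev x y' G.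
  by have := @sE G 1; rewrite !rmorph1 !divr1; apply; rewrite oner_neq0.
have sB : zmod_morphism s.
  move=> f g; have [G [r [r0 -> ->]]] := sP f; have [G' [r' [r'0 -> ->]]] := sP g.
  have rr : evx x (r * r') != 0 by rewrite rmorphM mulf_neq0.
  have E w : ev x w G / evx x r - ev x w G' / evx x r'
     = ev x w (G * r'%:P - G' * r%:P) / evx x (r * r').
    by rewrite evB !rmorphM /= !evC; field; rewrite r0 r'0.
  by rewrite !E sE.
have sM : monoid_morphism s.
  split; first by rewrite -[in LHS](rmorph1 (ev x y)) sE1 rmorph1.
  move=> f g; have [G [r [r0 -> ->]]] := sP f; have [G' [r' [r'0 -> ->]]] := sP g.
  have rr : evx x (r * r') != 0 by rewrite rmorphM mulf_neq0.
  have E w : (ev x w G / evx x r) * (ev x w G' / evx x r')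
     = ev x w (G * G') / evx x (r * r').
    by rewrite !rmorphM /=; field; rewrite r0 r'0.
  by rewrite !E sE.
pose sA := GRing.isZmodMorphism.Build K K s sB.
pose sMM := GRing.isMonoidMorphism.Build K K s sM.
pose S : {rmorphism K -> K} := HB.pack s sA sMM.
exists S; split=> [c||] /=.
- by rewrite -(evxC kap x c) -(evC kap x y) sE1 !evC.
- by rewrite -[in LHS](evxX kap x) -(evC kap x y) sE1 evC evxX.
- by rewrite -[in LHS](evX kap x y) sE1 evX.
Qed.

End ModelMaps.

(** * The function field and its places *)

Lemma fracE (R : idomainType) (r : {fraction R}) :
  exists N D : R, D != 0 /\ r = FracField.tofrac N / FracField.tofrac D.
Proof.
elim/quotW: r => [[[N D] /= D0]]; exists N, D; split=> //.
apply: (canRL (mulfK _)); first by rewrite tofrac_eq0.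
unlock FracField.tofrac; rewrite -[LHS]FracField.pi_mul.
apply/eqmodP; rewrite /= FracField.equivfE /FracField.mulf /= !numden_Ratio ?mulf_neq0 ?oner_neq0 //.
by rewrite !mulr1 mulrC.
Qed.

Lemma prim_root_ex (k : closedFieldType) m : (0 < m)%N -> m%:R != 0 :> k ->
  exists z : k, m.-primitive_root z.
Proof.
move=> m_gt0 mk.
have [s sE] := closed_field_poly_normal ('X^m - 1%:P : {poly k}).
rewrite (monicP (monicXnsubC _ m_gt0)) scale1r in sE.
have ss : size s = m.
  by apply: succn_inj; rewrite -(size_prod_XsubC s id) -sE size_XnsubC.
have : has m.-primitive_root s.
  apply: cyclic.has_prim_root => //; last by rewrite ss.
    apply/allP => a sa; have : root ('X^m - 1%:P) a by rewrite sE root_prod_XsubC.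
    by rewrite polyC1.
  by rewrite -separable_prod_XsubC -sE polyC1 separable_Xn_sub_1.
by case/hasP => z _ zp; exists z.
Qed.

Section FunctionField.
Variables (k : closedFieldType) (K : fieldExtType (ratfun k)).

Definition pfun : {poly k} -> K := in_alg K \o @FracField.tofrac {poly k}.
HB.instance Definition _ := GRing.RMorphism.on pfun.
Arguments pfun : simpl never.

Definition kap : k -> K := pfun \o polyC.
HB.instance Definition _ := GRing.RMorphism.on kap.
Arguments kap : simpl never.

Definition xK : K := pfun 'X.

Lemma evx_pfun r : eval_x kap xK r = pfun r.
Proof.
elim/poly_ind: r => [|r c IH]; first by rewrite !rmorph0.
by rewrite !rmorphD !rmorphM /= IH evxX evxC.
Qed.

Lemma pfun_eq0 r : (pfun r == 0) = (r == 0).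
Proof.
by rewrite /pfun /= scaler_eq0 oner_eq0 orbF tofrac_eq0.
Qed.

Lemma in1_frac (f : K) : f \in 1%VS -> exists N D, D != 0 /\ f = pfun N / pfun D.
Proof.
move=> /vlineP[r ->]; have [N [D [D0 ->]]] := fracE r; exists N, D; split=> //.
by rewrite /pfun /= -(fmorphV (in_alg K)) -(rmorphM (in_alg K)).
Qed.

Lemma pfun_in1 r : pfun r \in 1%VS.
Proof. exact: memvZ (mem1v _). Qed.

Variables (m n : nat) (m_gt0 : (0 < m)%N) (n_gt0 : (0 < n)%N).
Variables (mk : m%:R != 0 :> k) (nk : n%:R != 0 :> k).

(** The equation is irreducible: a factor of degree [d] in [y] would make
    [y ^ d] a rational function of [x], whose [m]-th power [(x ^ n + 1) ^ d]
    vanishes to order [d] at each root of [x ^ n + 1]. *)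
Lemma curve_degree (y : K) : y ^+ m = xK ^+ n + 1 -> (m <= adjoin_degree 1 y)%N.
Proof.
move=> yE; have xn : xK ^+ n + 1 = pfun ('X^n + 1).
  by rewrite rmorphD rmorphXn rmorph1.
have y0 : y != 0.
  have : y ^+ m != 0 by rewrite yE xn pfun_eq0 -size_poly_eq0 size_XnaddC.
  by rewrite expf_eq0 m_gt0.
have [z z_prim] := prim_root_ex m_gt0 mk.
have z0 : z != 0.
  apply: contra_eqN (prim_expr_order z_prim) => /eqP->.
  by rewrite expr0n gtn_eqF // eq_sym oner_neq0.
pose rs := [seq kap (z ^+ i) * y | i <- iota 0 m].
have pE : 'X^m - (y ^+ m)%:P = \prod_(w <- rs) ('X - w%:P).
  have := @all_roots_prod_XsubC _ ('X^m - (y ^+ m)%:P) rs.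
  rewrite (monicP (monicXnsubC _ m_gt0)) scale1r; apply.
  - by rewrite size_XnsubC // size_map size_iota.
  - apply/allP => w /mapP[i _ ->]; rewrite /root !hornerE ?hornerXn exprMn -rmorphXn /=.
    by rewrite exprAC (prim_expr_order z_prim) expr1n rmorph1 mul1r subrr.
  - rewrite uniq_rootsE map_inj_in_uniq ?iota_uniq // => i j.
    rewrite !mem_iota !add0n => /andP[_ im] /andP[_ jm] /(mulIf y0)/fmorph_inj/eqP.
    by rewrite (eq_prim_root_expr z_prim) !modn_small // => /eqP.
have mp : minPoly 1 y %| \prod_(w <- rs) ('X - w%:P).
  rewrite -pE; apply: minPoly_dvdp; last by rewrite /root !hornerE ?hornerXn subrr.
  by rewrite rpredB ?rpredX ?polyOverX ?polyOverC // yE xn pfun_in1.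
have [mm] := dvdp_prod_XsubC mp; set t := mask mm rs => mE.
have {}mE : minPoly 1 y = \prod_(w <- t) ('X - w%:P).
  by apply/eqP; rewrite -eqp_monic ?monic_minPoly ?monic_prod_XsubC.
set d := adjoin_degree 1 y.
have st : size t = d.
  by apply: succn_inj; rewrite -(size_prod_XsubC t id) -mE size_minPoly.
(* The roots of the factor are multiples of [y] by constants. *)
have [c c0 cE] : exists2 c : k, c != 0 & (minPoly 1 y).[0] = kap c * y ^+ d.
  rewrite mE horner_prod -st.
  have : {subset t <= rs} by move=> w; apply: mem_mask.
  elim: (t) => [|w t' IH] sub.
    by exists 1; rewrite ?oner_neq0 // big_nil rmorph1 mulr1.
  have [|c c0 cE] := IH; first by move=> v vt; apply: sub; rewrite in_cons vt orbT.
  have /mapP[i _ wE] := sub w (mem_head _ _).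
  exists (- z ^+ i * c).
    by rewrite mulf_neq0 // oppr_eq0 expf_neq0.
  rewrite big_cons cE !hornerE ?sub0r wE exprS rmorphM rmorphN /=.
  by rewrite -!mulNr -mulrA; ring.
have : y ^+ d \in 1%VS.
  have : (minPoly 1 y).[0] \in 1%VS by rewrite rpred_horner ?minPolyOver ?rpred0.
  have kc : kap c != 0 by rewrite fmorph_eq0.
  rewrite cE => h; have -> : y ^+ d = (kap c)^-1 * (kap c * y ^+ d) by rewrite mulKf.
  by rewrite rpredM // rpredV pfun_in1.
move=> /in1_frac[N [D [D0 ydE]]].
have Dn0 : pfun D != 0 by rewrite pfun_eq0.
have E : N ^+ m = ('X^n + 1) ^+ d * D ^+ m.
  apply/eqP; rewrite -subr_eq0 -pfun_eq0 rmorphB rmorphM !rmorphXn /= -xn -yE.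
  by rewrite -exprM mulnC exprM ydE -exprMn divfK // subrr.
have N0 : N != 0.
  apply: contraTneq (expf_neq0 d y0) => N0.
  by rewrite ydE N0 rmorph0 mul0r eqxx.
(* A simple root [a] of [x ^ n + 1], at which the orders are compared. *)
have [a aE] : exists a : k, a ^+ n = -1.
  have /closed_rootP[a] : size ('X^n + 1%:P : {poly k}) != 1%N.
    by rewrite size_XnaddC // eqSS -lt0n.
  by rewrite /root !hornerE ?hornerXn addr_eq0 => /eqP aE; exists a.
have [q qE] : exists q, 'X^n + 1 = q * ('X - a%:P) :> {poly k}.
  by apply/factor_theorem; rewrite /root !hornerE ?hornerXn aE addNr.
have a0 : a != 0.
  apply: contra_eqN aE => /eqP->; rewrite expr0n gtn_eqF // eq_sym oppr_eq0.
  exact: oner_neq0.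
have qa : ~~ root q a.
  have /(congr1 (fun r => r.[a])) := congr1 deriv qE.
  rewrite derivD derivXn derivC addr0 derivM derivXsubC mulr1 !hornerE ?hornerMn ?hornerXn subrr mulr0 add0r.
  by move=> h; rewrite /root -h -mulr_natr mulf_neq0 // expf_neq0.
have q0 : q != 0 by apply: contraNneq qa => ->; rewrite root0.
have mupX (r : {poly k}) i : r != 0 -> mup a (r ^+ i) = (i * mup a r)%N.
  move=> r0; elim: i => [|i IH]; first by rewrite expr0 mupNroot // root1.
  by rewrite exprS mupM ?expf_neq0 // IH mulSn.
have mu1 : mup a ('X^n + 1) = 1%N.
  by rewrite qE mupMr // -[X in mup _ X]expr1 mup_XsubCX eqxx.
have f0 : 'X^n + 1 != 0 :> {poly k} by rewrite qE mulf_neq0 // polyXsubC_eq0.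
have := congr1 (mup a) E; rewrite mupM ?expf_neq0 // !mupX // mu1 muln1 => /eqP h.
have : (m %| d)%N.
  by rewrite -(dvdn_addl d (dvdn_mulr (mup a D) (dvdnn m))) -(eqP h) dvdn_mulr.
by move/dvdn_leq; apply; rewrite /d.
Qed.

End FunctionField.

Section CurveModel.
Variables (k : closedFieldType) (K : fieldExtType (ratfun k)).
Variables (m n : nat) (m_gt0 : (0 < m)%N) (n_gt0 : (0 < n)%N).
Variables (mk : m%:R != 0 :> k) (nk : n%:R != 0 :> k).

Lemma curve_model : function_field_of (curve_F k m n) K ->
  exists y, model (kap K) m n (xK K) y.
Proof.
move=> [y yr yfull]; exists y.
have yE : y ^+ m = xK K ^+ n + 1.
  have : root (map_poly (pfun K) (curve_F k m n)) y by [].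
  rewrite /curve_F rmorphB rmorphXn /= map_polyX map_polyC /root !hornerE ?hornerXn /=.
  by rewrite rmorphD rmorphXn rmorph1 subr_eq0 => /eqP.
have deg := curve_degree m_gt0 n_gt0 mk nk yE.
split=> //.
- move=> f.
  pose Rp f := exists G r, eval_x (kap K) (xK K) r != 0 /\
    f = eval_xy (kap K) (xK K) y G / eval_x (kap K) (xK K) r.
  have RpD g g' : Rp g -> Rp g' -> Rp (g + g').
    move=> [G [r [r0 ->]]] [G' [r' [r'0 ->]]].
    exists (G * r'%:P + G' * r%:P), (r * r'); rewrite !rmorphD !rmorphM /= !evC mulf_neq0 //.
    by split=> //; field; rewrite r0 r'0.
  have RpM g g' : Rp g -> Rp g' -> Rp (g * g').
    move=> [G [r [r0 ->]]] [G' [r' [r'0 ->]]].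
    exists (G * G'), (r * r'); rewrite !rmorphM /= mulf_neq0 //.
    by split=> //; field; rewrite r0 r'0.
  have RpE G : Rp (eval_xy (kap K) (xK K) y G) by exists G, 1; rewrite !rmorph1 oner_neq0 divr1.
  have fy : f \in <<1; y>>%VS by rewrite yfull memvf.
  have /polyOverP := Fadjoin_polyOver 1%VS y f.
  move: (Fadjoin_poly_eq fy); move: (Fadjoin_poly _ y f) => h.
  rewrite horner_coef => fE Pc; rewrite -/(Rp f) -fE.
  elim/big_rec: _ => [|i g _ gR]; first by rewrite -(rmorph0 (eval_xy (kap K) (xK K) y)); apply: RpE.
  apply: (RpD _ _) => //; apply: (RpM _ _); last first.
    by rewrite -[y in y ^+ _](evX (kap K) (xK K)) -rmorphXn; apply: RpE.
  have [N [D [D0 ->]]] := in1_frac (Pc i).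
  by exists N%:P, D; rewrite evC !evx_pfun pfun_eq0.
- move=> G sG G0; pose H := map_poly (eval_x (kap K) (xK K)) G.
  have sH : (size H <= m)%N by apply: leq_trans (size_poly _ _) sG.
  have H0 : H = 0.
    apply/eqP; apply/negPn/negP => H0.
    have : minPoly 1 y %| H.
      apply: minPoly_dvdp; last by rewrite /root; apply/eqP.
      by apply/polyOverP => i; rewrite coef_map /= evx_pfun pfun_in1.
    move=> /dvdp_leq -/(_ H0); rewrite size_minPoly => h.
    by have := leq_trans h sH; rewrite ltnNge deg.
  apply/polyP => i; have /(congr1 (fun p : {poly K} => p`_i)) := H0.
  by rewrite coef_map /= !coef0 evx_pfun => /eqP; rewrite pfun_eq0 => /eqP.
Qed.

End CurveModel.

Section Places.
Variables (k : closedFieldType) (K : fieldExtType (ratfun k)).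
Local Notation kap := (kap K).

Lemma place_valuation (P : place K) : valuation kap P.
Proof. by case: P. Qed.

Definition mkplace (v : K -> int) (hv : valuation kap v) : place K :=
  Place (val_at0 hv) (valM hv) (valD hv) (valC hv) (val_unif hv).

Lemma place_eq (P Q : place K) : P =1 Q -> P = Q.
Proof.
case: P Q => [v a b c d e] [v' a' b' c' d' e'] /= vv'.
have {}vv' : v = v' by apply: funext.
by subst v'; congr Place; apply: Prop_irrelevance.
Qed.

Lemma place_const (P : place K) c : P (kap c) = 0.
Proof.
have [->|c0] := eqVneq c 0; first by rewrite rmorph0 ord_at0.
by rewrite (valC (place_valuation P)).
Qed.

Variables (m n : nat) (m_gt0 : (0 < m)%N) (n_gt0 : (0 < n)%N).
Variables (mk : m%:R != 0 :> k) (nk : n%:R != 0 :> k).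

Section Fiber.
Variables (x y : K) (mod : model kap m n x y).

Lemma point_place a b : b ^+ m = a ^+ n + 1 -> exists P : place K,
  [/\ vge P 1 (x - kap a), vge P 1 (y - kap b) &
      P (x - kap a) = (if b == 0 then m else 1%N)%:Z].
Proof.
move=> ab; exists (mkplace (ordp_valuation m_gt0 n_gt0 mk nk mod ab)).
split; [exact: ordp_xsub | exact: ordp_ysub |].
by rewrite /= ordp_xsubE; case: ifP.
Qed.

Lemma point_uniq a b (P Q : place K) : b ^+ m = a ^+ n + 1 ->
  vge P 1 (x - kap a) -> vge P 1 (y - kap b) ->
  vge Q 1 (x - kap a) -> vge Q 1 (y - kap b) -> P = Q.
Proof.
move=> ab Px Py Qx Qy; apply: place_eq => f.
have hP := place_valuation P; have hQ := place_valuation Q.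
by rewrite (ordp_uniq m_gt0 n_gt0 mk nk mod ab hP Px Py)
           (ordp_uniq m_gt0 n_gt0 mk nk mod ab hQ Qx Qy).
Qed.

Lemma roots_Xm c : exists s : seq k, [/\ uniq s, forall b, (b \in s) = (b ^+ m == c),
  c != 0 -> size s = m & c = 0 -> s = [:: 0]].
Proof.
have [c0|c0] := eqVneq c 0.
  exists [:: 0]; split=> // b.
  by rewrite mem_seq1 c0 expf_eq0 m_gt0.
have [z zP] := prim_root_ex m_gt0 mk.
have [b0 b0E] : exists b0, b0 ^+ m = c.
  have /closed_rootP[b0] : size ('X^m - c%:P : {poly k}) != 1%N.
    by rewrite size_XnsubC // eqSS -lt0n.
  by rewrite /root !hornerE ?hornerXn subr_eq0 => /eqP h; exists b0.
have bn0 : b0 != 0 by apply: contraNneq c0 => h; rewrite -b0E h expr0n gtn_eqF.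
exists [seq z ^+ i * b0 | i <- iota 0 m]; split.
- rewrite map_inj_in_uniq ?iota_uniq // => i j.
  rewrite !mem_iota !add0n => /andP[_ im] /andP[_ jm] /(mulIf bn0)/eqP.
  by rewrite (eq_prim_root_expr zP) !modn_small // => /eqP.
- move=> b; apply/mapP/eqP => [[i _ ->]|bE].
    by rewrite exprMn exprAC (prim_expr_order zP) expr1n mul1r.
  have /(prim_rootP zP)[i iE] : (b / b0) ^+ m = 1 by rewrite exprMn exprVn bE b0E divff.
  by exists (val i); rewrite ?mem_iota /= ?add0n ?ltn_ord // -iE divfK.
- by rewrite size_map size_iota.
- by move/eqP; rewrite (negbTE c0).
Qed.

(** There are [m] unramified points over [x = a] when [a ^ n + 1] is nonzero, and
    one point of ramification index [m] otherwise. *)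
Lemma fiber a : exists s : seq (place K), [/\ uniq s,
  forall P, (P \in s) = vge P 1 (x - kap a) & \sum_(P <- s) P (x - kap a) = m%:Z].
Proof.
have [s [us sP s1 s0]] := roots_Xm (a ^+ n + 1).
have [P0 _] : exists P : place K, True.
  have [|P _] := @point_place 0 1; last by exists P.
  by rewrite expr1n expr0n gtn_eqF // add0r.
have hF b : exists P : place K, b ^+ m = a ^+ n + 1 ->
    [/\ vge P 1 (x - kap a), vge P 1 (y - kap b) &
      P (x - kap a) = (if b == 0 then m else 1%N)%:Z].
  have [ab|ab] := eqVneq (b ^+ m) (a ^+ n + 1).
    by have [P hP] := point_place ab; exists P.
  by exists P0 => /eqP; rewrite (negbTE ab).
pose F b := projT1 (cid (hF b)).
have FP b : b \in s -> [/\ vge (F b) 1 (x - kap a), vge (F b) 1 (y - kap b)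
    & F b (x - kap a) = (if b == 0 then m else 1%N)%:Z].
  by rewrite sP => /eqP ab; rewrite /F; case: cid => P; apply.
exists (map F s); split.
- rewrite map_inj_in_uniq // => b b' /FP[_ h _] /FP[_ h' _] E; rewrite -E in h'.
  have hv := place_valuation (F b).
  have : vge (F b) 1 (kap (b - b')).
    have -> : kap (b - b') = (y - kap b') - (y - kap b) by rewrite rmorphB /=; ring.
    exact: (vgeB hv).
  by move/(vge1_kap hv)/eqP; rewrite subr_eq0 => /eqP.
- move=> P; have hv := place_valuation P; apply/mapP/idP => [[b /FP[h _ _] ->//]|h].
  have x0 : vge P 0 x.
    by rewrite -(subrK (kap a) x) (vgeD hv) ?(vge_kap hv) //; apply: vge_le h.
  have [a' [b [ab hx hy]]] := place_point m_gt0 mod hv x0.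
  have aa : a' = a.
    have : vge P 1 (kap (a' - a)).
      have -> : kap (a' - a) = (x - kap a) - (x - kap a') by rewrite rmorphB /=; ring.
      exact: (vgeB hv).
    by move/(vge1_kap hv)/eqP; rewrite subr_eq0 => /eqP.
  rewrite aa in ab hx; have bs : b \in s by rewrite sP ab.
  by exists b => //; have [Fx Fy _] := FP b bs; apply: (point_uniq ab).
- rewrite big_map big_seq (eq_bigr (fun b => (if b == 0 then m else 1%N)%:Z)) => [|b bs].
    rewrite -big_seq; have [c0|c0] := eqVneq (a ^+ n + 1) 0.
      by rewrite s0 // big_seq1 eqxx.
    rewrite big_seq (eq_bigr (fun _ => 1%:Z)) => [|b].
      by rewrite -big_seq big_const_seq count_predT iter_addr_0 s1 // natz.
    rewrite sP; have [->|//] := eqVneq b 0; rewrite expr0n gtn_eqF // eq_sym.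
    by rewrite (negbTE c0).
  by have [_ _ ->] := FP b bs.
Qed.

End Fiber.
End Places.

(** * Principal divisors have degree zero *)

Lemma freeg_ex (T : choiceType) (F : T -> int) (s : seq T) : uniq s ->
  (forall t, F t != 0 -> t \in s) ->
  exists D : {freeg T}, (forall t, coeff t D = F t) /\ deg D = \sum_(t <- s) F t.
Proof.
move=> us sF; exists (\sum_(t <- s) << F t *g t >>); split=> [t|]; last first.
  by rewrite raddf_sum; apply: eq_bigr => t _; rewrite /= degU.
rewrite raddf_sum /=; have [ts|ts] := boolP (t \in s).
  rewrite (bigD1_seq t) //= coeffU eqxx mulr1 big1 ?addr0 // => u /negbTE ut.
  by rewrite coeffU ut mulr0.
rewrite big_seq big1 => [|u us'].
  by apply/esym/eqP; apply: contraNT ts; apply: sF.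
by rewrite coeffU; case: eqVneq us' ts => [->->//|_ _ _]; rewrite mulr0.
Qed.

Lemma int_ge0_lt1 (i : int) : 0 <= i -> ~~ (1 <= i) -> i = 0.
Proof. lia. Qed.

Section Divisors.
Variables (k : closedFieldType) (K : fieldExtType (ratfun k)).
Variables (m n e : nat) (m_gt0 : (0 < m)%N) (n_gt0 : (0 < n)%N) (nE : n = (m * e)%N).
Variables (mk : m%:R != 0 :> k) (nk : n%:R != 0 :> k).
Local Notation kap := (kap K).
Local Notation x := (xK K).
Variables (y : K) (mod : model kap m n x y).
Local Notation ev := (eval_xy kap).
Local Notation evx := (eval_x kap).
Let x0 : x != 0 := x_neq0 m_gt0 mod.

Definition modi := model_inf m_gt0 mod nE.

Lemma place_inf (P : place K) : ~~ vge P 0 x -> vge P 1 x^-1.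
Proof.
rewrite !vge_neq0 ?invr_eq0 // (valV (place_valuation P)); move: (P x); clear.
lia.
Qed.

Lemma vge_evx (P : place K) r : vge P 0 x -> vge P 0 (evx x r).
Proof.
move=> Px; have hv := place_valuation P; rewrite /eval_x /= /horner_eval horner_coef.
by apply: (vge_sum hv) => i _; rewrite (vge0M hv) ?(vge0X hv) // coef_map (vge_kap hv).
Qed.

Lemma vge_y (P : place K) : vge P 0 x -> vge P 0 y.
Proof.
move=> Px; have hv := place_valuation P; apply: (vge0_expr hv m_gt0).
rewrite (model_eq mod) (vgeD hv) ?(vge0X hv) //.
by rewrite -(rmorph1 kap) (vge_kap hv).
Qed.

Lemma vge_ev (P : place K) G : vge P 0 x -> vge P 0 (ev x y G).
Proof.
move=> Px; have hv := place_valuation P; rewrite (evE _ _ _ (leqnn _)).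
by apply: (vge_sum hv) => i _; rewrite (vge0M hv) ?vge_evx ?(vge0X hv) ?vge_y.
Qed.

Lemma evxE r : exists2 s : seq k,
  evx x r = kap (lead_coef r) * \prod_(a <- s) (x - kap a) & forall a, (a \in s) -> root r a.
Proof.
have [s sE] := closed_field_poly_normal r; exists s; last first.
  move=> a sa; rewrite sE /root hornerZ horner_prod (big_rem a) //= !hornerE.
  by rewrite subrr /= mulr0 mul0r.
rewrite {1}sE -mul_polyC rmorphM rmorph_prod /= evxC; congr (_ * _).
by apply: eq_bigr => a _; rewrite rmorphB /= evxX evxC.
Qed.

Lemma support_ex f : f != 0 -> exists2 s : seq (place K), uniq s &
  forall P : place K, P f != 0 -> P \in s.
Proof.
move=> f0; have [G [r [r0 fE]]] := model_rep mod f.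
have [G' [r' [r'0 fE']]] := model_rep mod f^-1.
have [si [_ siP _]] := fiber m_gt0 n_gt0 mk nk modi 0.
have [s sE _] := evxE (r * r').
pose L a := projT1 (cid (fiber m_gt0 n_gt0 mk nk mod a)).
have LP a P : (P \in L a) = vge P 1 (x - kap a).
  by rewrite /L; case: cid => l [].
exists (undup (si ++ flatten (map L s))); first exact: undup_uniq.
move=> P; have hv := place_valuation P; apply: contraNT.
rewrite mem_undup mem_cat negb_or siP rmorph0 subr0 => /andP[Pi Ps].
have Px : vge P 0 x by apply: contraNT Pi => /place_inf.
have vr : P (evx x (r * r')) = 0.
  have rr : evx x (r * r') != 0 by rewrite rmorphM mulf_neq0.
  have lk : kap (lead_coef (r * r')) != 0 by move: rr; rewrite sE mulf_eq0 negb_or => /andP[].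
  rewrite sE (valM hv) //; last by move: rr; rewrite sE mulf_eq0 negb_or => /andP[].
  rewrite place_const add0r (val_prod hv) => [|a]; last exact: (xsub_neq0 m_gt0 mod).
  rewrite big_seq big1 // => a sa.
  have : ~~ vge P 1 (x - kap a).
    by rewrite -LP; apply: contraNN Ps => h; apply/flattenP; exists (L a); rewrite ?map_f.
  have : vge P 0 (x - kap a) by rewrite (vgeB hv) ?(vge_kap hv).
  rewrite !vge_neq0 ?(xsub_neq0 m_gt0 mod) //; exact: int_ge0_lt1.
have h1 := vge_evx r Px; have h2 := vge_evx r' Px.
move: vr; rewrite rmorphM (valM hv) //= => vr.
rewrite vge_neq0 // in h1; rewrite vge_neq0 // in h2.
have hf g G0 r0' : g != 0 -> P (evx x r0') = 0 -> evx x r0' != 0 ->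
    g = ev x y G0 / evx x r0' -> 0 <= P g.
  move=> g0 v0 r00 gE; rewrite gE in g0 *.
  have G00 : ev x y G0 != 0 by apply: contraNneq g0 => ->; rewrite mul0r.
  rewrite (val_div hv) // v0 subr0.
  by have := vge_ev G0 Px; rewrite vge_neq0.
have := hf _ _ _ f0 _ r0 fE; have fV0 : f^-1 != 0 by rewrite invr_eq0.
have := hf _ _ _ fV0 _ r'0 fE'; rewrite (valV hv).
rewrite oppr_ge0 => i1 i2; rewrite eq_le.
move: vr; move: (P (evx x r)) (P (evx x r')) h1 h2 i1 i2 => v1 v2 h1 h2 i1 i2 vr.
have [v10 v20] : v1 = 0 /\ v2 = 0 by clear -h1 h2 vr; lia.
by rewrite i1 ?i2.
Qed.

Definition is_div (D : {freeg place K}) (f : K) := forall P : place K, coeff P D = P f.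

Lemma is_div_ex f : exists D, is_div D f.
Proof.
have [->|f0] := eqVneq f 0; first by exists 0 => P; rewrite coeff0 ord_at0.
have [s us sP] := support_ex f0.
by have [D [DP _]] := freeg_ex us sP; exists D.
Qed.

Lemma is_div_uniq D D' f : is_div D f -> is_div D' f -> D = D'.
Proof. by move=> Df D'f; apply/eqP/freeg_eqP => P; rewrite Df D'f. Qed.

Lemma is_divM D D' f g : f != 0 -> g != 0 -> is_div D f -> is_div D' g ->
  is_div (D + D') (f * g).
Proof.
by move=> f0 g0 Df Dg P; rewrite coeffD Df Dg (valM (place_valuation P)).
Qed.

Lemma is_divV D f : is_div D f -> is_div (- D) f^-1.
Proof. by move=> Df P; rewrite coeffN Df (valV (place_valuation P)). Qed.

Definition div_deg0 f := forall D, is_div D f -> deg D = 0.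

Lemma deg0M f g : f != 0 -> g != 0 -> div_deg0 f -> div_deg0 g -> div_deg0 (f * g).
Proof.
move=> f0 g0 hf hg D DP; have [Df fP] := is_div_ex f; have [Dg gP] := is_div_ex g.
by rewrite (is_div_uniq DP (is_divM f0 g0 fP gP)) degD (hf _ fP) (hg _ gP) addr0.
Qed.

Lemma deg0V f : div_deg0 f -> div_deg0 f^-1.
Proof.
move=> hf D DP; have [Df fP] := is_div_ex f.
by rewrite (is_div_uniq DP (is_divV fP)) degN (hf _ fP) oppr0.
Qed.

Lemma deg0_kap c : div_deg0 (kap c).
Proof.
move=> D DP; suff -> : D = 0 by rewrite deg0.
by apply/eqP/freeg_eqP => P; rewrite DP coeff0 place_const.
Qed.

(** [x - a] has [m] zeros, over [x = a], and [m] poles, at infinity. *)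
Lemma deg0_xsub a : div_deg0 (x - kap a).
Proof.
move=> D DP; have [s [us sP sE]] := fiber m_gt0 n_gt0 mk nk mod a.
have [t [ut tP tE]] := fiber m_gt0 n_gt0 mk nk modi 0.
have xa0 := xsub_neq0 m_gt0 mod a.
have Pt P : P \in t -> P (x - kap a) = - P (x^-1 - kap 0).
  have hv := place_valuation P.
  rewrite tP rmorph0 subr0 vge_neq0 ?invr_eq0 // (valV hv) opprK => h.
  have [] // := val_dom hv x0 (g := - kap a).
  apply: (vge_le (s := 0)); first by lia.
  by rewrite (vgeN hv) (vge_kap hv).
have ust : uniq (s ++ t).
  rewrite cat_uniq us ut andbT; apply/hasPn => P Pt'; rewrite /= sP vge_neq0 //.
  rewrite Pt // -ltNge; move: Pt'; rewrite tP vge_neq0 ?rmorph0 ?subr0 ?invr_eq0 //; lia.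
have supp (P : place K) : P (x - kap a) != 0 -> P \in s ++ t.
  have hv := place_valuation P; apply: contraNT; rewrite mem_cat negb_or.
  rewrite sP tP rmorph0 subr0 => /andP[Ps Pt'].
  have Px : vge P 0 x by apply: contraNT Pt' => /place_inf.
  have : vge P 0 (x - kap a) by rewrite (vgeB hv) ?(vge_kap hv).
  by move: Ps; rewrite !vge_neq0 // => h1 h2; rewrite (int_ge0_lt1 h2 h1).
have [D' [D'P D'E]] := freeg_ex ust supp.
rewrite (is_div_uniq DP D'P) D'E big_cat /= sE (eq_big_seq _ Pt) sumrN tE.
by rewrite subrr.
Qed.

Lemma deg0_evx r : evx x r != 0 -> div_deg0 (evx x r).
Proof.
have [s -> _] := evxE r; rewrite mulf_eq0 negb_or => /andP[l0 p0].
apply: deg0M => //; first exact: deg0_kap.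
elim: s {p0} => [|a s IH]; first by rewrite big_nil -(rmorph1 kap); apply: deg0_kap.
rewrite big_cons; apply: deg0M => //; try exact: deg0_xsub.
  exact: (xsub_neq0 m_gt0 mod).
by elim/big_rec: _ => [|i f _ f0]; rewrite ?oner_neq0 ?mulf_neq0 // (xsub_neq0 m_gt0 mod).
Qed.

Section Twist.
Variables (z : k) (z_prim : m.-primitive_root z).
Variables (s : {rmorphism K -> K}).
Variables (sk : forall c, s (kap c) = kap c) (sx : s x = x) (sy : s y = kap z * y).

Lemma twist_evx r : s (evx x r) = evx x r.
Proof.
elim/poly_ind: r => [|r c IH]; first by rewrite !rmorph0.
by rewrite !rmorphD !rmorphM /= evxX evxC IH sx sk.
Qed.

Lemma twist_ev w G : s (ev x w G) = ev x (s w) G.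
Proof.
elim/poly_ind: G => [|r c IH]; first by rewrite !rmorph0.
by rewrite !rmorphD !rmorphM /= !evX !evC IH twist_evx.
Qed.

Lemma iter_twist i G r : iter i s (ev x y G / evx x r) =
  ev x (kap (z ^+ i) * y) G / evx x r.
Proof.
elim: i => [|i IH]; first by rewrite expr0 rmorph1 mul1r.
rewrite iterS IH fmorph_div twist_evx twist_ev; congr (ev _ _ _ / _).
by rewrite rmorphM /= sk sy mulrA -rmorphM exprSr.
Qed.

Lemma iter_twist_m f : iter m s f = f.
Proof.
have [G [r [_ ->]]] := model_rep mod f; rewrite iter_twist.
by rewrite (prim_expr_order z_prim) rmorph1 mul1r.
Qed.

Lemma twist_valuation (P : place K) : valuation kap (P \o s).
Proof.
have hv := place_valuation P; split=> /=.
- by rewrite rmorph0 ord_at0.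
- by move=> f g f0 g0; rewrite rmorphM (valM hv) ?fmorph_eq0.
- by move=> f g f0 g0 fg0; rewrite rmorphD (valD hv) ?fmorph_eq0 // -rmorphD fmorph_eq0.
- by move=> c c0; rewrite sk (valC hv).
- have [t t1] := val_unif hv; exists (iter m.-1 s t).
  by rewrite -iterS prednK // iter_twist_m.
Qed.

Definition twist (P : place K) : place K := mkplace (twist_valuation P).

Lemma twistE P f : twist P f = P (s f). Proof. by []. Qed.

Lemma iter_twistE i P f : iter i twist P f = P (iter i s f).
Proof. by elim: i P f => //= i IH P f; rewrite IH -iterSr. Qed.

Lemma twist_inj : injective twist.
Proof.
apply: (can_inj (g := iter m.-1 twist)) => P; apply: place_eq => f.
by rewrite -iterSr prednK // iter_twistE iter_twist_m.
Qed.

Lemma is_div_twist D f : is_div D f -> exists2 D', is_div D' (s f) & deg D' = deg D.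
Proof.
move=> Df; have Kt : cancel (iter m.-1 twist) twist.
  by move=> P; apply: place_eq => g; rewrite -iterS prednK // iter_twistE iter_twist_m.
exists (\sum_(P <- dom D) << coeff P D *g iter m.-1 twist P >>); last first.
  rewrite -[in RHS](freeg_sumE D) !raddf_sum; apply: eq_bigr => P _.
  by rewrite /= !degU.
move=> P; rewrite raddf_sum /=.
rewrite (eq_bigr (fun Q => coeff (twist P) << coeff Q D *g Q >>)) => [|Q _].
  by rewrite -raddf_sum /= freeg_sumE Df twistE.
rewrite !coeffU; congr (_ * _%:R); congr nat_of_bool.
by apply/eqP/eqP => [<-|->]; rewrite ?Kt //; apply: twist_inj; rewrite Kt.
Qed.

Lemma twist_fixed f : s f = f -> exists A B, [/\ evx x B != 0 & f = evx x A / evx x B].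
Proof.
have [G [r [sG r0 ->]]] := model_rep_red m_gt0 mod f.
rewrite fmorph_div twist_evx twist_ev => /(mulIf (invr_neq0 r0)) E.
exists G`_0, r; split=> //; congr (_ / _).
suff -> : G = (G`_0)%:P by rewrite evC coefC.
pose H : {poly {poly k}} := \poly_(j < m) (G`_j * (z ^+ j - 1)%:P).
have : H = 0.
  apply: (model_free mod); first exact: size_poly.
  move/eqP: E; rewrite -subr_eq0 !(evE _ _ _ sG) -sumrB => /eqP E.
  rewrite (evE _ _ _ (size_poly _ _)) -[RHS]E.
  apply: eq_bigr => j _; rewrite coef_poly ltn_ord rmorphM /= evxC sy exprMn -rmorphXn.
  by rewrite rmorphB rmorph1; ring.
move=> H0; apply/polyP => j; rewrite coefC; case: eqVneq => [->//|j0].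
have [jm|jm] := ltnP j m; last by rewrite nth_default // (leq_trans sG).
have /eqP := congr1 (fun p : {poly {poly k}} => p`_j) H0.
rewrite coef_poly jm coef0 mulf_eq0 polyC_eq0 subr_eq0 => /orP[/eqP//|].
by rewrite -(prim_order_dvd z_prim) gtnNdvd // lt0n.
Qed.

End Twist.

(** The product of the conjugates of [f] under the cyclic group is a function of
    [x], for which the degree is known; its divisor has degree [m] times that of
    the divisor of [f]. *)
Lemma principal_deg0 f : f != 0 -> div_deg0 f.
Proof.
move=> f0; have [z zP] := prim_root_ex m_gt0 mk.
have [s [sk sx sy]] := twist_ex m_gt0 mod (prim_expr_order zP).
have [D DP] := is_div_ex f.
have it0 i : iter i s f != 0 by elim: i => //= i IH; rewrite fmorph_eq0.
have h i : exists2 E, is_div E (\prod_(j < i) iter j s f) & deg E = deg D *+ i.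
  have hj j : exists2 E, is_div E (iter j s f) & deg E = deg D.
    elim: j => [|j [E EP Ed]]; first by exists D.
    by have [E' E'P E'd] := is_div_twist zP sk sx sy EP; exists E'; rewrite // E'd.
  elim: i => [|i [E EP Ed]].
    by exists 0; rewrite ?deg0 // => P; rewrite big_ord0 coeff0 (val1 (place_valuation P)).
  have [E' E'P E'd] := hj i; exists (E + E'); last by rewrite degD Ed E'd mulrSr.
  rewrite big_ord_recr; apply: is_divM => //; last exact: it0.
  by apply/prodf_neq0 => j _; exact: it0.
have [E EP Ed] := h m.
have sN : s (\prod_(j < m) iter j s f) = \prod_(j < m) iter j s f.
  rewrite rmorph_prod; case: (m) m_gt0 (iter_twist_m zP sk sx sy f) => // m' _ mE.
  rewrite big_ord_recr [RHS]big_ord_recl /= -iterS mE mulrC; congr (_ * _).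
have [A [B [B0 NE]]] := twist_fixed zP sk sx sy sN.
have N0 : \prod_(j < m) iter j s f != 0 by apply/prodf_neq0 => j _; exact: it0.
have A0 : evx x A != 0 by move: N0; rewrite NE mulf_eq0 negb_or => /andP[].
have : div_deg0 (\prod_(j < m) iter j s f).
  by rewrite NE; apply: deg0M; rewrite ?invr_eq0 //; [|apply: deg0V]; apply: deg0_evx.
move=> /(_ _ EP); rewrite Ed => /eqP; rewrite mulrn_eq0 gtn_eqF //= => /eqP d0 D' D'P.
by rewrite (is_div_uniq D'P DP).
Qed.

(** A function without zeros or poles is constant: subtracting its value at a
    point gives a function with a zero and no pole, which must vanish. *)
Lemma unit_const f : f != 0 -> (forall P : place K, P f = 0) -> exists c, f = kap c.
Proof.
move=> f0 fP.
have ab : (1 : k) ^+ m = 0 ^+ n + 1 by rewrite expr1n expr0n gtn_eqF // add0r.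
pose P := mkplace (ordp_valuation m_gt0 n_gt0 mk nk mod ab).
have [c Pc] : exists c, vge P 1 (f - kap c).
  by apply: ordp_value; rewrite vge_neq0 //; have := fP P; rewrite /P /= => ->.
exists c; apply/eqP; rewrite -subr_eq0; apply/negPn/negP => fc0.
have [D DP] := is_div_ex (f - kap c).
have D0 : fgle 0 D.
  apply/fgposP => Q; rewrite DP; have hv := place_valuation Q.
  have : vge Q 0 (f - kap c) by rewrite (vgeB hv) ?(vge_kap hv) // vge_neq0 // fP.
  by rewrite vge_neq0.
have := fgpos_eq0P D0 (principal_deg0 fc0 DP) => DE.
by move: Pc; rewrite vge_neq0 // -DP DE coeff0.
Qed.

End Divisors.

(** * The derivation along x and logarithmic derivatives *)

Section PBasis.
Variables (K : fieldType) (p : nat) (pK : p \in [pchar K]) (x : K).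
Local Notation frob := (pFrobenius_aut pK).

(** [K] has the basis [1, x, .., x ^ p.-1] over its subfield of [p]-th powers. *)
Definition p_basis := (forall f, exists Q, f = (map_poly frob Q).[x]) /\
  (forall Q : {poly K}, (size Q <= p)%N -> (map_poly frob Q).[x] = 0 -> Q = 0).

Hypothesis xP : p_basis.

Let p_prime : prime p := pcharf_prime pK.
Let p_gt0 : (0 < p)%N := prime_gt0 p_prime.

(** The Frobenius map on coefficients takes ['X^p - x%:P] to ['X - x%:P] to the
    power [p], which vanishes at [x] and has derivative [0]. *)
Lemma p_basis_red Q : exists Q0 S : {poly K}, (size Q0 <= p)%N /\
  map_poly frob Q = (('X - x%:P) ^+ p) * S + map_poly frob Q0.
Proof.
have Fm : 'X^p - x%:P \is monic by apply: monicXnsubC.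
exists (Pdiv.Ring.rmodp Q ('X^p - x%:P)), (map_poly frob (Pdiv.Ring.rdivp Q ('X^p - x%:P))).
split; first by have := Pdiv.Ring.ltn_rmodpN0 Q (monic_neq0 Fm); rewrite size_XnsubC.
rewrite {1}(Pdiv.RingMonic.rdivp_eq Fm Q) rmorphD rmorphM rmorphB /= map_polyXn map_polyC /=.
have pP : p \in [pchar {poly K}] by rewrite pchar_poly.
by rewrite -!(pFrobenius_autE pP) rmorphB /= !pFrobenius_autE -polyC_exp mulrC.
Qed.

Lemma deriv_exp_p (R : {poly K}) : (R ^+ p)^`() = 0.
Proof.
have pP : p \in [pchar {poly K}] by rewrite pchar_poly.
by rewrite deriv_exp -mulr_natr (pcharf0 pP) mulr0.
Qed.

Lemma p_basis_eval Q : (map_poly frob Q).[x] = 0 -> (map_poly frob Q)^`().[x] = 0.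
Proof.
have [Q0 [S [sQ0 ->]]] := p_basis_red Q; have [_ ind] := xP.
have hx : (('X - x%:P) ^+ p).[x] = 0.
  by rewrite horner_exp !hornerE subrr expr0n gtn_eqF.
rewrite hornerD hornerM hx mul0r add0r => /(ind _ sQ0) ->.
by rewrite rmorph0 addr0 derivM deriv_exp_p mul0r add0r hornerM hx mul0r.
Qed.

Lemma p_basis_coords f : exists Q : {poly K}, (size Q <= p)%N /\ f = (map_poly frob Q).[x].
Proof.
have [gen _] := xP; have [Q ->] := gen f; have [Q0 [S [sQ0 QE]]] := p_basis_red Q.
exists Q0; split=> //; rewrite QE hornerD hornerM horner_exp !hornerE subrr expr0n.
by rewrite gtn_eqF // mul0r add0r.
Qed.

(** Differentiation of polynomials in [x] over the [p]-th powers is well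
    defined: it kills [('X - x) ^+ p]. *)
Lemma derivation_ex : exists D : {additive K -> K},
  (forall f g, D (f * g) = D f * g + f * D g) /\ D x = 1.
Proof.
have [gen _] := xP.
pose D f := (map_poly frob (projT1 (cid (gen f))))^`().[x].
have DE Q : D (map_poly frob Q).[x] = (map_poly frob Q)^`().[x].
  rewrite /D; case: cid => Q' /= E; apply/eqP; rewrite -subr_eq0.
  rewrite -hornerN -hornerD -derivB -rmorphB; apply/eqP/p_basis_eval.
  by rewrite rmorphB hornerD hornerN E subrr.
have DB : zmod_morphism D.
  move=> f g; have [Q ->] := gen f; have [Q' ->] := gen g.
  by rewrite -hornerN -hornerD -rmorphB !DE rmorphB derivB hornerD hornerN.
pose DA := GRing.isZmodMorphism.Build K K D DB.
pose DD : {additive K -> K} := HB.pack D DA.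
exists DD; split=> [f g|] /=.
  have [Q ->] := gen f; have [Q' ->] := gen g.
  by rewrite -hornerM -rmorphM !DE rmorphM derivM hornerD !hornerM.
by have := DE 'X; rewrite map_polyX hornerX derivX hornerC.
Qed.

Variables (D : {additive K -> K}).
Hypotheses (DM : forall f g, D (f * g) = D f * g + f * D g) (Dx : D x = 1).

Lemma D1 : D 1 = 0.
Proof. by have /eqP := DM 1 1; rewrite !mulr1 mul1r -subr_eq subrr eq_sym => /eqP. Qed.

Lemma DX f i : D (f ^+ i) = f ^+ i.-1 * D f *+ i.
Proof.
elim: i => [|i IH]; first by rewrite D1 mulr0n.
rewrite exprS DM IH; case: i {IH} => [|i]; first by rewrite mulr0n mulr0 addr0 mulr1 mul1r.
by rewrite /= mulrnAr mulrA -exprS mulrC [RHS]mulrS.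
Qed.

Lemma Dp f : D (f ^+ p) = 0.
Proof. by rewrite DX -mulr_natr (pcharf0 pK) mulr0. Qed.

Lemma DpM f g : D (f ^+ p * g) = f ^+ p * D g.
Proof. by rewrite DM Dp mul0r add0r. Qed.

Lemma DV f : f != 0 -> D f^-1 = - D f / f ^+ 2.
Proof.
move=> f0; have := DM f f^-1; rewrite divff // D1 => /esym/eqP.
rewrite addrC addr_eq0 => /eqP E; apply: (mulfI f0); rewrite E.
by field.
Qed.

Lemma D_horner (R : {poly K}) : (forall i, D R`_i = 0) -> D R.[x] = R^`().[x].
Proof.
elim/poly_ind: R => [|R c IH] Rc; first by rewrite deriv0 !horner0 raddf0.
have cE i : (R * 'X + c%:P)`_i = if i is i'.+1 then R`_i' else c.
  by rewrite coefD coefMX coefC; case: i => [|i]; rewrite ?add0r ?addr0.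
have c0 : D c = 0 by have := Rc 0; rewrite cE.
rewrite !hornerE raddfD /= DM IH => [|i]; last by have := Rc i.+1; rewrite cE.
by rewrite derivD derivM derivC derivX !hornerE Dx c0 addr0 ?mulr1.
Qed.

Lemma D_iterp f : iter p D f = 0.
Proof.
have [gen _] := xP; have [Q ->] := gen f.
have h i : iter i D (map_poly frob Q).[x] = (map_poly frob Q)^`(i).[x] /\
    (forall j, D ((map_poly frob Q)^`(i))`_j = 0).
  elim: i => [|i [IH IHc]].
    by split=> // j; rewrite derivn0 coef_map /= pFrobenius_autE Dp.
  rewrite iterS IH D_horner // -derivnS; split=> // j.
  by rewrite derivnS coef_deriv raddfMn /= IHc mul0rn.
have [-> _] := h p; rewrite nderivn_def hornerMn -mulr_natr.
have -> : (p`!)%:R = 0 :> K.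
  by rewrite -[p]prednK // factS natrM prednK // (pcharf0 pK) mul0r.
by rewrite mulr0.
Qed.

(** In the basis [1, x, .., x ^ p.-1] over the [p]-th powers, differentiation
    multiplies the coefficient of [x ^ i] by [i], which is nonzero for
    [0 < i < p]. *)
Lemma D_eq0 f : D f = 0 -> exists g, f = g ^+ p.
Proof.
have [Q [sQ ->]] := p_basis_coords f; have [_ ind] := xP.
rewrite D_horner => [|i]; last by rewrite coef_map /= pFrobenius_autE Dp.
have -> : (map_poly frob Q)^`() = map_poly frob Q^`() by rewrite deriv_map.
have sQ' : (size Q^`() <= p)%N.
  have [->|Q0] := eqVneq Q 0; first by rewrite deriv0 size_poly0.
  exact: leq_trans (ltnW (lt_size_deriv Q0)) sQ.
move=> /(ind _ sQ') Q'0; exists Q`_0.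
suff {1}-> : Q = (Q`_0)%:P by rewrite map_polyC hornerC /= pFrobenius_autE.
apply/polyP => i; rewrite coefC; case: eqVneq => [->//|i0].
have [ip|ip] := ltnP i p; last by rewrite nth_default // (leq_trans sQ).
have /eqP := congr1 (fun R : {poly K} => R`_i.-1) Q'0.
rewrite coef_deriv coef0 prednK ?lt0n // -mulr_natr mulf_eq0 => /orP[/eqP//|].
by rewrite -(dvdn_pcharf pK) gtnNdvd // lt0n.
Qed.

End PBasis.

Lemma closed_fieldX (k : closedFieldType) p (c : k) : (0 < p)%N -> exists d, d ^+ p = c.
Proof.
move=> p_gt0; have /closed_rootP[d] : size ('X^p - c%:P : {poly k}) != 1%N.
  by rewrite size_XnsubC // eqSS -lt0n.
by rewrite /root !hornerE ?hornerXn subr_eq0 => /eqP h; exists d.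
Qed.

(** Polynomials over an infinite field are determined by their values; here a
    supply of points comes from the roots of unity. *)
Lemma poly_vanish (k : closedFieldType) (K : fieldType) (kap : {rmorphism k -> K}) p
    (R : {poly K}) : p \in [pchar k] -> (forall c, R.[kap c] = 0) -> R = 0.
Proof.
move=> pk R0; apply/eqP; apply/negPn/negP => Rn0.
(* [N] is prime to [p] and exceeds the degree of [R]. *)
pose N := (p * size R).+1.
have Nk : N%:R != 0 :> k.
  by rewrite /N -addn1 natrD natrM (pcharf0 pk) mul0r add0r oner_neq0.
have [z zP] := prim_root_ex (ltn0Sn _ : (0 < N)%N) Nk.
pose s := [seq kap (z ^+ i) | i <- iota 0 N].
have us : uniq s.
  rewrite map_inj_in_uniq ?iota_uniq // => i j.
  rewrite !mem_iota !add0n => /andP[_ iN] /andP[_ jN] /fmorph_inj/eqP.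
  by rewrite (eq_prim_root_expr zP) !modn_small // => /eqP.
have : all (root R) s by apply/allP => w /mapP[i _ ->]; rewrite /root R0.
move=> /(max_poly_roots Rn0) -/(_ us); rewrite size_map size_iota /N ltnNge => /negP; apply.
by rewrite leqW // leq_pmull // prime_gt0 // (pcharf_prime pk).
Qed.

Section Jacobson.
Variables (k : closedFieldType) (K : fieldType) (kap : {rmorphism k -> K}).
Variables (p : nat) (pk : p \in [pchar k]) (pK : p \in [pchar K]).
Let p_prime : prime p := pcharf_prime pK.
Let p_gt0 : (0 < p)%N := prime_gt0 p_prime.

(** A polynomial over [K] that is additive on the points of [k] only has the
    terms [X] and [X ^ p]: its derivative is invariant under translations. *)
Lemma additive_poly (E : {poly K}) : (size E <= p.+1)%N ->
  (forall a b, E.[kap (a + b)] = E.[kap a] + E.[kap b]) ->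
  E.[1] = E`_1 + E`_p.
Proof.
move=> sE Eadd.
have E0 : E.[0] = 0.
  have := Eadd 0 0; rewrite addr0 rmorph0 => /eqP.
  by rewrite -subr_eq subrr eq_sym => /eqP.
(* Additivity is invariance under translation up to a constant. *)
have tr (b : k) : E \Po ('X + (kap b)%:P) = E + (E.[kap b])%:P.
  apply/eqP; rewrite -subr_eq0; apply/eqP; apply: (poly_vanish (kap := kap) pk) => c.
  by rewrite hornerD hornerN horner_comp !hornerE -rmorphD Eadd subrr.
have dtr (b : k) : E^`().[kap b] = E^`().[0].
  have := congr1 (fun R : {poly K} => R^`().[0]) (tr b).
  by rewrite deriv_comp !derivD derivX !derivC !addr0 mulr1 horner_comp !hornerE.
have dE : E^`() = (E^`().[0])%:P.
  apply/eqP; rewrite -subr_eq0; apply/eqP; apply: (poly_vanish (kap := kap) pk) => c.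
  by rewrite !hornerE dtr subrr.
have Ej j : (1 < j < p)%N -> E`_j = 0.
  move=> /andP[j1 jp]; have /eqP := congr1 (fun R : {poly K} => R`_j.-1) dE.
  rewrite coef_deriv coefC prednK ?(ltnW j1) //.
  have -> : (j.-1 == 0)%N = false by apply/negbTE; rewrite -lt0n -ltnS prednK // ltnW.
  rewrite -mulr_natr mulf_eq0 => /orP[/eqP//|].
  by rewrite -(dvdn_pcharf pK) gtnNdvd // ltnW.
rewrite (horner_coef_wide _ sE) big_ord_recr expr1n mulr1 /=; congr (_ + _).
have p1 := prime_gt1 p_prime; case: (p) p1 Ej => [|[|p']] // _ Ej.
rewrite !big_ord_recl /= -horner_coef0 E0 mul0r add0r expr1n mulr1 /bump /= big1 ?addr0 // => i _.
by rewrite Ej ?mul0r // !add1n ltnS /= !ltnS; exact: ltn_ord.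
Qed.

Variables (D : {additive K -> K}).
Hypotheses (DM : forall f g, D (f * g) = D f * g + f * D g).
Hypotheses (Dk : forall c, D (kap c) = 0).

(** The values at [1] of the powers of the operator [D + g]. *)
Fixpoint cseq (g : K) n : K := if n is n'.+1 then D (cseq g n') + g * cseq g n' else 1.

Arguments cseq : simpl never.

Lemma cseqS g n : cseq g n.+1 = D (cseq g n) + g * cseq g n. Proof. by []. Qed.

Lemma cseqD g h n :
  cseq (g + h) n = \sum_(i < n.+1) (cseq g (n - i) * cseq h i) *+ 'C(n, i).
Proof.
elim: n => [|n IH]; first by rewrite big_ord_recl big_ord0 addr0 mulr1.
have step (i : nat) : D (cseq g (n - i) * cseq h i) + (g + h) * (cseq g (n - i) * cseq h i)
    = cseq g (n - i).+1 * cseq h i + cseq g (n - i) * cseq h i.+1.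
  by rewrite DM !cseqS; ring.
rewrite cseqS IH raddf_sum mulr_sumr -big_split /=.
rewrite (eq_bigr (fun i : 'I_n.+1 => (cseq g (n - i).+1 * cseq h i) *+ 'C(n, i) +
   (cseq g (n - i) * cseq h i.+1) *+ 'C(n, i))) => [|i _]; last first.
  by rewrite raddfMn /= mulrnAr -!mulrnDl step.
rewrite big_split /= [RHS]big_ord_recl /= subn0 bin0.
rewrite [in LHS]big_ord_recl /= subn0 bin0 -addrA; congr (_ + _).
rewrite [RHS](eq_bigr (fun i : 'I_n.+1 => (cseq g (n - i) * cseq h i.+1) *+ 'C(n, i.+1) +
   (cseq g (n - i) * cseq h i.+1) *+ 'C(n, i))) => [|i _]; last first.
  by rewrite /bump /= ?add1n binS mulrnDr subSS.
rewrite [RHS]big_split /=; congr (_ + _); rewrite [RHS]big_ord_recr /= bin_small // mulr0n addr0.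
by apply: eq_bigr => i _; rewrite /bump /= ?add1n -subSn // subSS.
Qed.

Lemma cseqp_add g h : cseq (g + h) p = cseq g p + cseq h p.
Proof.
rewrite cseqD big_ord_recr /= subnn binn mulr1n [cseq g 0]/cseq mul1r; congr (_ + _).
rewrite -(big_mkord xpredT (fun i => cseq g (p - i) * cseq h i *+ 'C(p, i))) (big_ltn p_gt0).
rewrite subn0 bin0 mulr1 big_nat big1 ?addr0 // => i /andP[i0 ip]; rewrite -mulr_natr.
have : (p %| 'C(p, i))%N by rewrite prime_dvd_bin // i0.
by rewrite (dvdn_pcharf pK) => /eqP->; rewrite mulr0.
Qed.

(** [cseq] of a multiple [t g] by a constant [t], as a polynomial in [t]. *)
Fixpoint cpoly (g : K) n : {poly K} :=
  if n is n'.+1 then map_poly D (cpoly g n') + g *: ('X * cpoly g n') else 1.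

Arguments cpoly : simpl never.

Lemma cpolyS g n : cpoly g n.+1 = map_poly D (cpoly g n) + g *: ('X * cpoly g n).
Proof. by []. Qed.

Lemma cpolyE g n c : (cpoly g n).[kap c] = cseq (kap c * g) n.
Proof.
elim: n => [|n IH]; first by rewrite hornerC.
have Dh (R : {poly K}) : (map_poly D R).[kap c] = D R.[kap c].
  rewrite (horner_coef_wide _ (size_poly _ _)) horner_coef raddf_sum.
  apply: eq_bigr => i _; rewrite coef_map /= DM.
  by rewrite -rmorphXn Dk mulr0 addr0.
by rewrite cpolyS hornerD hornerZ hornerM hornerX Dh IH cseqS; congr (_ + _); ring.
Qed.

Lemma size_cpoly g n : (size (cpoly g n) <= n.+1)%N.
Proof.
elim: n => [|n IH]; first by rewrite size_poly1.
rewrite cpolyS; apply: leq_trans (size_polyD _ _) _; rewrite geq_max; apply/andP; split.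
  by apply: leq_trans (size_poly _ _) (leqW IH).
apply: leq_trans (size_scale_leq _ _) _.
have [->|E0] := eqVneq (cpoly g n) 0; first by rewrite mulr0 size_poly0.
by rewrite mulrC size_mulX // ltnS.
Qed.

Lemma cpoly_coef0 g n : (cpoly g n.+1)`_0 = 0.
Proof.
elim: n => [|n IH]; rewrite cpolyS coefD coefZ coefXM eqxx mulr0 addr0.
  by rewrite coef_map /= coef1 (D1 DM).
by rewrite coef_map /= IH raddf0.
Qed.

Lemma cpoly_coef1 g n : (cpoly g n.+1)`_1 = iter n D g.
Proof.
elim: n => [|n IH].
  by rewrite cpolyS coefD coefZ coefXM coef_map /= !coef1 raddf0 add0r mulr1.
by rewrite cpolyS coefD coefZ coefXM coef_map IH /= cpoly_coef0 mulr0 addr0.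
Qed.

Lemma cpoly_lead g n : (cpoly g n)`_n = g ^+ n.
Proof.
elim: n => [|n IH]; first by rewrite coef1.
rewrite cpolyS coefD coefZ coefXM /= IH -exprS coef_map /=.
by rewrite nth_default ?raddf0 ?add0r // size_cpoly.
Qed.

(** Jacobson's formula for [(D + g) ^ p]: by the binomial theorem the polynomial
    [cpoly g p] is additive, so only its terms of degree [1] and [p] remain. *)
Lemma cseqp g : cseq g p = iter p.-1 D g + g ^+ p.
Proof.
have -> : cseq g p = (cpoly g p).[1].
  by rewrite -(rmorph1 kap) cpolyE rmorph1 mul1r.
rewrite additive_poly ?size_cpoly // => [|a b]; last first.
  by rewrite !cpolyE rmorphD mulrDl cseqp_add.
by have := cpoly_coef1 g p.-1; rewrite prednK // cpoly_lead => ->.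
Qed.

(** If [D f = g f] then [(D + g) ^ p] takes [1] to [D ^ p f / f = 0]; conversely
    the last nonzero element among the [(D - g) ^ i 1] is a suitable [f].  The
    condition on [g] says that the differential [g dx] is fixed by the Cartier
    operator [g dx |-> (- D ^ p.-1 g) ^ (1 / p) dx]. *)
Lemma log_diff (Dp0 : forall f, iter p D f = 0) g :
  (exists2 f, f != 0 & D f = g * f) <-> iter p.-1 D g + g ^+ p = 0.
Proof.
split=> [[f f0 fE]|gE].
  have h n : cseq g n * f = iter n D f.
    elim: n => [|n IH]; first by rewrite mul1r.
    by rewrite iterS -IH cseqS DM fE; ring.
  apply/eqP; rewrite -cseqp -(inj_eq (mulIf f0)) mul0r h; apply/eqP; exact: Dp0.
have c0 : cseq (- g) p == 0.
  have ND i : iter i D (- g) = - iter i D g.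
    by elim: i => //= i ->; rewrite raddfN.
  rewrite cseqp ND; have -> : (- g) ^+ p = - g ^+ p.
    by rewrite -!(pFrobenius_autE pK) rmorphN.
  by rewrite -opprD gE oppr0.
have [[|i] ci imin] := ex_minnP (ex_intro (fun i => cseq (- g) i == 0) p c0).
  by move: ci; rewrite /cseq oner_eq0.
exists (cseq (- g) i).
  by apply: contraTneq (ltnSn i) => h; rewrite -leqNgt imin // h.
by move: ci; rewrite cseqS mulNr subr_eq0 => /eqP.
Qed.

End Jacobson.

Section PBasisCurve.
Variables (k : closedFieldType) (K : fieldExtType (ratfun k)).
Variables (p h m n e : nat) (m_gt0 : (0 < m)%N) (n_gt0 : (0 < n)%N) (nE : n = (m * e)%N).
Variables (mk : m%:R != 0 :> k) (nk : n%:R != 0 :> k).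
Variables (pk : p \in [pchar k]) (pK : p \in [pchar K]) (h_gt0 : (0 < h)%N).
Hypothesis qE : n.+1 = (p ^ h)%N.
Local Notation kap := (kap K).
Variables (x y : K) (mod : model kap m n x y).
Let p_prime : prime p := pcharf_prime pK.
Let p_gt0 : (0 < p)%N := prime_gt0 p_prime.

(** [y] is a [p]-th power times a function of [x], because
    [y ^ n = (x ^ n + 1) ^ e] and [n.+1] is a power of [p].  At the place where
    [x = 0] and [y = 1], the values of the terms of a combination of
    [1, x, .., x ^ p.-1] over the [p]-th powers differ modulo [p]. *)
Lemma curve_p_basis : p_basis pK x.
Proof.
split=> [f|Q sQ Q0].
  pose Kp f := exists Q, f = (map_poly (pFrobenius_aut pK) Q).[x].
  have KpD g g' : Kp g -> Kp g' -> Kp (g + g').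
    by move=> [Q ->] [Q' ->]; exists (Q + Q'); rewrite rmorphD hornerD.
  have KpM g g' : Kp g -> Kp g' -> Kp (g * g').
    by move=> [Q ->] [Q' ->]; exists (Q * Q'); rewrite rmorphM hornerM.
  have Kpp g : Kp (g ^+ p) by exists g%:P; rewrite map_polyC hornerC.
  have KpX g i : Kp g -> Kp (g ^+ i).
    move=> Kg; elim: i => [|i IH]; last by rewrite exprS; apply: (KpM _ _).
    by rewrite expr0 -(expr1n _ p); exact: Kpp.
  have KpV g : Kp g -> Kp g^-1.
    have [->|g0] := eqVneq g 0; first by rewrite invr0.
    move=> Kg; have -> : g^-1 = g ^+ p.-1 * g^-1 ^+ p.
      by rewrite exprVn -{2}[p]prednK // exprSr invfM mulrA divff ?mul1r // expf_neq0.
    exact: (KpM _ _ (KpX _ _ Kg) (Kpp _)).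
  have Kpx : Kp x by exists 'X; rewrite map_polyX hornerX.
  have Kpk c : Kp (kap c).
    by have [d <-] := closed_fieldX c p_gt0; rewrite rmorphXn; exact: Kpp.
  have Kpe r : Kp (eval_x kap x r).
    elim/poly_ind: r => [|r c IH]; first by rewrite rmorph0 -(rmorph0 kap); apply: Kpk.
    by rewrite rmorphD rmorphM /= evxX evxC; exact: (KpD _ _ (KpM _ _ IH Kpx) (Kpk c)).
  have Kpy : Kp y.
    have -> : y = (y ^+ (p ^ h.-1)) ^+ p / (x ^+ n + 1) ^+ e.
      rewrite -exprM -expnSr prednK // -qE exprSr -(model_eq mod) -exprM -nE.
      by rewrite mulrAC divff ?mul1r // expf_neq0 // (y_neq0 m_gt0 n_gt0 mod).
    apply: (KpM _ _ (Kpp _)); apply: (KpV _); apply: (KpX _ _).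
    by apply: (KpD _ _ (KpX _ _ Kpx)); rewrite -(rmorph1 kap); exact: Kpk.
  have [G [r [_ ->]]] := model_rep mod f; apply: (KpM _ _); last exact: (KpV _ (Kpe r)).
  elim/poly_ind: G => [|G c IH]; first by rewrite rmorph0 -(rmorph0 kap); apply: Kpk.
  by rewrite rmorphD rmorphM /= evX evC; exact: (KpD _ _ (KpM _ _ IH Kpy) (Kpe c)).
have ab : (1 : k) ^+ m = 0 ^+ n + 1 by rewrite expr1n expr0n gtn_eqF // add0r.
have [P [_ _]] := point_place m_gt0 n_gt0 mk nk mod ab.
rewrite oner_eq0 rmorph0 subr0 => Px; have hv := place_valuation P.
have x0 := x_neq0 m_gt0 mod.
rewrite (horner_coef_wide _ (n := p)) in Q0; last exact: leq_trans (size_poly _ _) sQ.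
have E (i : 'I_p) : (map_poly (pFrobenius_aut pK) Q)`_i * x ^+ i = Q`_i ^+ p * x ^+ i.
  by rewrite coef_map /= pFrobenius_autE.
rewrite (eq_bigr _ (fun i _ => E i)) in Q0.
have F0 := sum_val_distinct hv _ Q0.
have {}F0 i : Q`_i ^+ p * x ^+ i = 0 \/ (p <= i)%N.
  have [ip|] := ltnP i p; last by right.
  left; apply: (F0 _ (Ordinal ip)) => j l; rewrite !mulf_eq0 !expf_eq0 p_gt0 (negbTE x0).
  rewrite !andbF !orbF /= => j0 l0.
  rewrite !(valM hv) ?expf_neq0 // !(valX hv) Px => jl; apply: val_inj => /=.
  have := ltn_ord j; have := ltn_ord l; move: jl; rewrite /= !natz.
  move: (P Q`_j) (P Q`_l) => u w uw lp jp.
  have {}uw : (j%:Z = l%:Z %[mod p%:Z])%Z.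
    have -> : j%:Z = (w - u) * p + l%:Z by clear -uw; lia.
    by rewrite modzMDl.
  by move: uw; rewrite !modz_nat !modn_small // => -[].
apply/polyP => i; rewrite coef0; have [/eqP|pi] := F0 i.
  by rewrite mulf_eq0 !expf_eq0 p_gt0 (negbTE x0) andbF orbF /= => /eqP.
by rewrite nth_default // (leq_trans sQ).
Qed.

End PBasisCurve.

(** * Local behaviour of logarithmic differentials *)

Lemma solve_prod (F : fieldType) (a b c u v : F) : a != 0 -> u != 0 ->
  a * b * u = c * a * v -> b = v / u * c.
Proof.
move=> a0 u0 E; apply: (mulfI a0); apply: (mulIf u0); rewrite E.
by field.
Qed.

Section LogDerivative.
Variables (K : fieldType) (d : {additive K -> K}).
Hypothesis dM : forall f g, d (f * g) = d f * g + f * d g.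

Lemma dlogM f g : f != 0 -> g != 0 -> d (f * g) / (f * g) = d f / f + d g / g.
Proof. by move=> f0 g0; rewrite dM; field; rewrite f0 g0. Qed.

Lemma dlogV f : f != 0 -> d f^-1 / f^-1 = - (d f / f).
Proof. by move=> f0; rewrite (DV dM f0); field; rewrite f0 oner_neq0. Qed.

Lemma dlogX f (i : int) : f != 0 -> d (f ^ i) / f ^ i = (d f / f) *~ i.
Proof.
move=> f0; have hn (j : nat) : d (f ^+ j) / f ^+ j = (d f / f) *+ j.
  elim: j => [|j IH]; first by rewrite (D1 dM) mul0r.
  by rewrite exprS dlogM ?expf_neq0 // IH mulrS.
case: i => i; first by rewrite -exprnP hn pmulrn.
by rewrite NegzE -exprnN dlogV ?expf_neq0 // hn mulrNz pmulrn.
Qed.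

End LogDerivative.

Section Local.
Variables (k : closedFieldType) (K : fieldExtType (ratfun k)).
Variables (p m n : nat) (m_gt0 : (0 < m)%N) (n_gt0 : (0 < n)%N).
Variables (mk : m%:R != 0 :> k) (nk : n%:R != 0 :> k).
Variables (pK : p \in [pchar K]).
Local Notation kap := (kap K).
Variables (x y : K) (mod : model kap m n x y).
Local Notation ev := (eval_xy kap x y).
Local Notation evx := (eval_x kap x).
Variable (d : {additive K -> K}).
Hypothesis dM : forall f g, d (f * g) = d f * g + f * d g.
Hypothesis dk : forall c, d (kap c) = 0.
Hypothesis dx : d x = y ^+ m.-1.

Lemma mK : m%:R != 0 :> K.
Proof. by have := mk; rewrite -(fmorph_eq0 kap) rmorph_nat. Qed.

(** The derivation [d] is dual to the differential [dx / y ^ m.-1], which has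
    neither zeros nor poles on the affine curve. *)
Lemma dy : d y = (n%:R / m%:R) * x ^+ n.-1.
Proof.
have y0 : y ^+ m.-1 != 0 by rewrite expf_neq0 // (y_neq0 m_gt0 n_gt0 mod).
have := congr1 d (model_eq mod); rewrite raddfD /= !(DX dM) (D1 dM) addr0 dx.
rewrite -[LHS]mulr_natr -[RHS]mulr_natr; exact: (solve_prod y0 mK).
Qed.

Lemma d_ev G : exists H, d (ev G) = ev H.
Proof.
have hx r : exists H, d (evx r) = ev H.
  elim/poly_ind: r => [|r c [H HE]]; first by exists 0; rewrite !rmorph0 raddf0.
  exists (H * 'X%:P + r%:P * 'X^(m.-1)); rewrite rmorphD rmorphM /= evxX evxC.
  by rewrite raddfD /= dM dk HE addr0 dx rmorphD !rmorphM rmorphXn /= !evC evX evxX.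
elim/poly_ind: G => [|G r [H HE]]; first by exists 0; rewrite !rmorph0 raddf0.
have [H' H'E] := hx r.
exists (H * 'X + G * (((n%:R / m%:R) *: 'X^(n.-1))%:P) + H').
rewrite rmorphD rmorphM /= evX evC raddfD /= dM HE H'E dy !rmorphD !rmorphM /= !evC !evX.
by rewrite -mul_polyC rmorphM rmorphXn /= evxX evxC fmorph_div !rmorph_nat.
Qed.

Section AtPoint.
Variables (a b : k) (ab : b ^+ m = a ^+ n + 1).
Local Notation v := (ordp m_gt0 n_gt0 mk nk mod ab).
Let hv := ordp_valuation m_gt0 n_gt0 mk nk mod ab.
Let t := ev (lpar a b).

Lemma d_unit f : v f = 0 -> f != 0 -> vge v 0 (d f / f).
Proof.
move=> vf f0; have [G [H [G0 H0 fE]]] := ordp_at m_gt0 n_gt0 mk nk mod ab f0.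
rewrite vf expr0z mul1r in fE.
have g0 := ev_neq0 m_gt0 mod ab G0; have h0 := ev_neq0 m_gt0 mod ab H0.
rewrite fE (dlogM dM) ?invr_eq0 // (dlogV dM) //.
have [G' ->] := d_ev G; have [H' ->] := d_ev H.
have hu A B : eval_pt a b B != 0 -> vge v 0 (ev A / ev B).
  move=> B0; rewrite (vge0M hv) ?ordp_ev //.
  by rewrite /vge (valV hv) ordp_unit // orbT.
by rewrite (vgeB hv) ?hu.
Qed.

Lemma d_lpar : v (d t) = 0 /\ d t != 0.
Proof.
have tE : exists G, eval_pt a b G != 0 /\ d t = ev G.
  rewrite /t /lpar; case: (eqVneq b 0) => b0.
    exists ((n%:R / m%:R) *: 'X^(n.-1))%:P; split.
      rewrite evpC hornerZ hornerXn mulf_neq0 ?invr_eq0 ?expf_neq0 //.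
        by rewrite mulf_neq0 // invr_eq0.
      exact: (a_neq0 m_gt0 n_gt0 ab b0).
    by rewrite evX dy evC -mul_polyC rmorphM rmorphXn /= evxX evxC fmorph_div !rmorph_nat.
  exists 'X^(m.-1); split; first by rewrite rmorphXn /= evpX expf_neq0.
  by rewrite evC rmorphB /= evxX evxC raddfB /= dk subr0 dx rmorphXn /= evX.
have [G [G0 ->]] := tE; split; first exact: ordp_unit.
exact: (ev_neq0 m_gt0 mod ab G0).
Qed.

(** With [f = t ^ i w], where [w] is a unit, [d f / f = i (d t / t) + d w / w]; the
    second term is regular and [d t / t] has a pole, so all depends on whether
    [i] is zero in [K]. *)
Lemma dlog_local f : f != 0 -> (p%:Z %| v f)%Z <-> vge v 0 (d f / f).
Proof.
move=> f0; have t0 : t != 0 by apply: (lpar_neq0 m_gt0 n_gt0 mod).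
have vt : v t = 1 by apply: ordp_lpar.
have vX (i : int) : v (t ^ i) = i.
  case: i => i; first by rewrite -exprnP (valX hv) vt natz.
  by rewrite NegzE -exprnN (valV hv) (valX hv) vt natz.
pose w := f / t ^ (v f).
have w0 : w != 0 by rewrite mulf_neq0 // invr_eq0 expfz_neq0.
have vw : v w = 0 by rewrite (val_div hv) ?expfz_neq0 // vX subrr.
have fE : f = t ^ (v f) * w by rewrite mulrC divfK // expfz_neq0.
have dE : d f / f = (d t / t) *~ (v f) + d w / w.
  by rewrite [in LHS]fE (dlogM dM) ?expfz_neq0 // (dlogX dM).
have dw := d_unit vw w0; have [vdt dt0] := d_lpar.
split=> [/dvdzP[i iE]|].
  by rewrite dE iE mulrzA -pmulrn -mulr_natr (pcharf0 pK) mulr0 add0r.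
move=> hf; have : vge v 0 ((d t / t) *~ (v f)).
  have -> : (d t / t) *~ (v f) = d f / f - d w / w by rewrite dE addrK.
  by rewrite (vgeB hv).
have tt0 : d t / t != 0 by rewrite mulf_neq0 // invr_eq0.
have [i0 _|i0] := eqVneq ((v f)%:~R : K) 0.
  move: i0; case: (v f) => i; last rewrite NegzE mulrNz; rewrite -?pmulrn => /eqP.
    by rewrite -(dvdn_pcharf pK) dvdzE.
  by rewrite oppr_eq0 -(dvdn_pcharf pK) dvdzE.
rewrite -mulrzr vge_neq0; last exact: mulf_neq0.
have vi : v (v f)%:~R = 0.
  have iE : (v f)%:~R = kap (v f)%:~R by rewrite rmorph_int.
  by rewrite iE (valC hv) //; apply: contra_neq i0 => h0; rewrite iE h0 rmorph0.
by rewrite (valM hv) // vi addr0 (val_div hv) // vdt vt.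
Qed.

End AtPoint.

Lemma dlog_place (P : place K) f : vge P 0 x -> f != 0 ->
  (p%:Z %| P f)%Z <-> vge P 0 (d f / f).
Proof.
move=> Px f0; have hv := place_valuation P.
have [a [b [ab hx hy]]] := place_point m_gt0 mod hv Px.
have E := ordp_uniq m_gt0 n_gt0 mk nk mod ab hv hx hy.
by rewrite /vge !E; apply: dlog_local.
Qed.

End Local.

(** * Holomorphic differentials *)

Lemma root_sum (k : fieldType) m (z : k) i j : m.-primitive_root z -> (i < m)%N -> (j < m)%N ->
  \sum_(l < m) (z ^+ i / z ^+ j) ^+ l = m%:R *+ (i == j).
Proof.
move=> zP im jm; have m_gt0 : (0 < m)%N by apply: leq_ltn_trans im.
have z0 l : z ^+ l != 0.
  rewrite expf_neq0 //; apply: contra_eqN (prim_expr_order zP) => /eqP->.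
  by rewrite expr0n gtn_eqF // eq_sym oner_neq0.
have [->|ij] := eqVneq i j.
  rewrite divff // (eq_bigr (fun _ => 1)) => [|l _]; last by rewrite expr1n.
  by rewrite sumr_const card_ord.
have w1 : z ^+ i / z ^+ j != 1.
  apply: contra_neq ij => w1; have /eqP : z ^+ i = z ^+ j by rewrite -[RHS]mul1r -w1 divfK.
  by rewrite (eq_prim_root_expr zP) !modn_small // => /eqP.
apply/eqP; rewrite mulr0n -(mulrI_eq0 _ (mulfI (_ : z ^+ i / z ^+ j - 1 != 0))) ?subr_eq0 //.
rewrite -subrX1 exprMn exprVn -!exprM ![(_ * m)%N]mulnC !exprM (prim_expr_order zP).
by rewrite !expr1n invr1 mulr1 subrr.
Qed.

Lemma subS_pred m j : (m - j.+1 = m.-1 - j)%N. Proof. lia. Qed.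

Lemma predB_lt m j : (0 < m)%N -> (m.-1 - j < m)%N. Proof. lia. Qed.

Lemma predBK m j : (j < m)%N -> ((m.-1 - j) + j = m.-1)%N. Proof. lia. Qed.

Section Holomorphic.
Variables (k : closedFieldType) (K : fieldExtType (ratfun k)).
Variables (p m n e : nat) (m_gt0 : (0 < m)%N) (n_gt0 : (0 < n)%N) (nE : n = (m * e)%N).
Variables (mk : m%:R != 0 :> k) (nk : n%:R != 0 :> k).
Variables (pk : p \in [pchar k]) (pK : p \in [pchar K]).
Local Notation kap := (kap K).
Local Notation x := (xK K).
Variables (y : K) (mod : model kap m n x y).
Local Notation ev := (eval_xy kap x y).
Local Notation evx := (eval_x kap x).
Local Notation u := (x^-1).
Local Notation z := (y / x ^+ e).
Let modi := modi m_gt0 nE mod.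
Let x0 : x != 0 := x_neq0 m_gt0 mod.
Let y0 : y != 0 := y_neq0 m_gt0 n_gt0 mod.

Section Components.
Variables (w : k) (w_prim : m.-primitive_root w) (s : {rmorphism K -> K}).
Variables (sk : forall c, s (kap c) = kap c) (sx : s x = x) (sy : s y = kap w * y).
Local Notation tw := (twist m_gt0 mod w_prim sk sx sy).

(** Averaging over the cyclic group extracts from a function its components in
    the eigenspaces, without introducing poles. *)
Lemma comp_regular (T : place K -> Prop) (A : 'I_m -> K) :
  (forall P, T P -> T (tw P)) -> (forall j, s (A j) = kap (w ^+ j) * A j) ->
  (forall P, T P -> vge P 0 (\sum_j A j)) -> forall P j, T P -> vge P 0 (A j).
Proof.
move=> Tt sA Tf P j TP; have hv := place_valuation P.
have Ti i : vge P 0 (iter i s (\sum_j A j)).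
  have : vge (iter i tw P) 0 (\sum_j A j).
    by apply: Tf; elim: i => //= i IH; apply: Tt.
  rewrite /vge iter_twistE => /orP[/eqP->|->]; last by rewrite orbT.
  by rewrite (_ : iter i s 0 = 0) ?eqxx //; elim: i => //= i ->; rewrite rmorph0.
have iA i (l : 'I_m) : iter i s (A l) = kap (w ^+ l ^+ i) * A l.
  elim: i => [|i IH]; first by rewrite expr0 rmorph1 mul1r.
  by rewrite iterS IH rmorphM sk sA mulrA -rmorphM exprSr.
have iS i : iter i s (\sum_j A j) = \sum_j iter i s (A j).
  by elim: i => //= i ->; rewrite rmorph_sum.
have E : kap m%:R * A j = \sum_(i < m) kap ((w ^+ j)^-1 ^+ i) * iter i s (\sum_j A j).
  transitivity (\sum_(l < m) kap (\sum_(i < m) (w ^+ l / w ^+ j) ^+ i) * A l).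
    rewrite (bigD1 j) //= (root_sum w_prim) // eqxx mulr1n.
    rewrite [X in _ + X]big1 ?addr0 // => l lj.
    by rewrite (root_sum w_prim) // (_ : (l == j :> nat) = false) ?mulr0n ?rmorph0 ?mul0r //; apply: negbTE.
  rewrite (eq_bigr (fun l : 'I_m => \sum_(i < m) kap ((w ^+ l / w ^+ j) ^+ i) * A l)) => [|l _].
    rewrite exchange_big /=; apply: eq_bigr => i _; rewrite iS mulr_sumr; apply: eq_bigr => l _.
    by rewrite iA mulrA -rmorphM exprMn mulrC [w ^- j ^+ i * _]mulrC [LHS]mulrC.
  by rewrite rmorph_sum mulr_suml.
have mk0 : kap m%:R != 0 by rewrite fmorph_eq0.
have -> : A j = kap (m%:R^-1) * (kap m%:R * A j) by rewrite mulrA -rmorphM mulVf // rmorph1 mul1r.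
rewrite E (vge0M hv) ?(vge_kap hv) // (vge_sum hv) // => i _.
by rewrite (vge0M hv) ?(vge_kap hv).
Qed.

End Components.

(** The coordinate ring of the affine curve is integrally closed: the components
    [r_j y ^ j] of [f] are regular, and a zero of a denominator of [r_j] would be
    a pole, since [y ^ j] has order less than the ramification index [m] at the
    points where [y = 0] and order [0] at the others. *)
Lemma regular_affine f : (forall P : place K, vge P 0 x -> vge P 0 f) ->
  exists2 G : {poly {poly k}}, (size G <= m)%N & f = ev G.
Proof.
move=> fP; have [w wP] := prim_root_ex m_gt0 mk.
have [s [sk sx sy]] := twist_ex m_gt0 mod (prim_expr_order wP).
have [G [r [sG r0 fE]]] := model_rep_red m_gt0 mod f.
have sr q : s (evx q) = evx q by apply: twist_evx.
pose A (j : 'I_m) := evx G`_j / evx r * y ^+ j.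
have fA : f = \sum_j A j.
  by rewrite fE (evE _ _ _ sG) mulr_suml; apply: eq_bigr => j _; rewrite mulrAC.
have Aj (P : place K) j : vge P 0 x -> vge P 0 (A j).
  move=> Px; apply: (@comp_regular w wP s sk sx sy (fun P : place K => vge P 0 x) A _ _ _ P j Px).
  - by move=> Q; rewrite /vge !twistE sx.
  - by move=> l; rewrite /A rmorphM fmorph_div !sr rmorphXn /= sy exprMn rmorphXn; ring.
  - by move=> Q; rewrite -fA; apply: fP.
have rn0 : r != 0 by apply: contraNneq r0 => ->; rewrite rmorph0.
have rG (j : nat) : (j < m)%N -> r %| G`_j.
  move=> jm; have [->|Gj0] := eqVneq G`_j 0; first exact: dvdp0.
  set g := gcdp r G`_j.
  have rE : r = (r %/ g) * g by rewrite divpK // dvdp_gcdl.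
  have GE : G`_j = (G`_j %/ g) * g by rewrite divpK // dvdp_gcdr.
  have cop : coprimep (r %/ g) (G`_j %/ g) by rewrite coprimep_div_gcd // rn0.
  have [/eqP/size_poly1P[c c0 rc]|/closed_rootP[a ra]] := eqVneq (size (r %/ g)) 1%N.
    by rewrite rE rc mul_polyC dvdpZl // dvdp_gcdr.
  have Ga := coprimep_root cop ra; have [r2 r2E] := factor_theorem _ _ ra.
  have [b ab] := closed_fieldX (a ^+ n + 1) m_gt0.
  (* [a] is a root of the reduced denominator, and [P] a place over it. *)
  pose P := mkplace (ordp_valuation m_gt0 n_gt0 mk nk mod ab).
  have hv := place_valuation P.
  have Pe q : P (evx q) = P (ev q%:P) by rewrite evC.
  have PG : P (evx (G`_j %/ g)) = 0 by rewrite Pe; apply: ordp_unit; rewrite evpC.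
  have Px := ordp_xsubE m_gt0 n_gt0 mk nk mod ab : P (x - kap a) = _.
  have Py : P y = (if b == 0 then 1 else 0).
    have [b0|b0] := eqVneq b 0.
      have ly : ev (lpar a b) = y by rewrite /lpar b0 eqxx evX.
      by have := ordp_lpar m_gt0 n_gt0 mk nk mod ab; rewrite ly.
    have := ordp_unit m_gt0 n_gt0 mk nk mod ab (G := 'X); rewrite evX evpX; exact.
  have P0 : vge P 0 x.
    have := ordp_ev m_gt0 n_gt0 mk nk mod ab 'X%:P; rewrite evC evxX; exact.
  have e0 q : q != 0 -> evx q != 0.
    by move=> q0; rewrite (evx_eq0 m_gt0 mod).
  have g0 : g != 0 by apply: contraNneq rn0 => h; rewrite rE h mulr0.
  have rg0 : r %/ g != 0 by apply: contraNneq rn0 => h; rewrite rE h mul0r.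
  have Gg0 : G`_j %/ g != 0 by apply: contraNneq Gj0 => h; rewrite GE h mul0r.
  have r20 : r2 != 0 by apply: contraNneq rg0 => h; rewrite r2E h mul0r.
  have AE : A (Ordinal jm) = evx (G`_j %/ g) / (evx r2 * (x - kap a)) * y ^+ j.
    have -> : evx r2 * (x - kap a) = evx (r %/ g).
      by rewrite r2E rmorphM rmorphB /= evxX evxC.
    rewrite /A /= {1}GE [in evx r]rE !rmorphM; congr (_ * _).
    by rewrite -mulf_div divff ?mulr1 ?e0.
  have xa0 := xsub_neq0 m_gt0 mod a.
  have := Aj P (Ordinal jm) P0; rewrite AE vge_neq0; last first.
    by rewrite !mulf_neq0 ?invr_eq0 ?mulf_neq0 ?e0 ?expf_neq0.
  rewrite (valM hv) ?mulf_neq0 ?invr_eq0 ?mulf_neq0 ?e0 ?expf_neq0 //.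
  rewrite (val_div hv) ?mulf_neq0 ?e0 // PG (valM hv) ?e0 // (valX hv) Px Py.
  have : 0 <= P (evx r2).
    by have := ordp_ev m_gt0 n_gt0 mk nk mod ab r2%:P; rewrite evC vge_neq0 ?e0.
  move: (P (evx r2)) => v v0 h; exfalso; move: h v0; clear -jm m_gt0.
  by case: eqP => _; rewrite ?mul0rn ?natz; lia.
exists (\poly_(j < m) (G`_j %/ r)); first exact: size_poly.
rewrite (evE _ _ _ (size_poly _ _)) fA; apply: eq_bigr => j _.
rewrite coef_poly ltn_ord /A; congr (_ * _).
by rewrite -{1}(divpK (rG j (ltn_ord j))) rmorphM mulfK.
Qed.

Lemma ab_inf : (1 : k) ^+ m = 0 ^+ n + 1.
Proof. by rewrite expr1n expr0n gtn_eqF // add0r. Qed.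

Definition Pinf : place K := mkplace (ordp_valuation m_gt0 n_gt0 mk nk modi ab_inf).

Lemma Pinf_u : Pinf u = 1.
Proof.
have := ordp_xsubE m_gt0 n_gt0 mk nk modi ab_inf.
by rewrite rmorph0 subr0 oner_eq0.
Qed.

Lemma Pinf_x : Pinf x = -1.
Proof. by rewrite -[x]invrK (valV (place_valuation Pinf)) Pinf_u. Qed.

Lemma Pinf_y : Pinf y = - e%:Z.
Proof.
have hv := place_valuation Pinf.
have Pz : Pinf z = 0.
  have := ordp_unit m_gt0 n_gt0 mk nk modi ab_inf (G := 'X).
  by rewrite evX evpX; apply; exact: oner_neq0.
have -> : y = z * x ^+ e by rewrite divfK // expf_neq0.
rewrite (valM hv) ?mulf_neq0 ?invr_eq0 ?expf_neq0 // Pz add0r (valX hv) Pinf_x.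
by rewrite mulNrn natz.
Qed.

Lemma Pinf_evx r : r != 0 -> Pinf (evx r) = - (size r).-1%:Z.
Proof.
have hv := place_valuation Pinf; have e0 q : q != 0 -> evx q != 0.
  by move=> q0; rewrite (evx_eq0 m_gt0 mod).
elim/poly_ind: r => [|r c IH]; first by rewrite eqxx.
have [->|r0] := eqVneq r 0.
  rewrite mul0r add0r polyC_eq0 => c0; rewrite evxC place_const size_polyC c0.
  by [].
move=> _; rewrite size_MXaddC (negbTE r0) /= rmorphD rmorphM /= evxX evxC.
have Pv : Pinf (evx r * x) = - (size r)%:Z.
  rewrite (valM hv) ?e0 // IH // Pinf_x; have := r0; rewrite -size_poly_gt0.
  by move: (size r) => [//|i] _ /=; clear; lia.
have [] // := val_dom hv (f := evx r * x) (g := kap c); first by rewrite mulf_neq0 ?e0.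
  apply: (vge_le (s := 0)); last exact: (vge_kap hv).
  by rewrite Pv; have := r0; rewrite -size_poly_gt0; move: (size r); clear; lia.
by rewrite Pv.
Qed.

(** Holomorphy of the differential [g dx].  It is compared with [dx / y ^ m.-1],
    and near infinity with the same form in the coordinates [u] and [z]; these
    have neither zeros nor poles there, and [dx = - x ^ 2 du]. *)
Definition hol g := forall P : place K,
  (vge P 0 x -> vge P 0 (y ^+ m.-1 * g)) /\
  (vge P 1 u -> vge P 0 (z ^+ m.-1 * x ^+ 2 * g)).

Lemma hol_sum (I : Type) (s : seq I) (Q : pred I) (F : I -> K) :
  (forall i, Q i -> hol (F i)) -> hol (\sum_(i <- s | Q i) F i).
Proof.
move=> hF P; have hv := place_valuation P; split=> hP; rewrite mulr_sumr.
  by apply: (vge_sum hv) => i Qi; have [-> //] := hF i Qi P.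
by apply: (vge_sum hv) => i Qi; have [_ ->] := hF i Qi P.
Qed.

Lemma hol_kap c g : hol g -> hol (kap c * g).
Proof.
move=> hg P; have hv := place_valuation P; have [h1 h2] := hg P.
by split=> hP; rewrite mulrCA (vge0M hv) ?(vge_kap hv) ?h1 ?h2.
Qed.

Lemma hol_mono i j : (j < m)%N -> (0 < i < j * e)%N -> hol (x ^+ i / y ^+ j / x).
Proof.
move=> jm /andP[i0 ij] P; have hv := place_valuation P.
have xE : x ^+ i = x ^+ i.-1 * x by rewrite -exprSr prednK.
have yE : y ^+ m.-1 = y ^+ (m.-1 - j) * y ^+ j by rewrite -exprD predBK.
split=> hP.
  have -> : y ^+ m.-1 * (x ^+ i / y ^+ j / x) = y ^+ (m.-1 - j) * x ^+ i.-1.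
    rewrite xE yE; move: (expf_neq0 j y0); move: (y ^+ j) => Y Y0.
    by move: (y ^+ _) (x ^+ i.-1) => Z X; field; rewrite Y0 x0.
  by rewrite (vge0M hv) ?(vge0X hv) // (vge_y m_gt0 mod).
have -> : z ^+ m.-1 * x ^+ 2 * (x ^+ i / y ^+ j / x) =
    z ^+ (m.-1 - j) * u ^+ (j * e - i.+1).
  have zE : z ^+ m.-1 = z ^+ (m.-1 - j) * (y ^+ j / x ^+ (j * e)).
    by rewrite [(j * e)%N]mulnC exprM -expr_div_n -exprD predBK.
  have -> : u ^+ (j * e - i.+1) = x ^+ i.+1 / x ^+ (j * e).
    rewrite -(subnK (_ : i.+1 <= j * e)%N) // addnK exprD exprVn.
    move: (expf_neq0 (j * e - i.+1) x0) (expf_neq0 i.+1 x0) => X0 X1.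
    by move: (x ^+ _) (x ^+ _) X0 X1 => X Y X0 Y0; field; rewrite X0 Y0.
  rewrite zE [x ^+ i.+1]exprS; move: (expf_neq0 j y0) (expf_neq0 (j * e) x0).
  move: (y ^+ j) (x ^+ (j * e)) (z ^+ _) (x ^+ i) => Y X Z Xi Y0 X0.
  by field; rewrite Y0 X0 x0.
have z1 : vge P 0 z.
  apply: (vge0_expr hv m_gt0); rewrite (model_eq modi) (vgeD hv) //.
    by rewrite (vge0X hv) //; apply: vge_le hP.
  by rewrite -(rmorph1 kap) (vge_kap hv).
by rewrite (vge0M hv) ?(vge0X hv) //; apply: vge_le hP.
Qed.

(** The monomials of [hol_mono] are all there is: on the affine curve the
    components of [g] for the cyclic group are polynomials in [x] times powers of
    [y], and the order at a single place at infinity bounds their degrees. *)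
Lemma hol_expand g : hol g -> exists R : nat -> {poly k},
  (forall j i, (R j)`_i != 0 -> (0 < i < j * e)%N) /\
  x * g = \sum_(j < m) evx (R j) / y ^+ j.
Proof.
move=> hg; have [w wP] := prim_root_ex m_gt0 mk.
have [s [sk sx sy]] := twist_ex m_gt0 mod (prim_expr_order wP).
have ym0 : y ^+ m.-1 != 0 by rewrite expf_neq0.
have [G sG GE] : exists2 G : {poly {poly k}}, (size G <= m)%N & y ^+ m.-1 * g = ev G.
  by apply: regular_affine => P; have [] := hg P.
have gE : g = \sum_(l < m) evx G`_l * y ^+ l / y ^+ m.-1.
  by rewrite -mulr_suml -(evE _ _ _ sG) -GE mulrAC divff // mul1r.
have hv := place_valuation Pinf.
have xe : x ^+ (e * m.-1) != 0 by rewrite expf_neq0.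
pose A (l : 'I_m) := x ^+ 2 / x ^+ (e * m.-1) * evx G`_l * y ^+ l.
have zA : z ^+ m.-1 * x ^+ 2 * g = \sum_l A l.
  rewrite gE mulr_sumr; apply: eq_bigr => l _; rewrite /A expr_div_n -exprM.
  by field; rewrite ym0 xe.
have sr q : s (evx q) = evx q by apply: twist_evx.
have Al l : vge Pinf 0 (A l).
  have Pu : vge Pinf 1 u by rewrite vge_neq0 ?invr_eq0 // Pinf_u.
  apply: (@comp_regular w wP s sk sx sy (fun P : place K => vge P 1 u) A _ _ _ Pinf l Pu).
  - by move=> P; rewrite /vge !twistE fmorphV sx.
  - move=> j; rewrite /A !rmorphM fmorphV !rmorphXn sr /= sx sy exprMn -rmorphXn; ring.
  - by move=> P Pu'; rewrite -zA; have [_] := hg P; apply.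
have degG (l : 'I_m) i : (G`_l)`_i != 0 -> (i.+1 < (m.-1 - l) * e)%N.
  move=> Gi; have Gl0 : G`_l != 0 by apply: contraNneq Gi => ->; rewrite coef0.
  have ig : (i < size (G`_l)%R)%N by rewrite ltnNge; apply: contraNN Gi => /(nth_default 0)->.
  have eG : evx G`_l != 0 by rewrite (evx_eq0 m_gt0 mod).
  have := Al l; rewrite /A vge_neq0; last by rewrite !mulf_neq0 ?invr_eq0 ?expf_neq0.
  rewrite !(valM hv) ?mulf_neq0 ?invr_eq0 ?expf_neq0 // (valV hv) !(valX hv).
  rewrite Pinf_x Pinf_y Pinf_evx //; have := ltn_ord l.
  rewrite !mulNrn natz; move: (size _) ig => d; rewrite mulnBl.
  clear -m_gt0 => id lm H; have : (l * e <= m.-1 * e)%N by rewrite leq_mul2r; lia.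
  move: H; rewrite -[e%:Z *+ l]mulr_natr !natz -PoszM mulnC; lia.
(* [y ^ l / y ^ m.-1 = y ^ - j] for [j = m.-1 - l], and the factor ['X] comes from
   [x * g]. *)
exists (fun j => if (j < m)%N then G`_(m.-1 - j) * 'X else 0); split=> [j i|].
  case: ltnP => jm; last by rewrite coef0 eqxx.
  rewrite coefMX; case: i => [|i]; first by rewrite /= eqxx.
  have lm := predB_lt j m_gt0.
  move=> /(degG (Ordinal lm)); rewrite /= subKn; first by move->.
  by rewrite -ltnS prednK.
rewrite gE mulr_sumr (reindex_inj rev_ord_inj); apply: eq_bigr => j _ /=.
rewrite ltn_ord rmorphM /= evxX.
rewrite subS_pred.
have -> : y ^+ m.-1 = y ^+ (m.-1 - j) * y ^+ j.
  by rewrite -exprD predBK.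
move: (expf_neq0 (m.-1 - j) y0) (expf_neq0 j y0); move: (y ^+ _) (y ^+ j) (evx _) => Y Z E Y0 Z0.
by field; rewrite Y0 Z0.
Qed.

Lemma mono_free (R : nat -> {poly k}) :
  \sum_(j < m) evx (R j) / y ^+ j = 0 -> forall j, (j < m)%N -> R j = 0.
Proof.
move=> R0; pose H : {poly {poly k}} := \poly_(l < m) R (m.-1 - l)%N.
have : H = 0.
  apply: (model_free mod); first exact: size_poly.
  rewrite (evE _ _ _ (size_poly _ _)) -[RHS](mulr0 (y ^+ m.-1)) -[in RHS]R0 mulr_sumr.
  rewrite [RHS](reindex_inj rev_ord_inj); apply: eq_bigr => l _; rewrite coef_poly ltn_ord /=.
  rewrite subS_pred.
  have -> : y ^+ m.-1 = y ^+ l * y ^+ (m.-1 - l).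
    by rewrite -exprD addnC predBK.
  move: (expf_neq0 (m.-1 - l) y0); move: (y ^+ _) (y ^+ l) (evx _) => Y Z E Y0.
  by field; rewrite Y0.
move=> H0 j jm; have := congr1 (fun p : {poly {poly k}} => p`_(m.-1 - j)) H0.
have lm := predB_lt j m_gt0.
by rewrite coef_poly lm coef0 subKn // -ltnS prednK.
Qed.

Section Derivation.
Variable (D : {additive K -> K}).
Hypothesis DM : forall f g, D (f * g) = D f * g + f * D g.
Hypothesis Dk : forall c, D (kap c) = 0.
Hypothesis Dx : D x = 1.

Definition scaled (c : K) (f : K) := c * D f.

Lemma scaled_zmod c : zmod_morphism (scaled c).
Proof. by move=> f g; rewrite /scaled raddfB mulrBr. Qed.
HB.instance Definition _ c := GRing.isZmodMorphism.Build K K (scaled c) (scaled_zmod c).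

Lemma scaledM c f g : scaled c (f * g) = scaled c f * g + f * scaled c g.
Proof. by rewrite /scaled DM; ring. Qed.

Lemma scaledk c a : scaled c (kap a) = 0.
Proof. by rewrite /scaled Dk mulr0. Qed.

(** The derivation dual to the differential of the second affine model. *)
Lemma scaled_u : scaled (- (z ^+ m.-1 * x ^+ 2)) u = z ^+ m.-1.
Proof. by rewrite /scaled (DV DM x0) Dx; field; rewrite x0. Qed.

(** The residue of [df / f] at a place is the order of [f] there, so [df / f] is
    without poles when the divisor of [f] vanishes modulo [p]. *)
Lemma hol_dlog f : f != 0 ->
  (forall P : place K, (p%:Z %| P f)%Z) <-> hol (D f / f).
Proof.
move=> f0; pose d1 : {additive K -> K} := scaled (y ^+ m.-1).
pose d2 : {additive K -> K} := scaled (- (z ^+ m.-1 * x ^+ 2)).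
have d1x : d1 x = y ^+ m.-1 by rewrite /d1 /= /scaled Dx mulr1.
have h1 (P : place K) : vge P 0 x -> (p%:Z %| P f)%Z <-> vge P 0 (y ^+ m.-1 * (D f / f)).
  move=> Px; rewrite mulrA.
  exact: (dlog_place m_gt0 n_gt0 mk nk pK mod (d := d1) (scaledM _) (scaledk _) d1x Px f0).
have h2 (P : place K) : vge P 1 u ->
    (p%:Z %| P f)%Z <-> vge P 0 (z ^+ m.-1 * x ^+ 2 * (D f / f)).
  move=> Pu; have Pu0 : vge P 0 u by apply: vge_le Pu.
  have := dlog_place m_gt0 n_gt0 mk nk pK modi (d := d2) (scaledM _) (scaledk _) scaled_u Pu0 f0.
  by rewrite -(vgeN (place_valuation P)) /d2 /= /scaled mulNr mulNr opprK mulrA.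
split=> [hf P|hg P]; first by split=> hP; [apply/(h1 P hP) | apply/(h2 P hP)].
have [g1 g2] := hg P; have [Px|Px] := boolP (vge P 0 x); first exact/(h1 P Px)/g1.
by have Pu := place_inf m_gt0 mod Px; apply/(h2 P Pu)/g2.
Qed.

End Derivation.
End Holomorphic.

(** * Fixed vectors of Frobenius-semilinear permutations *)

Lemma Fp_fixed p (k : fieldType) (iota : {rmorphism 'F_p -> k}) (a : k) :
  prime p -> a ^+ p = a -> exists c, a = iota c.
Proof.
move=> pp ap; have := congr1 (fun P => (map_poly iota P).[a]) (finField_genPoly 'F_p).
rewrite card_Fp // rmorphB /= map_polyXn map_polyX rmorph_prod horner_prod /=.
rewrite !hornerE ?hornerXn ap subrr => /esym/eqP/prodf_eq0[c _].
rewrite rmorphB /= map_polyX map_polyC !hornerE subr_eq0 => /eqP ac.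
by exists c.
Qed.

Section Lang.
Variables (p h : nat) (k : closedFieldType) (iota : {rmorphism 'F_p -> k}).
Variables (p_prime : prime p) (pk : p \in [pchar k]) (h_gt0 : (0 < h)%N).
Variables (Y : finType) (tau : Y -> Y) (tauh : forall s, iter h tau s = s).
Variables (beta : Y -> k) (beta0 : forall s, beta s != 0).

Definition fixed (c : Y -> k) := forall s, c (tau s) = beta s * c s ^+ p.

Let p_gt0 : (0 < p)%N := prime_gt0 p_prime.
Let q := (p ^ h)%N.

Lemma sum_exprp (I : Type) (s : seq I) (P : pred I) (F : I -> k) :
  (\sum_(i <- s | P i) F i) ^+ p = \sum_(i <- s | P i) F i ^+ p.
Proof.
by rewrite -!(pFrobenius_autE pk) rmorph_sum.
Qed.

(** The image of [a] at the single index [s] under the [i]-th iterate of the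
    semilinear map is [gam i s * a ^+ (p ^ i)] at the index [tau ^ i s]. *)
Fixpoint gam i (s : Y) : k :=
  if i is i'.+1 then beta (iter i' tau s) * gam i' s ^+ p else 1.

Definition orbit_sum s a (t : Y) : k :=
  \sum_(i < h) gam i s * a ^+ (p ^ i) * (iter i tau s == t)%:R.

Lemma gam_neq0 i s : gam i s != 0.
Proof. by elim: i => [|i IH] /=; rewrite ?oner_neq0 // mulf_neq0 ?expf_neq0. Qed.

Lemma tau_inj : injective tau.
Proof.
apply: (can_inj (g := iter h.-1 tau)) => s.
by rewrite -iterSr prednK.
Qed.

Lemma orbit_sum_fixed s a : gam h s * a ^+ q = a -> fixed (orbit_sum s a).
Proof.
move=> aE t; rewrite /orbit_sum sum_exprp mulr_sumr.
pose F i := gam i s * a ^+ (p ^ i) * (iter i tau s == tau t)%:R.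
have FS i : beta t * (gam i s * a ^+ (p ^ i) * (iter i tau s == t)%:R) ^+ p = F i.+1.
  rewrite /F /= (inj_eq tau_inj); case: eqVneq => [<-|_]; last first.
    by rewrite !mulr0 expr0n gtn_eqF // mulr0.
  by rewrite !mulr1 exprMn -exprM -expnSr mulrA.
rewrite [RHS](eq_bigr (fun i : 'I_h => F i.+1)) => [|i _]; last exact: FS.
have F0h : F 0%N = F h by rewrite /F tauh aE mul1r expr1.
have E : \sum_(i < h) F i + F h = F 0%N + \sum_(i < h) F i.+1.
  transitivity (\sum_(i < h.+1) F i); first by rewrite big_ord_recr.
  by rewrite big_ord_recl; congr (_ + _); apply: eq_bigr.
by apply: (addIr (F h)); rewrite -/F E F0h addrC.
Qed.

Lemma roots_gam s : exists rs : seq k, [/\ uniq rs, size rs = q &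
  forall a, a \in rs -> gam h s * a ^+ q = a].
Proof.
have g0 := gam_neq0 h s; have q1 : (1 < q)%N by rewrite -(expn0 p) ltn_exp2l // prime_gt1.
pose c := (gam h s)^-1; have c0 : c != 0 by rewrite invr_eq0.
pose R : {poly k} := 'X^q - c *: 'X.
have sc : (size (- (c *: 'X : {poly k})) < size ('X^q : {poly k}))%N.
  by rewrite size_polyN size_scale // size_polyX size_polyXn.
have sR : size R = q.+1 by rewrite size_polyDl // size_polyXn.
have lR : lead_coef R = 1 by rewrite lead_coefDl ?lead_coefXn.
have [rs rE] := closed_field_poly_normal R; rewrite lR scale1r in rE.
exists rs; split.
(* The derivative of [R] is the nonzero constant [- c]. *)
- rewrite -separable_prod_XsubC -rE unlock /R derivB derivZ derivXn derivX -mulr_natr.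
  have -> : q%:R = 0 :> {poly k}.
    by apply/eqP; rewrite -polyC_natr polyC_eq0 -(dvdn_pcharf pk) /q -(prednK h_gt0) dvdn_exp.
  by rewrite mulr0 sub0r -[- (c *: 1)]scaleNr coprimepZr ?oppr_eq0 // coprimep1.
- by apply: succn_inj; rewrite -(size_prod_XsubC rs id) -rE.
- move=> a ars; have : root R a by rewrite rE root_prod_XsubC.
  rewrite /root !hornerE ?hornerXn subr_eq0 => /eqP ->.
  by rewrite mulrA divff ?mul1r.
Qed.

(** The vectors [orbit_sum s a] span [k ^ Y]: a linear form vanishing on all of
    them gives, for each [s], a polynomial in [a] of degree at most
    [p ^ h.-1] with [p ^ h] roots, whose linear coefficient is the value of the
    form at [s].  A fixed vector has coordinates in the prime field with respect
    to a basis of fixed vectors. *)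
Lemma lang : exists V : 'I_#|Y| -> Y -> k,
  [/\ forall i, fixed (V i),
      forall c, fixed c -> exists d : 'rV['F_p]_#|Y|,
        forall s, c s = \sum_i iota (d 0 i) * V i s &
      forall d : 'rV['F_p]_#|Y|, (forall s, \sum_i iota (d 0 i) * V i s = 0) -> d = 0].
Proof.
pose rs s := projT1 (cid (roots_gam s)).
have rsP s : [/\ uniq (rs s), size (rs s) = q & forall a, a \in rs s -> gam h s * a ^+ q = a].
  by rewrite /rs; case: cid.
pose wv (i : Y * 'I_q) := orbit_sum i.1 (nth 0 (rs i.1) i.2).
pose M := \matrix_(i < #|{: Y * 'I_q}|, j < #|Y|) wv (enum_val i) (enum_val j).
have q0 : (0 < q)%N by rewrite expn_gt0 p_gt0.
have Mfull : row_full M.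
  rewrite -cokermx_eq0; apply/eqP/matrixP => t0 l; rewrite [RHS]mxE.
  set C := cokermx M; pose u s := C (enum_rank s) l.
  suff u0 s : u s = 0 by have := u0 (enum_val t0); rewrite /u enum_valK.
  (* The linear form [u] vanishes on the rows of [M], which are the orbit sums. *)
  have uM a : a \in rs s -> \sum_(i < h) gam i s * u (iter i tau s) * a ^+ (p ^ i) = 0.
    move=> ars; have iq : (index a (rs s) < q)%N by have [_ <- _] := rsP s; rewrite index_mem.
    have := congr1 (fun A : 'M_(_, _) => A (enum_rank (s, Ordinal iq)) l) (mulmx_coker M).
    rewrite !mxE => E; rewrite -[RHS]E -/C.
    rewrite (reindex (@enum_rank Y)) /=; last exact: onW_bij (enum_rank_bij Y).
    transitivity (\sum_t wv (s, Ordinal iq) t * u t); last first.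
      by apply: eq_bigr => t _; rewrite [M _ _]mxE !enum_rankK.
    rewrite /wv /orbit_sum /= nth_index //.
    rewrite (eq_bigr (fun t => \sum_(i < h) gam i s * a ^+ (p ^ i) * (iter i tau s == t)%:R * u t))
      => [|t _]; last by rewrite mulr_suml.
    rewrite exchange_big /=; apply: eq_bigr => i _.
    rewrite (bigD1 (iter i tau s)) //= eqxx mulr1 big1 => [|t]; first by rewrite addr0 mulrAC.
    by rewrite eq_sym => /negbTE->; rewrite mulr0 mul0r.
  pose R : {poly k} := \sum_(i < h) (gam i s * u (iter i tau s)) *: 'X^(p ^ i).
  have R0 : R = 0.
    apply/eqP; apply/negPn/negP => Rn0; have [urs srs _] := rsP s.
    have ra : all (root R) (rs s).
      apply/allP => a ars; rewrite /root -(uM a ars) horner_sum; apply/eqP/eq_bigr => i _.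
      by rewrite hornerZ hornerXn.
    have := max_poly_roots Rn0 ra urs; rewrite srs ltnNge => /negP; apply.
    apply: leq_trans (size_sum _ _ _) _; apply/bigmax_leqP => i _.
    apply: leq_trans (size_scale_leq _ _) _; rewrite size_polyXn /q.
    by rewrite ltn_exp2l // prime_gt1.
  have := congr1 (fun P : {poly k} => P`_1) R0; rewrite coef0 /R coef_sum.
  rewrite (bigD1 (Ordinal h_gt0)) //= big1 => [|i i0].
    by rewrite addr0 coefZ expn0 coefX mulr1 mul1r.
  rewrite coefZ coefXn; case: eqP; rewrite ?mulr0 // => /esym/eqP.
  by rewrite -[1%N](expn0 p) eqn_exp2l ?prime_gt1 // => /eqP i0'; case/eqP: i0; apply: val_inj.
pose V := rowsub (fullrankfun Mfull) M.
have Vu : V \in unitmx by apply: fullrowsub_unit.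
have Vfix i : fixed (fun s => V i (enum_rank s)).
  move=> s; rewrite /V !mxE !enum_rankK /wv; set z := enum_val _.
  apply: orbit_sum_fixed; have [_ sz ->//] := rsP z.1.
  by rewrite mem_nth // sz.
exists (fun i s => V i (enum_rank s)); split=> //.
- move=> c cf; pose cv : 'rV_#|Y| := \row_j c (enum_val j); pose d := cv *m invmx V.
  have cE s : c s = \sum_i d 0 i * V i (enum_rank s).
    have := congr1 (fun A : 'rV_#|Y| => A 0 (enum_rank s)) (mulmxKV Vu cv).
    by rewrite [in RHS]mxE enum_rankK mxE => <-.
  have dp : map_mx (pFrobenius_aut pk) d = d.
    apply: (can_inj (mulmxK Vu)); apply/matrixP => i j; rewrite ord1 [LHS]mxE [RHS]mxE.
    pose t := iter h.-1 tau (enum_val j).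
    have tE : tau t = enum_val j by rewrite /t -iterS prednK.
    have := cf t; rewrite !cE tE enum_valK => ->; rewrite sum_exprp mulr_sumr.
    apply: eq_bigr => l _; have -> : V l j = beta t * V l (enum_rank t) ^+ p by rewrite -Vfix tE enum_valK.
    by rewrite [map_mx _ _ _ _]mxE pFrobenius_autE exprMn mulrCA.
  have hd i : exists x, d 0 i = iota x.
    apply: Fp_fixed => //; have := congr1 (fun A : 'rV_#|Y| => A 0 i) dp.
    by rewrite mxE pFrobenius_autE.
  have [d' d'E] : exists d', forall i, d 0 i = iota (d' i).
    by exists (fun i => projT1 (cid (hd i))) => i; case: cid.
  by exists (\row_i d' i) => s; rewrite cE; apply: eq_bigr => i _; rewrite d'E; congr (iota _ * _); rewrite mxE.
- move=> d d0; have : map_mx iota d *m V = 0.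
    apply/matrixP => i j; rewrite ord1 [LHS]mxE [RHS]mxE -[RHS](d0 (enum_val j)); apply: eq_bigr => l _.
    by rewrite [map_mx _ _ _ _]mxE enum_valK.
  move=> /(congr1 (mulmx^~ (invmx V))); rewrite mulmxK // mul0mx => /matrixP dm.
  apply/matrixP => i j; have := dm i j; rewrite !mxE => /eqP; rewrite fmorph_eq0.
  by move/eqP.
Qed.

End Lang.

(** * Digits *)

Section Digits.
Variables (p h : nat) (p_gt1 : (1 < p)%N) (h_gt0 : (0 < h)%N).
Let p_gt0 : (0 < p)%N := ltnW p_gt1.

(** Words of [h] digits in base [p], the leading digit first. *)
Definition word := {ffun 'I_h -> 'I_p}.

Definition wval (w : word) := (\sum_(r < h) w r * p ^ (h.-1 - r))%N.

Definition lead_pos : 'I_h := Ordinal h_gt0.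

Definition wshift (w : word) : word := [ffun r => w (ordS r)].

Definition digit (w : word) r := if insub r is Some i then nat_of_ord (w i) else 0%N.

Lemma digE w (i : 'I_h) : digit w i = w i.
Proof. by rewrite /digit valK. Qed.

Lemma wvalE w : wval w = (\sum_(r < h) digit w r * p ^ (h.-1 - r))%N.
Proof. by apply: eq_bigr => i _; rewrite digE. Qed.

Lemma digits_ex I : exists a : nat -> nat, (forall r, (a r < p)%N) /\
  (\sum_(r < h) a r * p ^ (h.-1 - r) = I %% p ^ h)%N.
Proof.
elim: h => [|d [a [ap aE]]]; first by exists (fun _ => 0%N); rewrite big_ord0 modn1.
exists (fun r => if r == 0%N then I %/ p ^ d %% p else a r.-1)%N; split=> [r|].
  by case: ifP => _; rewrite ?ltn_mod.
rewrite big_ord_recl /= subn0.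
rewrite (eq_bigr (fun r : 'I_d => a r * p ^ (d.-1 - r)))%N => [|r _]; last first.
  by rewrite /bump /= add1n; congr (_ * p ^ _)%N; lia.
rewrite aE; set A := (_ + _)%N.
have IE : I = (I %/ p ^ d %/ p * p ^ d.+1 + A)%N.
  by rewrite /A addnA expnS mulnA -mulnDl -divn_eq -divn_eq.
rewrite IE modnMDl modn_small // /A => {IE A}.
have p0 : (0 < p ^ d)%N by rewrite expn_gt0 p_gt0.
apply: (@leq_trans ((I %/ p ^ d %% p).+1 * p ^ d)%N).
  by rewrite mulSn addnC ltn_add2r ltn_mod.
by rewrite expnS leq_mul2r ltn_mod p_gt0 orbT.
Qed.

Lemma wval_surj I : (I < p ^ h)%N -> exists w, wval w = I.
Proof.
move=> Iq; have [a [ap aE]] := digits_ex I; rewrite modn_small // in aE.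
by exists [ffun r : 'I_h => Ordinal (ap r)]; rewrite -aE; apply: eq_bigr => r _; rewrite ffunE.
Qed.

Definition word_of (I : 'I_(p ^ h)) : word := projT1 (cid (wval_surj (ltn_ord I))).

Lemma word_ofK I : wval (word_of I) = I.
Proof. by rewrite /word_of; case: cid. Qed.

Lemma word_of_bij : bijective word_of.
Proof.
apply: inj_card_bij => [I J E|]; first by apply: val_inj; rewrite /= -!word_ofK E.
by rewrite card_ffun !card_ord.
Qed.

Lemma wval_inj : injective wval.
Proof.
move=> w w' E; have [g gK Kg] := word_of_bij.
rewrite -(Kg w) -(Kg w'); congr word_of; apply: val_inj.
by rewrite /= -!word_ofK !Kg.
Qed.

Lemma sum_wval (R : nmodType) (F : nat -> R) :
  \sum_(w : word) F (wval w) = \sum_(i < p ^ h) F i.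
Proof.
rewrite (reindex word_of) /=; last exact: onW_bij word_of_bij.
by apply: eq_bigr => i _; rewrite word_ofK.
Qed.

(** Multiplication by [p] modulo [p ^ h - 1] rotates the digits. *)
Lemma wval_shift w : (p * wval w = w lead_pos * (p ^ h - 1) + wval (wshift w))%N.
Proof.
have sE (r : 'I_h) : digit (wshift w) r = digit w (r.+1 %% h).
  by rewrite digE ffunE -digE.
have fE : nat_of_ord (w lead_pos) = digit w 0 by rewrite -digE.
rewrite !wvalE fE [in RHS](eq_bigr _ (fun r _ => congr1 (muln^~ _) (sE r))).
move: h_gt0 (digit w) => {sE fE}; case: h => // d _ a /=.
rewrite big_ord_recl [in RHS]big_ord_recr /= subn0 subnn muln1 modnn mulnDr.
have -> : (p * \sum_(i < d) a (bump 0 i) * p ^ (d - bump 0 i) =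
  \sum_(i < d) a (i.+1 %% d.+1) * p ^ (d - i))%N.
  rewrite big_distrr; apply: eq_bigr => i _ /=; rewrite /bump /= add1n modn_small; last first.
    by rewrite ltnS ltn_ord.
  by rewrite mulnCA -expnS subnSK.
rewrite mulnCA -expnS mulnBr muln1.
have : (a 0%N <= a 0%N * p ^ d.+1)%N by rewrite leq_pmulr // expn_gt0 p_gt0.
move: (a 0%N) (a 0%N * p ^ d.+1)%N (\sum_(i < d) _)%N => A B C; clear; lia.
Qed.

Lemma wshift_inj : injective wshift.
Proof.
move=> w w' E; apply/ffunP => i.
have := congr1 (fun v : word => v (ord_pred i)) E; rewrite !ffunE ord_predK.
exact.
Qed.

Lemma iter_wshift i w (r : 'I_h) : digit (iter i wshift w) r = digit w ((r + i) %% h).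
Proof.
elim: i r => [|i IH] r; first by rewrite addn0 modn_small.
by rewrite iterS digE ffunE -digE IH /= modnDml addSnnS.
Qed.

Lemma iter_wshift_h w : iter h wshift w = w.
Proof.
apply/ffunP => r; apply: val_inj.
by rewrite /= -!digE iter_wshift modnDr modn_small.
Qed.

Lemma iter_wshift_first (i : 'I_h) w : iter i wshift w lead_pos = w i :> nat.
Proof. by rewrite -!digE iter_wshift add0n modn_small. Qed.

Definition word_le (w v : word) := [forall r, w r <= v r]%N.

Lemma word_le_val w v : word_le w v -> (wval w <= wval v)%N.
Proof. by move/forallP => wv; apply: leq_sum => r _; rewrite leq_mul2r wv orbT. Qed.

Definition word0 : word := [ffun=> Ordinal p_gt0].

Lemma wval0 : wval word0 = 0%N.
Proof. by rewrite /wval big1 // => r _; rewrite ffunE. Qed.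

Lemma wval_eq0 w : (wval w == 0%N) = (w == word0).
Proof. by rewrite -wval0 (inj_eq wval_inj). Qed.

Lemma card_word_le v : #|[set w : word | word_le w v]| = (\prod_(r < h) (v r + 1))%N.
Proof.
have -> : #|[set w : word | word_le w v]| = #|family (fun r => [pred i : 'I_p | (i < (v r).+1)%N])|.
  by rewrite cardsE; apply: eq_card => w; rewrite inE; apply/forallP/familyP.
rewrite card_family foldrE big_map big_enum; apply: eq_bigr => r _ /=.
rewrite -sum1_card (eq_bigl (fun i : 'I_p => i < (v r).+1)%N) //.
by rewrite (big_ord_narrow (ltn_ord (v r))) sum_nat_const card_ord muln1 addn1.
Qed.

Section Multiples.
Variables (m e : nat) (m_gt0 : (0 < m)%N) (qE : (p ^ h - 1 = m * e)%N).

Definition mulp (j : 'I_m) : 'I_m := Ordinal (ltn_pmod (p * j) m_gt0).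

Lemma qm : (p ^ h = m * e + 1)%N.
Proof. by rewrite -qE subnK // expn_gt0 p_gt0. Qed.

Lemma mdig_lt j r : (p * (p ^ r * j %% m) %/ m < p)%N.
Proof. by rewrite ltn_divLR // ltn_pmul2l // ltn_mod. Qed.

(** The digits of [j * e = j * (p ^ h - 1) / m], by long division. *)
Definition mword (j : 'I_m) : word := [ffun r : 'I_h => Ordinal (mdig_lt j r)].

Lemma wval_mword j : wval (mword j) = (j * e)%N.
Proof.
pose a r := (p * (p ^ r * j %% m) %/ m)%N.
have H d : (m * \sum_(r < d) a r * p ^ (d.-1 - r) + p ^ d * j %% m = p ^ d * j)%N.
  elim: d => [|d IH]; first by rewrite big_ord0 muln0 expn0 mul1n modn_small.
  rewrite big_ord_recr /= subnn muln1.
  have -> : (\sum_(r < d) a r * p ^ (d - r) = p * \sum_(r < d) a r * p ^ (d.-1 - r))%N.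
    rewrite big_distrr; apply: eq_bigr => r _ /=; rewrite mulnCA -expnS; congr (_ * p ^ _)%N.
    by have := ltn_ord r; lia.
  rewrite expnS -mulnA -{2}IH mulnDr mulnDr mulnCA -addnA; congr (_ + _)%N.
  by rewrite -modnMmr /a mulnC -divn_eq.
have E : (p ^ h * j = e * j * m + j)%N by rewrite qm mulnDl mul1n -mulnA mulnC.
have := H h; rewrite E modnMDl modn_small // => /eqP; rewrite eqn_add2r mulnC eqn_pmul2r //.
move=> /eqP; rewrite mulnC => <-; apply: eq_bigr => r _.
by rewrite ffunE.
Qed.

Lemma mulp_shift j : mword (mulp j) = wshift (mword j).
Proof.
apply/ffunP => r; apply: val_inj; rewrite !ffunE /= modnMmr mulnA -expnSr.
have [rh|rh] := ltnP r.+1 h; first by rewrite (modn_small rh).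
have -> : r.+1 = h by apply/eqP; rewrite eqn_leq ltn_ord rh.
rewrite modnn expn0 mul1n; congr (_ * _ %/ _)%N.
by rewrite qm mulnDl mul1n -mulnA mulnC modnMDl.
Qed.

Lemma mulp_first (j : 'I_m) : (p * j = m * mword j lead_pos + mulp j)%N.
Proof. by rewrite ffunE /= expn0 mul1n (modn_small (ltn_ord j)) [(m * _)%N]mulnC -divn_eq. Qed.

Lemma iter_mulp_h j : iter h mulp j = j.
Proof.
have H i : iter i mulp j = (p ^ i * j %% m)%N :> nat.
  elim: i => [|i IH]; first by rewrite expn0 mul1n modn_small.
  by rewrite iterS /= IH modnMmr mulnA -expnS.
by apply: val_inj; rewrite /= H qm mulnDl mul1n -mulnA mulnC modnMDl modn_small.
Qed.

(** A pair of a residue [j] and a word [w] stands for the monomial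
    [x ^ wval w / y ^ j]; Frobenius acts on such pairs by [frob_rot]. *)
Definition mono_index := ('I_m * word)%type.

Definition frob_rot (s : mono_index) : mono_index := (mulp s.1, wshift s.2).

Lemma iter_rotE i s : iter i frob_rot s = (iter i mulp s.1, iter i wshift s.2).
Proof. by elim: i => [|i IH] /=; [case: s | rewrite IH]. Qed.

Lemma iter_rot_h s : iter h frob_rot s = s.
Proof. by rewrite iter_rotE iter_mulp_h iter_wshift_h -surjective_pairing. Qed.

(** The coefficient of Frobenius on an index is a binomial coefficient of leading
    digits.  It is nonzero along the whole orbit when the word is below [mword]
    digit by digit; the two extreme words are the monomials that have a pole. *)
Definition ordinary (s : mono_index) :=
  [&& word_le s.2 (mword s.1), s.2 != word0 & s.2 != mword s.1].

Lemma ordinary_rot s : ordinary s -> ordinary (frob_rot s).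
Proof.
case/and3P=> le w0 wj; rewrite /ordinary /frob_rot /= mulp_shift; apply/and3P; split.
- by apply/forallP => r; have := forallP le (ordS r); rewrite !ffunE.
- apply: contra_neq w0 => E; apply: wshift_inj; rewrite E.
  by apply/ffunP => r; rewrite !ffunE.
- by rewrite (inj_eq wshift_inj).
Qed.

(** These are the bounds under which [hol_mono] gives a holomorphic differential. *)
Lemma ordinary_bounds s : ordinary s -> (0 < wval s.2 < s.1 * e)%N.
Proof.
case/and3P=> le w0 wj; rewrite lt0n wval_eq0 w0 -wval_mword ltn_neqAle word_le_val // andbT.
by rewrite (inj_eq wval_inj).
Qed.

Lemma iter_rot_first (r : 'I_h) s :
  ((iter r frob_rot s).2 lead_pos = s.2 r :> nat) * (mword (iter r frob_rot s).1 lead_pos = mword s.1 r :> nat).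
Proof.
rewrite iter_rotE /= iter_wshift_first; split=> //.
have -> : mword (iter r mulp s.1) = iter r wshift (mword s.1).
  by elim: (nat_of_ord r) => //= i <-; rewrite mulp_shift.
by rewrite iter_wshift_first.
Qed.

Lemma card_ordinary_at (j : 'I_m) : (0 < e)%N ->
  (#|[set w | ordinary (j, w)]| + (if j == 0%N :> nat then 0 else 2) =
   if j == 0%N :> nat then 0 else \prod_(r < h) (mword j r + 1))%N.
Proof.
move=> e0; case: eqVneq => [j0|j0].
  rewrite addn0; apply/eqP; rewrite cards_eq0; apply/eqP/setP => w; rewrite !inE.
  by apply/negP => /ordinary_bounds /=; rewrite j0 mul0n ltn0 andbF.
have m0 : mword j != word0 by rewrite -wval_eq0 wval_mword muln_eq0 negb_or j0 -lt0n.
rewrite -card_word_le; set A := [set w | word_le w _].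
have A0 : word0 \in A by rewrite inE; apply/forallP => r; rewrite ffunE.
have A1 : mword j \in A :\ word0 by rewrite !inE m0; apply/forallP => r.
rewrite (cardsD1 word0 A) A0 (cardsD1 (mword j) (A :\ _)) A1.
have -> : [set w | ordinary (j, w)] = A :\ word0 :\ mword j.
  by apply/setP => w; rewrite !inE /ordinary /=; case: (word_le w _); case: (w == word0); case: (w == mword j).
by rewrite addnC.
Qed.

Lemma card_ordinary : (0 < e)%N ->
  (#|[set s | ordinary s]| + 2 * m.-1 =
   \sum_(j < m | j != 0%N :> nat) \prod_(r < h) (mword j r + 1))%N.
Proof.
move=> e0; have -> : #|[set s | ordinary s]| = (\sum_(j < m) #|[set w | ordinary (j, w)]|)%N.
  rewrite -sum1_card (eq_bigr (fun j => \sum_(w in [set w | ordinary (j, w)]) 1)%N) => [|j _].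
    by rewrite pair_big_dep; apply: eq_bigl => -[j w]; rewrite !inE.
  by rewrite sum1_card.
have -> : (2 * m.-1 = \sum_(j < m) if j == 0%N :> nat then 0 else 2)%N.
  case: m m_gt0 => // m' _; rewrite big_ord_recl /= add0n sum_nat_const card_ord.
  by rewrite mulnC.
rewrite -big_split [RHS]big_mkcond; apply: eq_bigr => j _ /=.
by rewrite card_ordinary_at //; case: eqP.
Qed.

End Multiples.

End Digits.

(** * The Cartier operator on monomials *)

Lemma ffact_pred (F : fieldType) p M : p \in [pchar F] ->
  (M ^_ p.-1)%:R = (if (p %| M.+1)%N then -1 else 0) :> F.
Proof.
move=> pF; have pp := pcharf_prime pF; have p_gt0 := prime_gt0 pp.
have p0 i : (i * p)%:R = 0 :> F by rewrite natrM (pcharf0 pF) mulr0.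
rewrite ffact_prod natr_prod; case: ifP => [/dvdnP[a aE]|pM].
  have [b bE] : exists b, M = (b * p + p.-1)%N.
    by case: a aE => // b bE; exists b; rewrite mulSn in bE; move: bE p_gt0; clear; lia.
  rewrite (eq_bigr (fun i : 'I_p.-1 => (p.-1 - i)%:R)) => [|i _].
    rewrite -natr_prod -ffact_prod ffactnn; apply/eqP; rewrite -subr_eq0 opprK natr1.
    by rewrite -(dvdn_pcharf pF) -Wilson // prime_gt1.
  by rewrite bE -addnBA ?natrD ?p0 ?add0r // ltnW.
have rp : (M %% p < p.-1)%N.
  have := ltn_pmod M p_gt0; rewrite -{2}(prednK p_gt0) ltnS leq_eqVlt => /orP[/eqP rE|//].
  case/negP: (negbT pM); apply/dvdnP; exists (M %/ p).+1.
  by rewrite {1}(divn_eq M p) rE mulSn -addnS prednK // addnC.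
rewrite (bigD1 (Ordinal rp)) //= {1}(divn_eq M p) addnK p0 mul0r.
by [].
Qed.

Lemma natr_inj_lt (F : fieldType) p i j : p \in [pchar F] -> (i < p)%N -> (j < p)%N ->
  (i%:R == j%:R :> F) = (i == j).
Proof.
move=> pF; wlog ij : i j / (i <= j)%N => [H ip jp|ip jp].
  by case/orP: (leq_total i j) => h; last rewrite eq_sym [RHS]eq_sym; apply: H.
apply/eqP/eqP => [E|->//]; apply/eqP; rewrite eqn_leq ij -subn_eq0 /=.
have : (p %| j - i)%N by rewrite (dvdn_pcharf pF) natrB // E subrr.
by case: (j - i)%N (leq_ltn_trans (leq_subr i j) jp) => // d dp; rewrite gtnNdvd.
Qed.

Section Cartier.
Variables (k : closedFieldType) (K : fieldExtType (ratfun k)).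
Variables (p h m n e : nat) (m_gt0 : (0 < m)%N) (n_gt0 : (0 < n)%N) (nE : n = (m * e)%N).
Variables (mk : m%:R != 0 :> k) (nk : n%:R != 0 :> k).
Variables (p_prime : prime p) (h_gt0 : (0 < h)%N).
Variables (pk : p \in [pchar k]) (pK : p \in [pchar K]).
Hypothesis qE : (p ^ h - 1 = m * e)%N.
Local Notation kap := (kap K).
Local Notation x := (xK K).
Variables (y : K) (mod : model kap m n x y).
Let x0 : x != 0 := x_neq0 m_gt0 mod.
Let y0 : y != 0 := y_neq0 m_gt0 n_gt0 mod.
Let p_gt1 : (1 < p)%N := prime_gt1 p_prime.
Let p_gt0 : (0 < p)%N := prime_gt0 p_prime.

Variable (D : {additive K -> K}).
Hypothesis DM : forall f g, D (f * g) = D f * g + f * D g.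
Hypothesis Dk : forall c, D (kap c) = 0.
Hypothesis Dx : D x = 1.

Lemma D_iter_x i M : iter i D (x ^+ M) = (M ^_ i)%:R * x ^+ (M - i).
Proof.
elim: i => [|i IH]; first by rewrite subn0 mul1r.
rewrite iterS IH DM (DX DM) Dx mulr1 -(rmorph_nat kap) Dk mul0r add0r rmorph_nat.
by rewrite ffactnSr natrM -[x ^+ _ *+ _]mulr_natl mulrA subnS.
Qed.

Lemma D_iter_pM i f g : iter i D (f ^+ p * g) = f ^+ p * iter i D g.
Proof. by elim: i => //= i ->; rewrite (DpM pK DM). Qed.

Lemma D_iter_kap i c g : iter i D (kap c * g) = kap c * iter i D g.
Proof. by elim: i => //= i ->; rewrite DM Dk mul0r add0r. Qed.

Lemma D_iter_sum i (I : Type) (s : seq I) (Q : pred I) (F : I -> K) :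
  iter i D (\sum_(j <- s | Q j) F j) = \sum_(j <- s | Q j) iter i D (F j).
Proof. by elim: i => //= i ->; rewrite raddf_sum. Qed.

Local Notation mono_index := (mono_index p h m).
Local Notation frob_rot := (@frob_rot p h m m_gt0).
Local Notation fst0 := (lead_pos h_gt0).
Local Notation mword := (mword h p_gt1 m_gt0).

Definition monom (s : mono_index) : K := x ^+ wval s.2 / y ^+ s.1.

(** [s] and its rotation [frob_rot s] are related by the leading digits [l] of the
    word and [d] of [mword]: [p] times an exponent is the rotated exponent plus
    a multiple of [n], resp. of [m], and [y ^ m = x ^ n + 1]. *)
Lemma mono_rot s : monom (frob_rot s) * x ^+ (n * s.2 fst0) =
  monom s ^+ p * (x ^+ n + 1) ^+ mword s.1 fst0.
Proof.
case: s => j w; rewrite /monom /=.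
have := wval_shift p_gt1 h_gt0 w; rewrite qE -nE => wE.
have := mulp_first p_gt1 h_gt0 m_gt0 j => jE.
have xE : x ^+ (wval w * p) = x ^+ (n * w fst0) * x ^+ wval (wshift w).
  by rewrite mulnC wE exprD mulnC.
have yE : y ^+ (j * p) = (x ^+ n + 1) ^+ mword j fst0 * y ^+ mulp p m_gt0 j.
  by rewrite mulnC jE exprD exprM (model_eq mod).
rewrite expr_div_n -!exprM xE yE.
have y1 : y ^+ mulp p m_gt0 j != 0 by rewrite expf_neq0.
have y2 : (x ^+ n + 1) ^+ mword j fst0 != 0 by rewrite expf_neq0 // (xn1_neq0 m_gt0 n_gt0 mod).
move: (y ^+ _) (_ ^+ mword j fst0) (x ^+ (n * _)) (x ^+ wval _) y1 y2 => Y Z A B Y0 Z0.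
by field; rewrite Y0 Z0.
Qed.

(** Once the [p]-th powers are taken out, [p.-1] differentiations keep only the
    terms whose exponent is congruent to [-1] modulo [p].  In the expansion of
    [(x ^ n + 1) ^ d] this is the term of degree [n * l] alone, since [n] is [-1]
    modulo [p] and [l, d < p]. *)
Lemma cartier_mono s : iter p.-1 D (monom (frob_rot s) / x) =
  - ('C(mword s.1 fst0, s.2 fst0))%:R * (monom s / x) ^+ p.
Proof.
set l := nat_of_ord (s.2 fst0); set d := nat_of_ord (mword s.1 fst0).
have lp : (l < p)%N by apply: ltn_ord. have dp : (d < p)%N by apply: ltn_ord.
have nlE : x ^+ (n * l) != 0 by rewrite expf_neq0.
pose A := monom s / x / x ^+ (n * l).
have E : monom (frob_rot s) / x = A ^+ p *
    \sum_(t < d.+1) kap ('C(d, t))%:R * x ^+ (n * t + n * l * p.-1 + p.-1).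
  have -> : monom (frob_rot s) = monom s ^+ p * (x ^+ n + 1) ^+ d / x ^+ (n * l).
    by rewrite -mono_rot mulfK.
  have -> : (x ^+ n + 1) ^+ d = \sum_(t < d.+1) kap ('C(d, t))%:R * x ^+ (n * t).
    rewrite addrC exprDn; apply: eq_bigr => t _.
    by rewrite expr1n mul1r -exprM rmorph_nat mulr_natl.
  have -> : \sum_(t < d.+1) kap ('C(d, t))%:R * x ^+ (n * t + n * l * p.-1 + p.-1) =
    (\sum_(t < d.+1) kap ('C(d, t))%:R * x ^+ (n * t)) * (x ^+ (n * l) ^+ p.-1 * x ^+ p.-1).
    by rewrite mulr_suml; apply: eq_bigr => t _; rewrite -addnA exprD exprD -exprM mulrA.
  have pE (f : K) : f ^+ p = f * f ^+ p.-1 by rewrite -exprS prednK.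
  rewrite /A; move: (monom s) => Mo; rewrite !expr_div_n (pE x) (pE (x ^+ (n * l))).
  move: (\sum_(t < _) _) (expf_neq0 p.-1 x0) (expf_neq0 p.-1 nlE).
  move: (Mo ^+ p) (x ^+ p.-1) (x ^+ (n * l) ^+ p.-1) (x ^+ (n * l)) nlE.
  by move=> M X Y Z Z0 S X0 Y0; field; rewrite X0 Y0 Z0 x0.
have n1 : n%:R = -1 :> K.
  have : (p ^ h)%:R = 0 :> K by rewrite natrX (pcharf0 pK) expr0n gtn_eqF.
  rewrite -(subnK (_ : 0 < p ^ h)%N) ?expn_gt0 ?p_gt0 // qE -nE natrD => /eqP.
  by rewrite addr_eq0 => /eqP.
have Mp (t : 'I_d.+1) : (p %| (n * t + n * l * p.-1 + p.-1).+1)%N = (t == l :> nat).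
  have -> : (n * t + n * l * p.-1 + p.-1).+1 = (n * t + n * l * p.-1 + p)%N.
    by rewrite -addnS prednK.
  rewrite dvdn_addl // (dvdn_pcharf pK) natrD !natrM n1 !mulN1r mulNr.
  have -> : p.-1%:R = -1 :> K.
    by apply/eqP; rewrite -addr_eq0 natr1 prednK // (pcharf0 pK).
  rewrite mulrN mulr1 opprK addrC subr_eq0 eq_sym (natr_inj_lt pK) //.
  by rewrite (leq_ltn_trans _ dp) // -ltnS.
have T (t : 'I_d.+1) : iter p.-1 D (kap ('C(d, t))%:R * x ^+ (n * t + n * l * p.-1 + p.-1)) =
    kap ('C(d, t))%:R * ((if t == l :> nat then -1 else 0) * x ^+ (n * t + n * l * p.-1)).
  by rewrite D_iter_kap D_iter_x (ffact_pred _ pK) Mp addnK.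
rewrite E D_iter_pM D_iter_sum (eq_bigr _ (fun t _ => T t)).
have [ld|dl] := leqP l d; last first.
  rewrite bin_small // oppr0 mul0r big1 ?mulr0 // => t _.
  by rewrite ltn_eqF ?mul0r ?mulr0 // (leq_ltn_trans _ dl) // -ltnS.
have ld1 : (l < d.+1)%N by rewrite ltnS.
rewrite (bigD1 (Ordinal ld1)) //= eqxx big1 => [|t tl]; last first.
  rewrite (_ : (t == l :> nat) = false) ?mul0r ?mulr0 //; apply: contraNF tl => /eqP tl.
  by apply/eqP/val_inj.
have -> : (n * l + n * l * p.-1 = n * l * p)%N by rewrite -{1}[(n * l)%N]muln1 -mulnDr add1n prednK.
rewrite exprM addr0 rmorph_nat /A [(_ / x ^+ (n * l)) ^+ p]expr_div_n.
by move: (expf_neq0 p nlE); move: (x ^+ (n * l) ^+ p) => Z Z0; field.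
Qed.

Definition gsum (c : mono_index -> k) : K := \sum_s kap (c s) * (monom s / x).

Lemma gsumE (c : mono_index -> k) : x * gsum c =
  \sum_(j < m) eval_x kap x (\sum_(w : word p h) c (j, w) *: 'X^(wval w)) / y ^+ j.
Proof.
rewrite [RHS](eq_bigr (fun j => \sum_(w : word p h) x * (kap (c (j, w)) * (monom (j, w) / x)))).
  by rewrite [RHS]pair_bigA /gsum mulr_sumr; apply: eq_bigr => -[j w] _.
move=> j _; rewrite rmorph_sum mulr_suml; apply: eq_bigr => w _.
rewrite -mul_polyC rmorphM rmorphXn /= evxX evxC /monom /=.
by move: (expf_neq0 j y0); move: (y ^+ j) => Y Y0; field; rewrite Y0 x0.
Qed.

Lemma gsum_eq0 (c : mono_index -> k) : gsum c = 0 -> forall s, c s = 0.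
Proof.
move=> c0 [j w].
pose R i : {poly k} := if insub i is Some j' then
  \sum_(w : word p h) c (j', w) *: 'X^(wval w) else 0.
have RE (i : 'I_m) : R i = \sum_(w : word p h) c (i, w) *: 'X^(wval w) by rewrite /R valK.
have : \sum_(i < m) eval_x kap x (R i) / y ^+ i = 0.
  have := gsumE c; rewrite c0 mulr0 => E; rewrite [RHS]E.
  by apply: eq_bigr => i _; rewrite RE.
move=> /(mono_free m_gt0 n_gt0 mod) -/(_ j (ltn_ord j)).
rewrite RE => /(congr1 (fun r : {poly k} => r`_(wval w))); rewrite coef0 coef_sum.
rewrite (bigD1 w) //= coefZ coefXn eqxx mulr1 big1 ?addr0 // => v vw.
by rewrite coefZ coefXn (inj_eq (wval_inj p_gt1 h_gt0)) eq_sym (negbTE vw) mulr0.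
Qed.

Lemma gsumD (c c' : mono_index -> k) : gsum (fun s => c s + c' s) = gsum c + gsum c'.
Proof. by rewrite -big_split; apply: eq_bigr => s _; rewrite rmorphD mulrDl. Qed.

Definition lbin (s : mono_index) : k := ('C(mword s.1 fst0, s.2 fst0))%:R.

Lemma rot_bij : bijective frob_rot.
Proof.
exists (iter h.-1 frob_rot) => s.
  by rewrite -iterSr prednK // (iter_rot_h p_gt1 m_gt0 qE).
by rewrite -iterS prednK // (iter_rot_h p_gt1 m_gt0 qE).
Qed.

(** After a reindexing along [frob_rot], [cartier_mono] makes the left-hand side a
    combination of the [p]-th powers of the monomials; a [p]-th root of it is a
    combination of the monomials themselves, which are independent. *)
Lemma cartier_fixed (c : mono_index -> k) : iter p.-1 D (gsum c) + gsum c ^+ p = 0 <->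
  forall s, c s ^+ p = lbin s * c (frob_rot s).
Proof.
have E : iter p.-1 D (gsum c) + gsum c ^+ p =
    \sum_s kap (c s ^+ p - lbin s * c (frob_rot s)) * (monom s / x) ^+ p.
  rewrite /gsum D_iter_sum (reindex frob_rot) /=; last exact: onW_bij rot_bij.
  rewrite -(pFrobenius_autE pK) rmorph_sum -big_split; apply: eq_bigr => s _ /=.
  rewrite D_iter_kap cartier_mono; move: (monom s / x) => M.
  rewrite pFrobenius_autE exprMn rmorphB rmorphM rmorphXn /lbin rmorph_nat /=.
  by ring.
rewrite E; split=> [c0 s|cE]; last first.
  by rewrite big1 // => s _; rewrite cE subrr rmorph0 mul0r.
have [d dE] : exists d : mono_index -> k, forall s, d s ^+ p = c s ^+ p - lbin s * c (frob_rot s).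
  have hd s := closed_fieldX (c s ^+ p - lbin s * c (frob_rot s)) p_gt0.
  by exists (fun s => projT1 (cid (hd s))) => t; case: cid.
have d0 : gsum d = 0.
  have : gsum d ^+ p = 0.
    rewrite -c0 -(pFrobenius_autE pK) rmorph_sum; apply: eq_bigr => t _ /=.
    by rewrite pFrobenius_autE exprMn -rmorphXn dE.
  by move/eqP; rewrite expf_eq0 p_gt0 => /eqP.
by apply/eqP; rewrite -subr_eq0 -dE (gsum_eq0 d0) expr0n gtn_eqF.
Qed.

Lemma lbin_neq0 s : (lbin s != 0) = (s.2 fst0 <= mword s.1 fst0)%N.
Proof.
rewrite /lbin -(dvdn_pcharf pk); set d := mword _ _; have := ltn_ord d.
move: (nat_of_ord d) (nat_of_ord (s.2 fst0)) => {}d l dp; have [ld|dl] := leqP l d; last first.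
  by rewrite bin_small // dvdn0.
apply/negP => pC; have : (p %| d`!)%N by rewrite -(bin_fact ld) dvdn_mulr.
apply/negP; elim: d {ld pC} dp => [_|d IH dp]; first by rewrite fact0 dvdn1 gtn_eqF.
by rewrite factS Euclid_dvdM // negb_or IH ?gtnNdvd // ltnW.
Qed.

(** If [c s] is nonzero, the system forces [c], and with it [lbin], to be nonzero
    along the orbit of [s]; this compares the words [s.2] and [mword s.1] digit by
    digit.  Holomorphy excludes the two extreme words. *)
Lemma log_hol g : hol m e y g /\ iter p.-1 D g + g ^+ p = 0 <->
  exists c : mono_index -> k, [/\ g = gsum c, forall s, c s ^+ p = lbin s * c (frob_rot s) &
    forall s, c s != 0 -> ordinary p_gt1 m_gt0 s].
Proof.
split=> [[hg gE]|[c [-> cE cS]]]; last first.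
  split; last exact/cartier_fixed.
  apply: hol_sum => s _; have [->|cs] := eqVneq (c s) 0.
    rewrite rmorph0 mul0r => P; rewrite mulr0 mulr0; split=> _; exact: vge0f.
  apply: hol_kap; apply: (hol_mono m_gt0 n_gt0 nE mod) => //.
  exact: (ordinary_bounds h_gt0 qE (cS s cs)).
have [R [Rb RE]] := hol_expand m_gt0 n_gt0 nE mk nk mod hg.
pose c (s : mono_index) := (R s.1)`_(wval s.2).
have gc : g = gsum c.
  apply: (mulfI x0); rewrite gsumE RE; apply: eq_bigr => j _; congr (_ / _).
  congr (eval_x _ _ _); apply/polyP => i.
  rewrite (sum_wval p_gt1 h_gt0 (fun i => (R j)`_i *: 'X^i)) coef_sum.
  have [iq|iq] := ltnP i (p ^ h); last first.
    rewrite big1 => [|l _].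
      apply/eqP; apply: contraLR iq => /Rb/andP[_ ij]; rewrite -ltnNge.
      apply: (leq_trans ij); rewrite (leq_trans (_ : j * e <= m * e)%N) //.
        by rewrite leq_mul2r ltnW ?orbT.
      by rewrite -qE leq_subr.
    by rewrite coefZ coefXn gtn_eqF ?mulr0 // (leq_trans (ltn_ord l)).
  rewrite (bigD1 (Ordinal iq)) //= coefZ coefXn eqxx mulr1 big1 ?addr0 // => l li.
  rewrite coefZ coefXn (_ : (i == l) = false) ?mulr0 //; apply: contraNF li => /eqP li.
  by apply/eqP/val_inj.
rewrite gc in gE; move/cartier_fixed: gE => cE.
exists c; split=> // s cs; have cb t : c t != 0 -> (0 < wval t.2 < t.1 * e)%N by apply: Rb.
have ci i : c (iter i frob_rot s) != 0.
  elim: i => //= i IH; have := cE (iter i frob_rot s).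
  by apply: contra_eq_neq => ->; rewrite mulr0 expf_eq0 negb_and IH orbT.
have bi i : lbin (iter i frob_rot s) != 0.
  have := cE (iter i frob_rot s); apply: contra_eq_neq => ->.
  by rewrite mul0r expf_eq0 negb_and ci orbT.
have /andP[w0 wj] := cb s cs; apply/and3P; split.
- apply/forallP => r; have := bi r; rewrite lbin_neq0.
  by rewrite !(iter_rot_first p_gt1 h_gt0 m_gt0 qE).
- by rewrite -(wval_eq0 p_gt1 h_gt0) -lt0n.
- apply: contraTneq wj => ->; rewrite (wval_mword p_gt1 h_gt0 m_gt0 qE) ltnn.
  by [].
Qed.

End Cartier.

(** * The p-torsion of the Jacobian *)

Lemma div0_valB (T : choiceType) (E F : div0 T) :
  div0_val (E - F) = div0_val E - div0_val F.
Proof. exact: (raddfB (\val : div0 T -> {freeg T})). Qed.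

Lemma div0_valMn (T : choiceType) (E : div0 T) i :
  div0_val (E *+ i) = div0_val E *+ i.
Proof. exact: (raddfMn (\val : div0 T -> {freeg T})). Qed.

Section Jacobian.
Variables (k : closedFieldType) (K : fieldExtType (ratfun k)).

Definition cls (E : div0 (place K)) : Jac K := \pi_(Jac K)%qT E.

Lemma cls_is_zmod_morphism : zmod_morphism cls.
Proof. by move=> E F; rewrite /cls raddfB. Qed.
HB.instance Definition _ := GRing.isZmodMorphism.Build _ _ cls cls_is_zmod_morphism.

Lemma cls_eq0 E : cls E = 0 <-> E \in @principal k K.
Proof.
split=> [h|h].
  have : cls E = cls 0 by rewrite raddf0.
  by move=> /eqP; rewrite /cls -Quotient.idealrBE subr0.
rewrite -(raddf0 cls); apply/eqP; rewrite /cls -Quotient.idealrBE subr0 //.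
Qed.

Lemma cls_surj c : exists E, c = cls E.
Proof. by exists (repr c); rewrite /cls reprK. Qed.

End Jacobian.

Section PRank.
Variables (k : closedFieldType) (K : fieldExtType (ratfun k)).
Variables (p h m n e : nat) (m_gt0 : (0 < m)%N) (n_gt0 : (0 < n)%N) (nE : n = (m * e)%N).
Variables (mk : m%:R != 0 :> k) (nk : n%:R != 0 :> k).
Variables (p_prime : prime p) (h_gt0 : (0 < h)%N).
Variables (iota : {rmorphism 'F_p -> k}).
Variables (pk : p \in [pchar k]) (pK : p \in [pchar K]).
Hypothesis qE : (p ^ h - 1 = m * e)%N.
Local Notation kap := (kap K).
Local Notation x := (xK K).
Variables (y : K) (mod : model kap m n x y).
Let p_gt1 : (1 < p)%N := prime_gt1 p_prime.
Let p_gt0 : (0 < p)%N := prime_gt0 p_prime.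

Variable (D : {additive K -> K}).
Hypothesis DM : forall f g, D (f * g) = D f * g + f * D g.
Hypothesis Dx : D x = 1.

Let xP : p_basis pK x.
Proof.
apply: (curve_p_basis m_gt0 n_gt0 nE mk nk pK h_gt0 _ mod).
by rewrite nE -qE -addn1 subnK // expn_gt0 p_gt0.
Qed.

(** Constants are [p]-th powers, because [k] is perfect. *)
Lemma D_kap c : D (kap c) = 0.
Proof. by have [d <-] := closed_fieldX c p_gt0; rewrite rmorphXn (Dp pK DM). Qed.

Lemma div_divisible f : f != 0 -> (forall P : place K, (p%:Z %| P f)%Z) ->
  exists E : div0 (place K), forall P : place K, coeff P (E : {freeg _}) *+ p = P f.
Proof.
move=> f0 fp; have [s us sP] := support_ex m_gt0 n_gt0 nE mk nk mod f0.
have [E [EP _]] : exists E : {freeg place K}, (forall P, coeff P E = (P f %/ p)%Z) /\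
    deg E = \sum_(P <- s) (P f %/ p)%Z.
  by apply: freeg_ex => // P Pf; apply: sP; apply: contraNneq Pf => ->; rewrite div0z.
have Ep P : coeff P E *+ p = P f by rewrite EP -mulr_natr natz divzK.
have dE : deg E = 0.
  have dP : is_div (E *+ p) f by move=> P; rewrite coeffMn Ep.
  have := principal_deg0 m_gt0 n_gt0 nE mk nk mod f0 dP; rewrite degMn => /eqP.
  by rewrite mulrn_eq0 gtn_eqF //= => /eqP.
have Ed : E \in @deg0_pred (place K) by rewrite unfold_in dE.
by exists (Div0 Ed).
Qed.

Definition ord_index := {s : mono_index p h m | ordinary p_gt1 m_gt0 s}.

HB.instance Definition _ := Finite.on ord_index.

Definition ord_rot (u : ord_index) : ord_index :=
  exist _ (frob_rot m_gt0 (val u)) (ordinary_rot qE (valP u)).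

Lemma iter_ord_rot i u : val (iter i ord_rot u) = iter i (frob_rot m_gt0) (val u).
Proof. by elim: i => //= i ->. Qed.

Lemma iter_ord_rot_h u : iter h ord_rot u = u.
Proof. by apply: val_inj; rewrite iter_ord_rot (iter_rot_h p_gt1 m_gt0 qE). Qed.

Definition obeta (u : ord_index) : k := (lbin k m_gt0 p_prime h_gt0 (val u))^-1.

Lemma lbin_ordinary (s : mono_index p h m) : ordinary p_gt1 m_gt0 s -> lbin k m_gt0 p_prime h_gt0 s != 0.
Proof. by move=> /and3P[/forallP le _ _]; rewrite lbin_neq0. Qed.

Lemma obeta_neq0 u : obeta u != 0.
Proof. by rewrite invr_eq0 lbin_ordinary // (valP u). Qed.

Definition ext0 (c : ord_index -> k) (s : mono_index p h m) : k := oapp c 0 (insub s).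

Lemma ext0E c u : ext0 c (val u) = c u.
Proof. by rewrite /ext0 valK. Qed.

Lemma ext0_supp c s : ext0 c s != 0 -> ordinary p_gt1 m_gt0 s.
Proof. by rewrite /ext0; case: insubP => //=; rewrite eqxx. Qed.

Lemma ordinary_rot_inv (s : mono_index p h m) : ordinary p_gt1 m_gt0 (frob_rot m_gt0 s) -> ordinary p_gt1 m_gt0 s.
Proof.
move=> os; have -> : s = iter h.-1 (frob_rot m_gt0) (frob_rot m_gt0 s).
  by rewrite -iterSr prednK // (iter_rot_h p_gt1 m_gt0 qE).
by elim: h.-1 => //= i IH; apply: (ordinary_rot qE).
Qed.

Lemma ext0_fixed c : fixed p ord_rot obeta c <->
  forall s, ext0 c s ^+ p = lbin k m_gt0 p_prime h_gt0 s * ext0 c (frob_rot m_gt0 s).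
Proof.
split=> [cf s|cE u]; last first.
  have := cE (val u); rewrite -[frob_rot _ _]/(val (ord_rot u)) !ext0E => ->.
  by rewrite /obeta mulKf // lbin_ordinary // (valP u).
have [os|os] := boolP (ordinary p_gt1 m_gt0 s).
  have -> : s = val (exist _ s os : ord_index) by [].
  rewrite -[frob_rot _ _]/(val (ord_rot (exist _ s os))) !ext0E cf mulrA.
  by rewrite /obeta mulfV ?mul1r // lbin_ordinary.
have z (t : mono_index p h m) : ~~ ordinary p_gt1 m_gt0 t -> ext0 c t = 0.
  by apply: contraNeq => /ext0_supp.
rewrite !z //; last by apply: contraNN os => /ordinary_rot_inv.
by rewrite mulr0 expr0n gtn_eqF.
Qed.

Definition fixvec : 'I_#|{: ord_index}| -> ord_index -> k :=
  projT1 (cid (lang iota p_prime pk h_gt0 iter_ord_rot_h obeta_neq0)).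

Lemma fixvecP : [/\ forall i, fixed p ord_rot obeta (fixvec i),
  forall c, fixed p ord_rot obeta c -> exists d : 'rV['F_p]_#|{: ord_index}|,
    forall u, c u = \sum_i iota (d 0 i) * fixvec i u &
  forall d : 'rV['F_p]_#|{: ord_index}|,
    (forall u, \sum_i iota (d 0 i) * fixvec i u = 0) -> d = 0].
Proof. by rewrite /fixvec; case: cid. Qed.

(** The holomorphic logarithmic differential with given coordinates in the
    basis of fixed vectors. *)
Definition logdiff (d : 'rV['F_p]_#|{: ord_index}|) : K :=
  gsum y (ext0 (fun u => \sum_i iota (d 0 i) * fixvec i u)).

Lemma logdiff_zmod : zmod_morphism logdiff.
Proof.
suff add d d' : logdiff (d + d') = logdiff d + logdiff d'.
  by move=> d d'; apply: (addIr (logdiff d')); rewrite -add !subrK.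
rewrite /logdiff -gsumD; congr (gsum _ _); apply: funext => s.
rewrite /ext0; case: insub => [u|] /=; last by rewrite addr0.
by rewrite -big_split; apply: eq_bigr => i _; rewrite mxE rmorphD mulrDl.
Qed.
HB.instance Definition _ := GRing.isZmodMorphism.Build _ _ logdiff logdiff_zmod.

Lemma logdiff_inj d : logdiff d = 0 -> d = 0.
Proof.
move=> d0; have [_ _] := fixvecP; apply => u.
by have := gsum_eq0 m_gt0 n_gt0 p_prime h_gt0 mod d0 (val u); rewrite ext0E.
Qed.

Lemma logdiffP g : (hol m e y g /\ exists2 f, f != 0 & D f = g * f) <->
  exists d, g = logdiff d.
Proof.
have Dk := D_kap; have [Vf Vg _] := fixvecP.
have lg := log_diff pk pK DM Dk (D_iterp xP DM Dx) g.
have lh := log_hol m_gt0 n_gt0 nE mk nk p_prime h_gt0 pk pK qE mod DM Dk Dx g.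
split=> [[hg /lg gE]|[d gE]].
  have [c [-> cE cS]] := lh.1 (conj hg gE).
  have cx : c = ext0 (fun u => c (val u)).
    apply: funext => s; rewrite /ext0; case: insubP => [u _ <-//|os].
    by apply/eqP; apply: contraNT os; apply: cS.
  have /Vg[d dE] : fixed p ord_rot obeta (fun u => c (val u)) by apply/ext0_fixed; rewrite -cx.
  exists d; rewrite cx /logdiff; congr (gsum _ (ext0 _)); exact: funext.
suff [hg gL] : hol m e y g /\ iter p.-1 D g + g ^+ p = 0 by split=> //; apply/lg.
apply/lh; rewrite gE; exists (ext0 (fun u => \sum_i iota (d 0 i) * fixvec i u)).
split=> //; last by move=> s; apply: ext0_supp.
apply/ext0_fixed => u; rewrite (sum_exprp pk) mulr_sumr; apply: eq_bigr => i _.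
rewrite exprMn Vf mulrCA -rmorphXn; congr (_ * (iota _ * _)); apply/esym.
have := congr1 (fun P => P.[d 0 i]) (finField_genPoly 'F_p).
rewrite card_Fp // !hornerE ?hornerXn horner_prod (bigD1 (d 0 i)) //= !hornerE subrr mul0r.
by move/eqP; rewrite subr_eq0 => /eqP.
Qed.

(** [logdiff d] is the logarithmic derivative of a function [f] whose divisor is
    [p] times a divisor of class [c].  This relation turns out to be the graph of
    an isomorphism from logarithmic differentials to [p]-torsion classes. *)
Definition attached (d : 'rV['F_p]_#|{: ord_index}|) (c : Jac K) := exists f : K,
  [/\ f != 0, D f = logdiff d * f & exists2 E : div0 (place K),
    forall P : place K, coeff P (E : {freeg _}) *+ p = P f & c = cls E].

Lemma dlogE f g : f != 0 -> D f = g * f -> D f / f = g.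
Proof. by move=> f0 ->; rewrite mulfK. Qed.

Lemma attached_ex d : exists c, attached d c.
Proof.
have [hg [f f0 fE]] := (logdiffP _).2 (ex_intro _ d erefl).
have [|E EP] := div_divisible f0; last by exists (cls E), f; split=> //; exists E.
apply/(hol_dlog m_gt0 n_gt0 nE mk nk pK mod DM D_kap Dx f0).
by rewrite (dlogE f0 fE).
Qed.

Lemma attachedB d d' c c' : attached d c -> attached d' c' -> attached (d - d') (c - c').
Proof.
move=> [f [f0 fE [E EP ->]]] [g [g0 gE [F FP ->]]]; exists (f / g).
have fg0 : f / g != 0 by rewrite mulf_neq0 // invr_eq0.
split=> //; last first.
  exists (E - F) => [P|]; last by rewrite raddfB.
  by rewrite div0_valB coeffB mulrnBl EP FP (val_div (place_valuation P)).
apply: (mulIf (_ : (f / g)^-1 != 0)); first by rewrite invr_eq0.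
rewrite (dlogM DM) ?invr_eq0 // (dlogV DM g0) (dlogE f0 fE) (dlogE g0 gE).
by rewrite raddfB mulfK.
Qed.

(** If [D f = 0] then [f = g ^ p], and the divisor of [f] is [p] times that of [g]. *)
Lemma attached0 c : attached 0 c -> c = 0.
Proof.
move=> [f [f0 fE [E EP ->]]]; apply/cls_eq0/asboolP.
have /(D_eq0 xP DM Dx)[g gE] : D f = 0 by rewrite fE raddf0 mul0r.
have g0 : g != 0 by apply: contraNneq f0 => h0; rewrite gE h0 expr0n gtn_eqF.
exists g => // P; have := EP P; rewrite gE (valX (place_valuation P)) => /eqP.
by rewrite -subr_eq0 -mulrnBl mulrn_eq0 gtn_eqF //= subr_eq0 => /eqP.
Qed.

Lemma attached_uniq d c c' : attached d c -> attached d c' -> c = c'.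
Proof.
move=> dc dc'; have := attachedB dc dc'; rewrite subrr => /attached0/eqP.
by rewrite subr_eq0 => /eqP.
Qed.

Definition torsion_class d := projT1 (cid (attached_ex d)).

Lemma torsion_classP d : attached d (torsion_class d).
Proof. by rewrite /torsion_class; case: cid. Qed.

Lemma torsion_class_zmod : zmod_morphism torsion_class.
Proof.
move=> d d'; apply: (attached_uniq (torsion_classP _)).
by apply: attachedB; apply: torsion_classP.
Qed.
HB.instance Definition _ := GRing.isZmodMorphism.Build _ _ torsion_class torsion_class_zmod.

(** If the class is that of the divisor of [g], then [f / g ^ p] has neither zeros
    nor poles, hence is constant, and [D f = 0]. *)
Lemma torsion_class_eq0 d : torsion_class d = 0 -> d = 0.
Proof.
have [f [f0 fE [E EP ->]]] := torsion_classP d => /cls_eq0/asboolP[g g0 gE].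
have [|P|c cE] := unit_const m_gt0 n_gt0 nE mk nk mod (f := f / g ^+ p).
- by rewrite mulf_neq0 // invr_eq0 expf_neq0.
- have hv := place_valuation P.
  by rewrite (val_div hv) ?expf_neq0 // (valX hv) -gE EP subrr.
apply: logdiff_inj; have f1 : f = g ^+ p * kap c by rewrite -cE mulrC divfK // expf_neq0.
have : D f = 0 by rewrite f1 (DpM pK DM) D_kap mulr0.
by rewrite fE => /eqP; rewrite mulf_eq0 (negbTE f0) orbF => /eqP.
Qed.

(** A [p]-torsion class [c] comes from the logarithmic differential [df / f],
    where [p c] is the divisor of [f]. *)
Lemma torsion_classE c : c *+ p = 0 <-> exists d, torsion_class d = c.
Proof.
split=> [cp|[d <-]]; last first.
  by rewrite -raddfMn -scaler_nat (pcharf0 (pchar_Fp p_prime)) scale0r raddf0.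
have [E cE] := cls_surj c; move: cp; rewrite cE -raddfMn => /cls_eq0/asboolP[f f0 fE].
have fp (P : place K) : coeff P (E : {freeg _}) *+ p = P f by rewrite -fE div0_valMn coeffMn.
have /logdiffP[d dE] : hol m e y (D f / f) /\ exists2 f', f' != 0 & D f' = (D f / f) * f'.
  split; last by exists f; rewrite // divfK.
  apply/(hol_dlog m_gt0 n_gt0 nE mk nk pK mod DM D_kap Dx f0) => P.
  by rewrite -fp -mulr_natr natz dvdz_mull.
exists d; apply: (attached_uniq (torsion_classP d)); exists f; split=> //.
  by rewrite -dE divfK.
by exists E.
Qed.

Lemma p_rank_ordinary : is_p_rank p K #|{: ord_index}|.
Proof.
exists torsion_class; last exact: torsion_classE.
by apply: raddf_inj; exact: torsion_class_eq0.
Qed.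

End PRank.

(** * The formula for the p-rank *)

Lemma big_ord_neq0 m (F : nat -> nat) :
  (\sum_(1 <= j < m) F j = \sum_(j < m | j != 0 :> nat) F j)%N.
Proof.
rewrite -(big_mkord (fun j => j != 0) F); case: m => [|m]; first by rewrite !big_geq.
rewrite [RHS]big_mkcond [RHS]big_ltn //= [LHS]big_nat [X in (0 + X)%N]big_nat.
by apply: eq_bigr => j /andP[j0 _]; rewrite -lt0n j0.
Qed.

Lemma big_shift h (R : Type) (idx : R) (op : Monoid.law idx) (F : nat -> R) :
  \big[op/idx]_(1 <= r < h.+1) F r = \big[op/idx]_(r < h) F r.+1.
Proof. by rewrite big_add1 big_mkord. Qed.

(** Base [p] expansions are unique, so the digits [a j] are those of [mword j]. *)
Lemma sum_digit_products p h m e (p_gt1 : (1 < p)%N) (h_gt0 : (0 < h)%N) (m_gt0 : (0 < m)%N)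
    (qE : (p ^ h - 1 = m * e)%N) (a : nat -> nat -> nat) :
  (forall j r : nat, (1 <= j < m)%N -> (1 <= r <= h)%N -> (a j r < p)%N) ->
  (forall j : nat, (1 <= j < m)%N ->
     (j * (p ^ h - 1) %/ m = \sum_(1 <= r < h.+1) a j r * p ^ (h - r))%N) ->
  (\sum_(1 <= j < m) \prod_(1 <= r < h.+1) (a j r + 1) =
   \sum_(j < m | j != 0 :> nat) \prod_(r < h) (mword h p_gt1 m_gt0 j r + 1))%N.
Proof.
move=> ap aE; rewrite big_ord_neq0; apply: eq_bigr => j j0.
have jm : (1 <= j < m)%N by rewrite lt0n j0 ltn_ord.
have ar (r : 'I_h) : (a j r.+1 < p)%N by apply: ap; rewrite //= ltn_ord.
pose w : word p h := [ffun r => Ordinal (ar r)].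
have wE : w = mword h p_gt1 m_gt0 j.
  apply: (wval_inj p_gt1 h_gt0); rewrite (wval_mword p_gt1 h_gt0 m_gt0 qE).
  have := aE _ jm; rewrite qE mulnCA mulKn // => ->; rewrite (big_shift h).
  by apply: eq_bigr => r _; rewrite ffunE /=; congr (_ * p ^ _)%N; case: h r {aE ap ar w qE h_gt0}.
by rewrite (big_shift h) -wE; apply: eq_bigr => r _; rewrite ffunE.
Qed.

Theorem theorem4p2 (p m h : nat) (p_prime : prime p) (m_gt1 : (1 < m)%N)
  (h_gt0 : (0 < h)%N) (m_dvd : (m %| p ^ h - 1)%N)
  (k : closedFieldType) (iota : {rmorphism 'F_p -> k})
  (k_closure : algebraic_closure_Fp iota)
  (K : fieldExtType {fraction {poly k}})
  (K_F : function_field_of (curve_F k m (p ^ h - 1)) K) :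
  exists gamma : nat,
    [/\ is_p_rank p K gamma,
        forall a : nat -> nat -> nat,
          (forall j r : nat, (1 <= j < m)%N -> (1 <= r <= h)%N ->
             (a j r < p)%N) ->
          (forall j : nat, (1 <= j < m)%N ->
             (j * (p ^ h - 1) %/ m
              = \sum_(1 <= r < h.+1) a j r * p ^ (h - r))%N) ->
          gamma%:Z = (\sum_(1 <= j < m) \prod_(1 <= r < h.+1) (a j r + 1))%N%:Z
                     - 2 * (m%:Z - 1)
      & (m %| p - 1)%N ->
        gamma%:Z = (\sum_(1 <= j < m) (j * (p - 1) %/ m + 1) ^ h)%N%:Z
                   - 2 * (m%:Z - 1)].
Proof.
have p_gt1 := prime_gt1 p_prime; have p_gt0 := prime_gt0 p_prime.
have m_gt0 : (0 < m)%N by apply: ltnW.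
have q_gt1 : (1 < p ^ h)%N by rewrite -(expn0 p) ltn_exp2l.
set n := (p ^ h - 1)%N in m_dvd K_F *.
have n_gt0 : (0 < n)%N by rewrite subn_gt0.
pose e := (n %/ m)%N.
have nE : n = (m * e)%N by rewrite mulnC divnK.
have e_gt0 : (0 < e)%N by rewrite divn_gt0 // dvdn_leq.
have pk : p \in [pchar k] by apply: (rmorph_pchar iota); exact: pchar_Fp.
have pK : p \in [pchar K] by apply: (rmorph_pchar (kap K)).
have nk : n%:R != 0 :> k.
  rewrite -(dvdn_pcharf pk); apply/negP => pn.
  have : (p %| p ^ h)%N by rewrite -(prednK h_gt0) expnS dvdn_mulr.
  rewrite -(subnK (ltnW q_gt1)) dvdn_addr // dvdn1 => /eqP p1.
  by rewrite p1 in p_gt1.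
have mk : m%:R != 0 :> k.
  by apply: contraNneq nk => m0; rewrite nE natrM m0 mul0r.
have [y mod] := curve_model m_gt0 n_gt0 mk nk K_F.
have xP : p_basis pK (xK K).
  by apply: (curve_p_basis m_gt0 n_gt0 nE mk nk pK h_gt0 _ mod); rewrite /n subn1 prednK ?expn_gt0 ?p_gt0.
have [D [DM Dx]] := derivation_ex xP.
have qE : (p ^ h - 1 = m * e)%N by [].
have count := card_ordinary p_gt1 h_gt0 m_gt0 qE e_gt0.
have gE : #|{: ord_index h m_gt0 p_prime}| =
    #|[set s : mono_index p h m | ordinary (prime_gt1 p_prime) m_gt0 s]|.
  by rewrite card_sig cardsE.
have formula (a : nat -> nat -> nat) :
  (forall j r : nat, (1 <= j < m)%N -> (1 <= r <= h)%N -> (a j r < p)%N) ->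
  (forall j : nat, (1 <= j < m)%N ->
     (j * (p ^ h - 1) %/ m = \sum_(1 <= r < h.+1) a j r * p ^ (h - r))%N) ->
  #|{: ord_index h m_gt0 p_prime}|%:Z =
    (\sum_(1 <= j < m) \prod_(1 <= r < h.+1) (a j r + 1))%N%:Z - 2 * (m%:Z - 1).
  move=> ap aE; rewrite (sum_digit_products p_gt1 h_gt0 m_gt0 qE ap aE) -count gE.
  rewrite (_ : prime_gt1 p_prime = p_gt1); last exact: bool_irrelevance.
  by have := m_gt1; move: #|_|; clear; lia.
exists #|{: ord_index h m_gt0 p_prime}|; split=> //.
  exact: (p_rank_ordinary m_gt0 n_gt0 nE mk nk p_prime h_gt0 iota pk pK qE mod DM Dx).
move=> mp; pose f := ((p - 1) %/ m)%N.
have fE : (p - 1 = m * f)%N by rewrite mulnC divnK.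
have dE (j : nat) : (j * (p - 1) %/ m = j * f)%N by rewrite fE mulnCA mulKn.
rewrite (formula (fun j _ => (j * (p - 1) %/ m)%N)).
- congr (_%:Z - _); rewrite [LHS]big_nat [RHS]big_nat; apply: eq_bigr => j _.
  by rewrite prod_nat_const_nat subSS subn0.
- move=> j r /andP[_ jm] _; rewrite ltn_divLR //.
  apply: (@leq_ltn_trans (m * (p - 1))%N); first by rewrite leq_mul2r ltnW ?orbT.
  by rewrite mulnC ltn_pmul2r // subn1 prednK.
- move=> j jm; rewrite (eq_bigr (fun r => j * f * p ^ (h - r))%N) => [|r _]; last by rewrite dE.
  rewrite -big_distrr /= big_nat_rev /= (big_shift h).
  rewrite (eq_bigr (fun r : 'I_h => p ^ r)%N) => [|r _]; last first.
    by congr (p ^ _)%N; have := ltn_ord r; lia.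
  have -> : (p ^ h - 1 = m * f * \sum_(r < h) p ^ r)%N by rewrite -fE !subn1 predn_exp.
  by rewrite -mulnA mulnCA mulKn // mulnA.
Qed.
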